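(* Let $G$ be a finite abelian group and $\mathbb{F}$ an algebraically closed field. Let $\mathcal{A}$ and $\mathcal{A}'$ be direct limits of matrix algebras over $\mathbb{F}$ endowed with elementary $G$-gradings. Let $\mathcal{D}$ and $\mathcal{D}'$ be $G$-graded-division algebras that are central simple as algebras, and write $\mathcal{D}\otimes\mathcal{D}'^{\mathrm{op}}\cong\mathrm{M}_y(\mathcal{E})$ where $0\ne y\in\mathbb{Z}_{\ge0}G$ and $\mathcal{E}$ is a graded-division algebra. Denote by $T'$ and $E$ the supports of $\mathcal{D}'$ and $\mathcal{E}$, respectively, and put $x_H=\sum_{h\in H}h\in\mathbb{Z}_{\ge0}G$ for any subgroup $H\le G$. Then $\mathcal{A}\otimes\mathcal{D}\cong\mathcal{A}'\otimes\mathcal{D}'$ as $G$-graded algebras if and only if (i) $x_E\cdot K_0^{\mathrm{gr}}(\mathcal{A})^+=K_0^{\mathrm{gr}}(\mathcal{A})^+$, and (ii) $\mathrm{M}_y\otimes\mathcal{A}\cong\mathrm{M}_{x_{T'}}\otimes\mathcal{A}'$ as $G$-graded algebras.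
   Context: All algebras are associative and unital over $\mathbb{F}$; central simple algebras are finite-dimensional. A $G$-grading on $\mathcal{A}$ is a decomposition $\mathcal{A}=\bigoplus_{g\in G}\mathcal{A}_g$ into subspaces with $\mathcal{A}_g\mathcal{A}_h\subseteq\mathcal{A}_{gh}$; homomorphisms of graded algebras preserve components, and $\cong$ means isomorphism of graded algebras. The support is $\{g\mid\mathcal{A}_g\ne0\}$. A graded-division algebra is a $G$-graded unital algebra in which every nonzero homogeneous element is invertible; its support is a subgroup of $G$. Tensor products (over $\mathbb{F}$) are graded by $\deg(a\otimes b)=\deg a\deg b$; the opposite algebra $\mathcal{D}^{\mathrm{op}}$ is graded by the same homogeneous components as $\mathcal{D}$. For $0\ne x=\sum_g x_g g\in\mathbb{Z}_{\ge0}G$ and a $G$-graded algebra $\mathcal{B}$, let $n=\sum_g x_g$ and choose $(g_1,\dots,g_n)\in G^n$ in which each $g$ occurs $x_g$ times. $\mathrm{M}_x(\mathcal{B})$ is $\mathrm{M}_n(\mathcal{B})$ with the grading $\deg E_{ij}(b)=g_i(\deg b)g_j^{-1}$ for nonzero homogeneous $b\in\mathcal{B}$, where $E_{ij}(b)$ has $b$ in position $(i,j)$ and zeros elsewhere; it is well defined up to graded isomorphism. $\mathrm{M}_x:=\mathrm{M}_x(\mathbb{F})$; these gradings on matrix algebras over $\mathbb{F}$ are called elementary. By the graded Wedderburn theorem, a decomposition $\mathcal{D}\otimes\mathcal{D}'^{\mathrm{op}}\cong\mathrm{M}_y(\mathcal{E})$ as in the claim always exists, with $\mathcal{E}$ unique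 up to isomorphism. ''Direct limit of matrix algebras with elementary gradings'' means the direct limit of a sequence $\mathcal{A}_0\to\mathcal{A}_1\to\mathcal{A}_2\to\cdots$ of unital embeddings of graded algebras, where each $\mathcal{A}_i$ is a matrix algebra over $\mathbb{F}$ with an elementary grading. Graded $K_0$: for a unital $G$-graded algebra $\mathcal{A}$, $K_0^{\mathrm{gr}}(\mathcal{A})^+$ is the commutative monoid (under $\oplus$) of isomorphism classes $[P]$ of finitely generated projective graded left $\mathcal{A}$-modules; $K_0^{\mathrm{gr}}(\mathcal{A})$ is its group completion, a $\mathbb{Z}G$-module via $g[P]=[P^{[g]}]$, where $P^{[g]}_h=P_{hg^{-1}}$. The positive cone $K_0^{\mathrm{gr}}(\mathcal{A})^+$ is invariant under the action of $\mathbb{Z}_{\ge0}G$. *)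

(* Defs.v *)
From HB Require Import structures.
From mathcomp Require Import all_boot all_order all_algebra.
From mathcomp Require Import boolp classical_sets.

Set Implicit Arguments.
Unset Strict Implicit.
Unset Printing Implicit Defensive.

Import GRing.Theory.
Local Open Scope classical_set_scope.
Local Open Scope ring_scope.
Local Open Scope quotient_scope.

(** A finite abelian group is a [finZmodType], hence written additively: the
    product gh is [g + h] and g^{-1} is [- g].  An algebra is an [algType] over
    a field: associative, unital and nonzero.  An element x of Z_{>=0}G is a
    function [x : {ffun G -> nat}] giving its coefficients. *)

(** The vector space [tens U V] consists of formal sums of pairs
    [(u_1, v_1) + ... + (u_n, v_n)], two of them being identified when no
    bilinear map on [U * V] distinguishes them; scalars can be absorbed into
    the first factor.  With this relation the universal property of the tensor
    product holds by construction, see [tlift_pure] and [tlift_is_linear]. *)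

Section TensorSpace.
Variables (F : fieldType) (U V : lmodType F).
Implicit Types s t : seq (U * V).

Notation is_bilinear f := (bilinear_for *:%R *:%R f).

Definition fsum (W : lmodType F) (f : U -> V -> W) s : W :=
  \sum_(p <- s) f p.1 p.2.

Definition tens_equiv s t : Prop :=
  forall (W : lmodType F) (f : U -> V -> W),
    is_bilinear f -> fsum f s = fsum f t.

Definition tens_rel s t : bool := `[< tens_equiv s t >].

Lemma tens_rel_refl : reflexive tens_rel.
Proof. by move=> s; apply/asboolP. Qed.

Lemma tens_rel_sym : symmetric tens_rel.
Proof.
by move=> s t; apply/asboolP/asboolP => st W f bf; rewrite st.
Qed.

Lemma tens_rel_trans : transitive tens_rel.
Proof.
move=> s t u /asboolP ts /asboolP su.
by apply/asboolP => W f bf; rewrite ts // su.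
Qed.

Canonical tens_equiv_rel :=
  EquivRel tens_rel tens_rel_refl tens_rel_sym tens_rel_trans.

Definition tens := {eq_quot tens_equiv_rel}.

HB.instance Definition _ := Choice.on tens.

Definition mktens s : tens := \pi_({eq_quot tens_equiv_rel}) s.

Definition tlift (W : lmodType F) (f : U -> V -> W) (x : tens) : W :=
  fsum f (repr (x : {eq_quot tens_equiv_rel})).

Lemma tlift_mktens (W : lmodType F) (f : U -> V -> W) s :
  is_bilinear f -> tlift f (mktens s) = fsum f s.
Proof.
move=> bf; rewrite /tlift /mktens.
have /eqmodP/asboolP H :
  repr (\pi_({eq_quot tens_equiv_rel}) s) = s %[mod {eq_quot tens_equiv_rel}].
  by rewrite reprK.
exact: H.
Qed.

Lemma tens_ext (x y : tens) :
  (forall (W : lmodType F) (f : U -> V -> W),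
     is_bilinear f -> tlift f x = tlift f y) -> x = y.
Proof.
move=> H; rewrite -[x](@reprK _ {eq_quot tens_equiv_rel}).
rewrite -[y](@reprK _ {eq_quot tens_equiv_rel}).
by apply/eqmodP/asboolP => W f bf; apply: H.
Qed.

Lemma mktens_surj (x : tens) : exists s, x = mktens s.
Proof. by exists (repr (x : {eq_quot tens_equiv_rel})); rewrite /mktens reprK. Qed.

Definition tzero : tens := mktens [::].
Definition tadd (x y : tens) : tens :=
  mktens (repr (x : {eq_quot tens_equiv_rel}) ++
          repr (y : {eq_quot tens_equiv_rel})).
Definition tscale (c : F) (x : tens) : tens :=
  mktens [seq (c *: p.1, p.2) | p <- repr (x : {eq_quot tens_equiv_rel})].
Definition topp (x : tens) : tens := tscale (- 1) x.

Section Lift.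
Variables (W : lmodType F) (f : U -> V -> W).
Hypothesis bf : is_bilinear f.

Lemma bilDl u u' v : f (u + u') v = f u v + f u' v.
Proof. by have := bf.1 v 1 u u'; rewrite /= !scale1r. Qed.

Lemma bilZl c u v : f (c *: u) v = c *: f u v.
Proof.
have f0 : f 0 v = 0.
  by apply: (addrI (f 0 v)); rewrite -bilDl !addr0.
by have := bf.1 v c u 0; rewrite /= !addr0 f0 addr0.
Qed.

Lemma bilDr u v v' : f u (v + v') = f u v + f u v'.
Proof. by have := bf.2 u 1 v v'; rewrite /= !scale1r. Qed.

Lemma bilZr c u v : f u (c *: v) = c *: f u v.
Proof.
have f0 : f u 0 = 0 by apply: (addrI (f u 0)); rewrite -bilDr !addr0.
by have := bf.2 u c v 0; rewrite /= !addr0 f0 addr0.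
Qed.

Lemma tlift0 : tlift f tzero = 0.
Proof. by rewrite tlift_mktens // /fsum big_nil. Qed.

Lemma tliftD x y : tlift f (tadd x y) = tlift f x + tlift f y.
Proof. by rewrite tlift_mktens // /fsum big_cat. Qed.

Lemma tliftZ c x : tlift f (tscale c x) = c *: tlift f x.
Proof.
rewrite tlift_mktens // /tlift /fsum big_map scaler_sumr.
by apply: eq_bigr => p _; rewrite bilZl.
Qed.

Lemma tliftN x : tlift f (topp x) = - tlift f x.
Proof. by rewrite tliftZ scaleN1r. Qed.

End Lift.

Lemma taddA : associative tadd.
Proof. by move=> x y z; apply: tens_ext => W f bf; rewrite !tliftD // addrA. Qed.
Lemma taddC : commutative tadd.
Proof. by move=> x y; apply: tens_ext => W f bf; rewrite !tliftD // addrC. Qed.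
Lemma tadd0 : left_id tzero tadd.
Proof. by move=> x; apply: tens_ext => W f bf; rewrite tliftD // tlift0 // add0r. Qed.
Lemma taddN : left_inverse tzero topp tadd.
Proof.
by move=> x; apply: tens_ext => W f bf; rewrite tliftD // tliftN // addNr tlift0.
Qed.

HB.instance Definition _ := GRing.isZmodule.Build tens taddA taddC tadd0 taddN.

Lemma tscaleA a b x : tscale a (tscale b x) = tscale (a * b) x.
Proof. by apply: tens_ext => W f bf; rewrite !tliftZ // scalerA. Qed.
Lemma tscale1 : left_id 1 tscale.
Proof. by move=> x; apply: tens_ext => W f bf; rewrite tliftZ // scale1r. Qed.
Lemma tscaleDr : right_distributive tscale +%R.
Proof.
move=> a x y; apply: tens_ext => W f bf.
by rewrite tliftZ // !tliftD // !tliftZ // scalerDr.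
Qed.
Lemma tscaleDl x : {morph tscale^~ x : a b / a + b}.
Proof.
move=> a b; apply: tens_ext => W f bf.
by rewrite tliftZ // tliftD // !tliftZ // scalerDl.
Qed.

HB.instance Definition _ :=
  GRing.Zmodule_isLmodule.Build F tens tscaleA tscale1 tscaleDr tscaleDl.

Definition pure (u : U) (v : V) : tens := mktens [:: (u, v)].

Lemma tlift_pure (W : lmodType F) (f : U -> V -> W) u v :
  is_bilinear f -> tlift f (pure u v) = f u v.
Proof. by move=> bf; rewrite tlift_mktens // /fsum big_seq1. Qed.

Lemma tlift_is_linear (W : lmodType F) (f : U -> V -> W) :
  is_bilinear f -> linear (tlift f).
Proof. by move=> bf c x y; rewrite tliftD // tliftZ. Qed.

Lemma pure_bilinear : is_bilinear pure.
Proof.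
split=> [v | u] c x y; apply: tens_ext => W f bf;
  by rewrite /= tliftD // tliftZ // !tlift_pure // ?(bilDl, bilDr)
             // ?(bilZl, bilZr).
Qed.

Lemma tlift_sum (W : lmodType F) (f : U -> V -> W) (I : Type) (r : seq I)
    (P : pred I) (E : I -> tens) : is_bilinear f ->
  tlift f (\sum_(i <- r | P i) E i) = \sum_(i <- r | P i) tlift f (E i).
Proof. by move=> bf; apply: big_morph => [x y|]; [apply: tliftD | apply: tlift0]. Qed.

Lemma tens_sum (x : tens) : exists s, x = \sum_(p <- s) pure p.1 p.2.
Proof.
have [s ->] := mktens_surj x; exists s; apply: tens_ext => W f bf.
rewrite tlift_sum // tlift_mktens //.
by apply: eq_bigr => p _; rewrite tlift_pure.
Qed.

Lemma tens_ind (P : tens -> Prop) :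
  P 0 -> (forall u v x, P x -> P (pure u v + x)) -> forall x, P x.
Proof.
move=> P0 PD x; have [s ->] := tens_sum x.
elim: s => [|[u v] s IH]; first by rewrite big_nil.
by rewrite big_cons; apply: PD.
Qed.

End TensorSpace.

(** Every algebra has a linear form sending 1 to 1; this is what makes the
    tensor product of two algebras nonzero. *)

Lemma unit_form (F : fieldType) (A : algType F) :
  exists phi : A -> F, phi 1 = 1 /\ linear_for *%R phi.
Proof.
pose P (W : set A) :=
  (forall (c : F) x y, W x -> W y -> W (c *: x + y)) /\ ~ W 1.
have [Fs FsP Ftot|W [[Wlin W1] Wmax]] := @Zorn_bigcup A P.
  split=> [c x y [X FX Xx] [Y FY Yy] | [X FX]]; last exact: (FsP X FX).2.
  have [XY|YX] := Ftot X Y FX FY.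
  - by exists Y => //; apply: (FsP Y FY).1 => //; apply: XY.
  - by exists X => //; apply: (FsP X FX).1 => //; apply: YX.
have W0 : W 0.
  apply: contrapT => W0.
  have WW x : W x -> W 0 by move=> Wx; rewrite -(addNr x) -scaleN1r; apply: Wlin.
  apply: (Wmax [set 0%R] _ _).
    split; first by move=> x Wx; case: W0; apply: WW Wx.
    by move=> /(_ 0 erefl).
  split=> [c x y -> -> /=|/eqP]; first by rewrite scaler0 addr0.
  by rewrite oner_eq0.
have dec a : exists c : F, W (a - c%:A).
  have [Wa|Wa] := pselect (W a); first by exists 0; rewrite scale0r subr0.
  pose W' : set A := [set x | exists w c, W w /\ x = c *: a + w].
  have [w [c [Ww e1]]] : W' 1.
    apply: contrapT => W'1; apply: (Wmax W' _ _); last first.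
      split=> // k x y [w [c [Ww ->]]] [w' [c' [Ww' ->]]].
      exists (k *: w + w'), (k * c + c'); split; first exact: Wlin.
      by rewrite scalerDr scalerA scalerDl addrACA.
    split; first by move=> x Wx; exists x, 0; rewrite scale0r add0r.
    by move=> /(_ a); apply/not_implyP; split=> //; exists 0, 1; rewrite scale1r addr0.
  have c0 : c != 0.
    by apply/eqP => c0; apply: W1; rewrite e1 c0 scale0r add0r.
  exists c^-1; rewrite e1 scalerDr scalerA mulVf // scale1r opprD addNKr.
  by rewrite -scaleNr -[X in W X]addr0; apply: Wlin.
have {}dec a := cid (dec a).
exists (fun a => sval (dec a)).
have uni a c c' : W (a - c%:A) -> W (a - c'%:A) -> c = c'.
  move=> Wc Wc'; apply/eqP; rewrite -subr_eq0; apply/negP => /negP d0.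
  apply: W1; have := Wlin (-1) _ _ Wc Wc'.
  rewrite scaleN1r opprB addrA subrK -scalerBl => Wd.
  have := Wlin (c - c')^-1 _ _ Wd W0.
  by rewrite scalerA mulVf // scale1r addr0.
split=> [|k x y].
  by apply: (uni 1); [exact: svalP (dec 1) | rewrite scale1r subrr].
apply: (uni (k *: x + y)); first exact: svalP (dec _).
rewrite scalerDl opprD addrACA -scalerA -scalerBr.
by apply: Wlin; [exact: svalP (dec x) | exact: svalP (dec y)].
Qed.

Section TensorAlgebra.
Variables (F : fieldType) (A B : algType F).
Local Notation T := (tens A B).

(* (a ⊗ b)(a' ⊗ b') = aa' ⊗ bb' *)
Definition tmulr_pure (a' : A) (b' : B) (x : T) : T :=
  tlift (fun a b => pure (a * a') (b * b')) x.
Definition tmul (x y : T) : T := tlift (fun a' b' => tmulr_pure a' b' x) y.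
Definition tone : T := pure 1 1.

Let pDl (a a' : A) (b : B) : pure (a + a') b = pure a b + pure a' b :> T.
Proof. exact: bilDl (@pure_bilinear F A B) _ _ _. Qed.
Let pDr (a : A) (b b' : B) : pure a (b + b') = pure a b + pure a b' :> T.
Proof. exact: bilDr (@pure_bilinear F A B) _ _ _. Qed.
Let pZl c (a : A) (b : B) : pure (c *: a) b = c *: pure a b :> T.
Proof. exact: bilZl (@pure_bilinear F A B) _ _ _. Qed.
Let pZr c (a : A) (b : B) : pure a (c *: b) = c *: pure a b :> T.
Proof. exact: bilZr (@pure_bilinear F A B) _ _ _. Qed.

Lemma tmulr_pure_bil a' b' :
  bilinear_for *:%R *:%R (fun a b => pure (a * a') (b * b') : T).
Proof.
split=> [b|a] c x y /=; rewrite /=.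
- by rewrite mulrDl -scalerAl pDl pZl.
- by rewrite mulrDl -scalerAl pDr pZr.
Qed.

Lemma tmulr_pure_linear a b : linear (tmulr_pure a b).
Proof. exact: tlift_is_linear (tmulr_pure_bil a b). Qed.

Lemma tmulr_pureE a b a' b' :
  tmulr_pure a' b' (pure a b) = pure (a * a') (b * b').
Proof. by rewrite /tmulr_pure tlift_pure //; apply: tmulr_pure_bil. Qed.

Lemma tmulr_pure0 a b : tmulr_pure a b 0 = 0.
Proof. exact: tlift0 (tmulr_pure_bil a b). Qed.

Lemma tmulr_pureD a b x y :
  tmulr_pure a b (x + y) = tmulr_pure a b x + tmulr_pure a b y.
Proof. exact: tliftD (tmulr_pure_bil a b) _ _. Qed.

Lemma tmul_bil x :
  bilinear_for *:%R *:%R (fun a' b' => tmulr_pure a' b' x : T).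
Proof.
split=> [b|a] c u v; rewrite /=; elim/tens_ind: x => [|a0 b0 x IH] /=;
  rewrite ?tmulr_pure0 ?scaler0 ?addr0 // !tmulr_pureD IH !tmulr_pureE mulrDr.
- by rewrite -scalerAr pDl pZl scalerDr addrACA.
- by rewrite -scalerAr pDr pZr scalerDr addrACA.
Qed.

Lemma tmul_pure a b a' b' :
  tmul (pure a b) (pure a' b') = pure (a * a') (b * b').
Proof. by rewrite /tmul tlift_pure ?tmulr_pureE //; apply: tmul_bil. Qed.

Lemma tmulDr : right_distributive tmul +%R.
Proof. by move=> x y z; apply: tliftD; apply: tmul_bil. Qed.

Lemma tmul0 x : tmul x 0 = 0.
Proof. by apply: tlift0; apply: tmul_bil. Qed.

Lemma tmulZr c x y : tmul x (c *: y) = c *: tmul x y.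
Proof. by apply: tliftZ; apply: tmul_bil. Qed.

Lemma tmul_purer x a b : tmul x (pure a b) = tmulr_pure a b x.
Proof. by rewrite /tmul tlift_pure //; apply: tmul_bil. Qed.

Lemma tmulDl : left_distributive tmul +%R.
Proof.
move=> x y z; elim/tens_ind: z => [|a b z IH]; first by rewrite !tmul0 addr0.
by rewrite !tmulDr IH !tmul_purer tmulr_pureD addrACA.
Qed.

Lemma tmul0l x : tmul 0 x = 0.
Proof.
elim/tens_ind: x => [|a b x IH]; first exact: tmul0.
by rewrite tmulDr IH tmul_purer tmulr_pure0 addr0.
Qed.

Lemma tmulZl c x y : tmul (c *: x) y = c *: tmul x y.
Proof.
elim/tens_ind: y => [|a b y IH]; first by rewrite !tmul0 scaler0.
rewrite !tmulDr IH !tmul_purer scalerDr; congr (_ + _).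
by apply: tliftZ; apply: tmulr_pure_bil.
Qed.

Lemma tmulA : associative tmul.
Proof.
move=> x y z; elim/tens_ind: z => [|a b z IH]; first by rewrite !tmul0.
rewrite !tmulDr IH; congr (_ + _).
elim/tens_ind: y {IH} => [|a' b' y IH]; first by rewrite tmul0l !tmul0 tmul0l.
rewrite tmulDl !tmulDr IH tmulDl; congr (_ + _).
elim/tens_ind: x {IH} => [|a'' b'' x IH]; first by rewrite !tmul0l.
by rewrite !tmulDl IH !tmul_pure !mulrA.
Qed.

Lemma tmul1l : left_id tone tmul.
Proof.
move=> x; elim/tens_ind: x => [|a b x IH]; first exact: tmul0.
by rewrite tmulDr IH tmul_pure !mul1r.
Qed.

Lemma tmul1r : right_id tone tmul.
Proof.
move=> x; elim/tens_ind: x => [|a b x IH]; first exact: tmul0l.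
by rewrite tmulDl IH tmul_pure !mulr1.
Qed.

Lemma tone_neq0 : tone != 0.
Proof.
have [phi [phi1 philin]] := unit_form A.
pose f (a : A) (b : B) : B := phi a *: b.
have phi0 : phi 0 = 0.
  by have := philin (-1) 0 0; rewrite scaler0 addr0 mulN1r addNr.
have bf : bilinear_for *:%R *:%R f.
  split=> [b|a] c x y; rewrite /f /=.
    by rewrite philin scalerDl scalerA.
  by rewrite scalerDr !scalerA mulrC.
apply/eqP => /(congr1 (tlift f)); rewrite tlift_pure // (tlift0 bf) /f phi1.
by rewrite scale1r => /eqP; rewrite oner_eq0.
Qed.

HB.instance Definition _ := GRing.Zmodule_isNzRing.Build T
  tmulA tmul1l tmul1r tmulDl tmulDr tone_neq0.

Lemma tscalerAl (c : F) (x y : T) : c *: (x * y) = c *: x * y.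
Proof. by symmetry; apply: tmulZl. Qed.
Lemma tscalerAr (c : F) (x y : T) : c *: (x * y) = x * (c *: y).
Proof. by symmetry; apply: tmulZr. Qed.

HB.instance Definition _ := GRing.Lmodule_isLalgebra.Build F T tscalerAl.
HB.instance Definition _ := GRing.Lalgebra_isAlgebra.Build F T tscalerAr.

Lemma pureM (a a' : A) (b b' : B) :
  (pure a b : T) * pure a' b' = pure (a * a') (b * b').
Proof. exact: tmul_pure. Qed.

End TensorAlgebra.

(* [V] is the internal direct sum of the subgroups [C g]. *)
Record is_direct_sum (G : finZmodType) (V : zmodType) (C : G -> set V) : Prop :=
  IsDirectSum {
  dsum0 : forall g, C g 0;
  dsumB : forall g x y, C g x -> C g y -> C g (x - y);
  dsum_ex : forall x, exists2 f : G -> V, (forall g, C g (f g)) & x = \sum_g f g;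
  dsum_uniq : forall f : G -> V,
    (forall g, C g (f g)) -> \sum_g f g = 0 -> forall g, f g = 0
}.

Section DirectSum.
Variables (G : finZmodType) (V : zmodType) (C : G -> set V).
Hypothesis dC : is_direct_sum C.

Definition dproj (g : G) (x : V) : V := s2val (cid2 (dsum_ex dC x)) g.

Lemma dproj_in g x : C g (dproj g x).
Proof. exact: (s2valP (cid2 (dsum_ex dC x))). Qed.

Lemma dproj_sum x : x = \sum_g dproj g x.
Proof. exact: (s2valP' (cid2 (dsum_ex dC x))). Qed.

Lemma dsumN g x : C g x -> C g (- x).
Proof. by move=> Cx; rewrite -sub0r; apply: (dsumB dC) => //; apply: (dsum0 dC). Qed.

Lemma dsumD g x y : C g x -> C g y -> C g (x + y).
Proof. by move=> Cx Cy; rewrite -[y]opprK; apply: dsumB => //; apply: dsumN. Qed.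

Lemma dsum_sum g (I : Type) (r : seq I) (P : pred I) (E : I -> V) :
  (forall i, P i -> C g (E i)) -> C g (\sum_(i <- r | P i) E i).
Proof.
by move=> CE; apply: big_ind => // [|x y]; [exact: (dsum0 dC) | exact: dsumD].
Qed.

Lemma dproj_uniq x (f : G -> V) :
  (forall g, C g (f g)) -> x = \sum_g f g -> forall g, dproj g x = f g.
Proof.
move=> Cf xE g; apply/eqP; rewrite -subr_eq0; apply/eqP.
apply: (dsum_uniq dC (f := fun g => dproj g x - f g)) => [h|].
  by apply: dsumB => //; apply: dproj_in.
by rewrite sumrB -dproj_sum -xE subrr.
Qed.

Lemma dproj_id g h x : C g x -> dproj h x = if h == g then x else 0.
Proof.
move=> Cx; apply: (dproj_uniq (f := fun h => if h == g then x else 0)).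
  by move=> k; case: eqP => [->|] // _; exact: (dsum0 dC).
by rewrite -big_mkcond big_pred1_eq.
Qed.

Lemma dprojD g x y : dproj g (x + y) = dproj g x + dproj g y.
Proof.
apply: (dproj_uniq (f := fun g => dproj g x + dproj g y)) => [h|].
  by apply: dsumD; apply: dproj_in.
by rewrite big_split -!dproj_sum.
Qed.

End DirectSum.

Lemma direct_sumP (G : finZmodType) (V : zmodType) (C : G -> set V)
    (p : G -> V -> V) :
  (forall g, C g 0) -> (forall g x y, C g x -> C g y -> C g (x - y)) ->
  (forall g x, C g (p g x)) -> (forall x, x = \sum_g p g x) ->
  (forall g, {morph p g : x y / x + y}) ->
  (forall g h x, C g x -> p h x = if h == g then x else 0) ->
  is_direct_sum C.
Proof.
move=> C0 CB Cp p_sum pD p_id; split=> // [x|f Cf f0 g].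
  by exists (p^~ x).
have p0 : p g 0 = 0 by apply: (addrI (p g 0)); rewrite -pD !addr0.
have := congr1 (p g) f0; rewrite p0 (big_morph _ (pD g) p0) => <-.
rewrite (bigD1 g) //= (p_id g) // eqxx big1 ?addr0 // => h hg.
by rewrite (p_id h) // eq_sym (negPf hg).
Qed.

Record gralg (G : finZmodType) (F : fieldType) := GrAlg {
  gr_sort :> algType F;
  gcomp : G -> set gr_sort;
  gcomp_dsum : is_direct_sum gcomp;
  gcompZ : forall g c x, gcomp g x -> gcomp g (c *: x);
  gcompM : forall g h x y, gcomp g x -> gcomp h y -> gcomp (g + h) (x * y)
}.
Arguments gcomp {G F A} g x : rename.

Section GradedAlgebras.
Variables (G : finZmodType) (F : fieldType).
Implicit Types A B : gralg G F.

Definition gproj A (g : G) : A -> A := dproj (gcomp_dsum A) g.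

Lemma gprojD A g (x y : A) : gproj g (x + y) = gproj g x + gproj g y.
Proof. exact: dprojD. Qed.

Lemma gprojZ A g c (x : A) : gproj g (c *: x) = c *: gproj g x.
Proof.
apply: (dproj_uniq _ (f := fun g => c *: gproj g x)) => [h|].
  by apply: gcompZ; apply: dproj_in.
by rewrite -scaler_sumr -dproj_sum.
Qed.

Definition is_ghom A B (f : {lrmorphism A -> B}) : Prop :=
  forall g x, gcomp g x -> gcomp g (f x).

Definition giso A B : Prop :=
  exists (f : {lrmorphism A -> B}) (h : {lrmorphism B -> A}),
    [/\ is_ghom f, is_ghom h, cancel f h & cancel h f].

Definition supp A : {set G} :=
  finset (fun g => `[< exists2 x : A, gcomp g x & x != 0 >]).

Definition graded_division A : Prop :=
  forall g (x : A), gcomp g x -> x != 0 -> exists y : A, x * y = 1 /\ y * x = 1.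

Definition triv_comp (g : G) : set F^o := [set x | g != 0 -> x = 0].

Lemma triv_dsum : is_direct_sum triv_comp.
Proof.
apply: (direct_sumP (p := fun g x => if g == 0 then x else 0)) => //.
- by move=> g x y xg yg g0; rewrite xg // yg // subrr.
- by move=> g x g0; rewrite (negPf g0).
- by move=> x; rewrite -big_mkcond big_pred1_eq.
- by move=> g x y; case: eqP => // _; rewrite addr0.
- move=> g h x xg; case: (eqVneq h g) => [->|hg].
    by case: eqP => // /eqP g0; rewrite xg.
  by case: eqP => // h0; rewrite xg // -h0 eq_sym.
Qed.

Lemma triv_compZ g c x : triv_comp g x -> triv_comp g (c *: x).
Proof. by move=> xg g0; rewrite xg // scaler0. Qed.

Lemma triv_compM g h x y :
  triv_comp g x -> triv_comp h y -> triv_comp (g + h) (x * y).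
Proof.
move=> xg yh gh; case: (eqVneq g 0) => [g0|g0]; last by rewrite xg // mul0r.
by rewrite yh ?mulr0 //; rewrite g0 add0r in gh.
Qed.

Definition gtriv : gralg G F := GrAlg triv_dsum triv_compZ triv_compM.

End GradedAlgebras.

Section OppositeAlgebra.
Variables (F : fieldType) (A : algType F).

HB.instance Definition _ := GRing.Lmodule.copy A^c A.

Fact opp_scalerAl (c : F) (x y : A^c) : c *: (x * y) = (c *: x : A^c) * y.
Proof. exact: (@scalerAr F A c y x). Qed.
Fact opp_scalerAr (c : F) (x y : A^c) : c *: (x * y) = x * (c *: y : A^c).
Proof. exact: (@scalerAl F A c y x). Qed.

HB.instance Definition _ := GRing.Lmodule_isLalgebra.Build F A^c opp_scalerAl.
HB.instance Definition _ := GRing.Lalgebra_isAlgebra.Build F A^c opp_scalerAr.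

End OppositeAlgebra.

Section GradedOpposite.
Variables (G : finZmodType) (F : fieldType) (A : gralg G F).

Definition op_comp (g : G) : set A^c := @gcomp G F A g.

Lemma op_dsum : is_direct_sum op_comp.
Proof. by case: (gcomp_dsum A) => *; split. Qed.

Lemma op_compZ g c x : op_comp g x -> op_comp g (c *: x).
Proof. exact: gcompZ. Qed.

Lemma op_compM g h x y : op_comp g x -> op_comp h y -> op_comp (g + h) (x * y).
Proof. by move=> xg yh; rewrite addrC; apply: (@gcompM G F A h g y x). Qed.

Definition gop : gralg G F := GrAlg op_dsum op_compZ op_compM.

Lemma gopM (x y : gop) : x * y = (y : A) * (x : A).
Proof. by []. Qed.

End GradedOpposite.

Section GradedTensor.
Variables (G : finZmodType) (F : fieldType) (A B : gralg G F).
Local Notation T := (tens A B).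

(* The span of all a ⊗ b with deg a + deg b = g. *)
Definition tens_comp (g : G) : set T := [set t | exists2 s : seq (A * B),
  (forall p, p \in s ->
     exists h k, [/\ h + k = g, gcomp h p.1 & gcomp k p.2]) &
  t = \sum_(p <- s) pure p.1 p.2].

Definition tproj_pure (g : G) (a : A) (b : B) : T :=
  \sum_h pure (gproj h a) (gproj (g - h) b).

Lemma tproj_pure_bil g : bilinear_for *:%R *:%R (tproj_pure g).
Proof.
have pb := @pure_bilinear F A B.
split=> [b|a] c x y; rewrite /tproj_pure /= scaler_sumr -big_split /=;
  apply: eq_bigr => h _; rewrite gprojD gprojZ.
- by rewrite (bilDl pb) (bilZl pb).
- by rewrite (bilDr pb) (bilZr pb).
Qed.

Definition tproj (g : G) : T -> T := tlift (tproj_pure g).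

Lemma tproj_pureE g a b : tproj g (pure a b) = tproj_pure g a b.
Proof. exact: tlift_pure (tproj_pure_bil g). Qed.

Lemma tens_comp0 g : tens_comp g 0.
Proof. by exists [::]; rewrite ?big_nil. Qed.

Lemma tens_compD g x y : tens_comp g x -> tens_comp g y -> tens_comp g (x + y).
Proof.
move=> [s sP ->] [t tP ->]; exists (s ++ t); last by rewrite big_cat.
by move=> p; rewrite mem_cat => /orP[]; [apply: sP | apply: tP].
Qed.

Lemma tens_compZ g c x : tens_comp g x -> tens_comp g (c *: x).
Proof.
move=> [s sP ->]; exists [seq (c *: p.1, p.2) | p <- s].
  move=> _ /mapP[p /sP[h [k [hk ph pk]]] ->]; exists h, k.
  by split=> //; apply: gcompZ.
rewrite big_map scaler_sumr; apply: eq_bigr => p _ /=.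
by rewrite (bilZl (@pure_bilinear F A B)).
Qed.

Lemma tens_comp_pure h k (a : A) (b : B) :
  gcomp h a -> gcomp k b -> tens_comp (h + k) (pure a b).
Proof.
move=> ah bk; exists [:: (a, b)]; last by rewrite big_seq1.
by move=> p; rewrite inE => /eqP ->; exists h, k.
Qed.

Lemma tens_comp_sum g (I : Type) (r : seq I) (P : pred I) (E : I -> T) :
  (forall i, P i -> tens_comp g (E i)) -> tens_comp g (\sum_(i <- r | P i) E i).
Proof.
by move=> CE; apply: big_ind => // [|x y]; [exact: tens_comp0 | exact: tens_compD].
Qed.

Lemma tens_compM g h x y :
  tens_comp g x -> tens_comp h y -> tens_comp (g + h) (x * y).
Proof.
move=> [s sP ->] [t tP ->]; rewrite mulr_suml big_seq_cond.
apply: tens_comp_sum => p /andP[/sP[a [b [<- pa pb]]] _].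
rewrite mulr_sumr big_seq_cond.
apply: tens_comp_sum => q /andP[/tP[a' [b' [<- qa qb]]] _].
by rewrite pureM addrACA; apply: tens_comp_pure; apply: gcompM.
Qed.

Lemma tens_dsum : is_direct_sum tens_comp.
Proof.
have pb := @pure_bilinear F A B.
have p0l (b : B) : pure (0 : A) b = 0 :> T.
  by rewrite -(scale0r 0) (bilZl pb) scale0r.
have p0r (a : A) : pure a (0 : B) = 0 :> T.
  by rewrite -(scale0r 0) (bilZr pb) scale0r.
have tD g : {morph tproj g : x y / x + y} by apply: tliftD; apply: tproj_pure_bil.
have t0 g : tproj g 0 = 0 by apply: tlift0; apply: tproj_pure_bil.
apply: (direct_sumP (p := tproj)) => //.
- exact: tens_comp0.
- by move=> g x y xg yg; rewrite -scaleN1r; apply/tens_compD/tens_compZ.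
- move=> g x; elim/tens_ind: x => [|a b x IH]; first by rewrite t0; exact: tens_comp0.
  rewrite tD; apply: tens_compD => //; rewrite tproj_pureE.
  apply: tens_comp_sum => h _; rewrite -[X in tens_comp X](subrKC h).
  by apply: tens_comp_pure; apply: dproj_in.
- move=> x; elim/tens_ind: x => [|a b x IH]; first by rewrite big1.
  under eq_bigr do rewrite tD.
  rewrite big_split /= -IH; congr (_ + _).
  under eq_bigr do rewrite tproj_pureE /tproj_pure.
  rewrite exchange_big /= [in LHS](dproj_sum (gcomp_dsum A) a).
  rewrite (big_morph (fun a => pure a b : T) (id1 := 0) (op1 := +%R)) //; last first.
    by move=> u v; rewrite (bilDl pb).
  apply: eq_bigr => h _.
  rewrite [in LHS](dproj_sum (gcomp_dsum B) b).
  rewrite (big_morph (fun b => pure (dproj (gcomp_dsum A) h a) b : T)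
             (id1 := 0) (op1 := +%R)) //; last by move=> u v; rewrite (bilDr pb).
  by rewrite (reindex_inj (addIr (- h))).
- move=> g h _ [s sP ->]; rewrite (big_morph _ (tD h) (t0 h)).
  transitivity (\sum_(p <- s) if h == g then pure p.1 p.2 : T else 0); last first.
    by case: eqP => // _; rewrite big1.
  rewrite big_seq [RHS]big_seq.
  apply: eq_bigr => -[a b] /sP[/= k [l [<- ak bl]]].
  rewrite tproj_pureE /tproj_pure (bigD1 k) //= big1 => [|i ik].
    rewrite /gproj (dproj_id _ _ ak) eqxx (dproj_id _ _ bl) addr0.
    rewrite subr_eq addrC; case: eqP => // _; exact: p0r.
  by rewrite /gproj (dproj_id _ _ ak) (negPf ik) p0l.
Qed.

Definition gtens : gralg G F := GrAlg tens_dsum tens_compZ tens_compM.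

End GradedTensor.

(* The library makes matrices over [B] a [B]-module; the alias carries the
   [F]-algebra structure. *)
Definition matalg (F : fieldType) (B : algType F) (n : nat) := 'M[B]_n.+1.

Section MatrixAlgebra.
Variables (F : fieldType) (B : algType F) (n : nat).
Local Notation M := (matalg B n).

HB.instance Definition _ := GRing.NzRing.on M.

Definition matalg_scale (c : F) (X : M) : M := map_mx (fun b => c *: b) X.

Fact matalg_scaleA a b X :
  matalg_scale a (matalg_scale b X) = matalg_scale (a * b) X.
Proof. by apply/matrixP => i j; rewrite !mxE scalerA. Qed.
Fact matalg_scale1 : left_id 1 matalg_scale.
Proof. by move=> X; apply/matrixP => i j; rewrite !mxE scale1r. Qed.
Fact matalg_scaleDr : right_distributive matalg_scale +%R.
Proof. by move=> a X Y; apply/matrixP => i j; rewrite !mxE scalerDr. Qed.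
Fact matalg_scaleDl X : {morph matalg_scale^~ X : a b / a + b}.
Proof. by move=> a b; apply/matrixP => i j; rewrite !mxE scalerDl. Qed.

HB.instance Definition _ := GRing.Zmodule_isLmodule.Build F M
  matalg_scaleA matalg_scale1 matalg_scaleDr matalg_scaleDl.

Fact matalg_scalerAl (c : F) (X Y : M) : c *: (X * Y) = c *: X * Y.
Proof.
apply/matrixP => i j; rewrite !mxE scaler_sumr.
by apply: eq_bigr => k _; rewrite !mxE scalerAl.
Qed.
Fact matalg_scalerAr (c : F) (X Y : M) : c *: (X * Y) = X * (c *: Y).
Proof.
apply/matrixP => i j; rewrite !mxE scaler_sumr.
by apply: eq_bigr => k _; rewrite !mxE scalerAr.
Qed.

HB.instance Definition _ := GRing.Lmodule_isLalgebra.Build F M matalg_scalerAl.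
HB.instance Definition _ := GRing.Lalgebra_isAlgebra.Build F M matalg_scalerAr.

End MatrixAlgebra.

Section GradedMatrix.
Variables (G : finZmodType) (F : fieldType) (B : gralg G F).
Variables (n : nat) (d : 'I_n.+1 -> G).
Local Notation M := (matalg B n).

(* E_ij(b) has degree d i + deg b - d j, hence lies in degree g exactly when
   b lies in degree - d i + g + d j. *)
Definition mat_comp (g : G) : set M :=
  [set X | forall i j, gcomp (- d i + g + d j) (X i j)].

Definition mat_proj (g : G) (X : M) : M :=
  \matrix_(i, j) gproj (- d i + g + d j) (X i j).

Lemma mat_dsum : is_direct_sum mat_comp.
Proof.
pose dB := gcomp_dsum B.
apply: (direct_sumP (p := mat_proj)).
- by move=> g i j; rewrite mxE; apply: dsum0 dB _.
- by move=> g X Y Xg Yg i j; rewrite !mxE; apply: (dsumB dB).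
- by move=> g X i j; rewrite /mat_proj mxE; apply: dproj_in.
- move=> X; apply/matrixP => i j; rewrite summxE [LHS](dproj_sum dB).
  rewrite (reindex_inj (addIr (d j))) (reindex_inj (addrI (- d i))) /=.
  by apply: eq_bigr => g _; rewrite /mat_proj mxE.
- by move=> g X Y; apply/matrixP => i j; rewrite /mat_proj !mxE gprojD.
move=> g h X Xg; apply/matrixP => i j; rewrite /mat_proj mxE /gproj (dproj_id _ _ (Xg i j)).
rewrite (inj_eq (addIr _)) (inj_eq (addrI _)).
by case: eqP => //; rewrite mxE.
Qed.

Lemma mat_compZ g c X : mat_comp g X -> mat_comp g (c *: X).
Proof. by move=> Xg i j; rewrite mxE; apply: gcompZ. Qed.

Lemma mat_compM g h X Y : mat_comp g X -> mat_comp h Y -> mat_comp (g + h) (X * Y).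
Proof.
move=> Xg Yh i j; rewrite mxE; apply: (dsum_sum (gcomp_dsum B)) => k _.
have -> : - d i + (g + h) + d j = (- d i + g + d k) + (- d k + h + d j).
  by rewrite -[- d k + h + d j]addrA [RHS]addrA addrK !addrA.
exact: gcompM.
Qed.

Definition gmat : gralg G F := GrAlg mat_dsum mat_compZ mat_compM.

End GradedMatrix.

(** Given [x] in Z_{>=0}G, [degs x] lists each g in G exactly [x g] times, see
    [count_degs].  For nonzero [x] the matrix size [(size (degs x)).-1.+1] used
    in [Mx] is the sum of the coefficients of [x], see [size_degs]; for [x = 0]
    it is a junk value. *)

Definition degs (G : finZmodType) (x : {ffun G -> nat}) : seq G :=
  flatten [seq nseq (x g) g | g <- enum G].

Lemma count_degs (G : finZmodType) (x : {ffun G -> nat}) g :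
  count_mem g (degs x) = x g.
Proof.
rewrite count_flatten -map_comp sumnE big_map big_enum /= (bigD1 g) //=.
rewrite count_nseq /= eqxx mul1n big1 ?addn0 // => h hg.
by rewrite count_nseq /= (negPf hg).
Qed.

Lemma size_degs (G : finZmodType) (x : {ffun G -> nat}) :
  x != [ffun=> 0%N] -> (size (degs x)).-1.+1 = (\sum_g x g)%N.
Proof.
have szE : size (degs x) = (\sum_g x g)%N.
  rewrite size_flatten /shape -map_comp sumnE big_map big_enum /=.
  by apply: eq_bigr => g _; rewrite size_nseq.
move=> x0; rewrite prednK // szE lt0n sum_nat_eq0; apply: contra x0 => /forallP H.
by apply/eqP/ffunP => g; rewrite ffunE; apply/eqP; have := H g.
Qed.

Definition Mx (G : finZmodType) (F : fieldType) (x : {ffun G -> nat})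
    (B : gralg G F) : gralg G F :=
  gmat B (fun i : 'I_(size (degs x)).-1.+1 => nth 0 (degs x) i).

Definition xset (G : finZmodType) (H : {set G}) : {ffun G -> nat} :=
  [ffun g => nat_of_bool (g \in H)].

Section CentralSimple.
Variables (F : fieldType) (A : algType F).

Definition finite_dimensional : Prop :=
  exists s : seq A, forall x, exists c : 'I_(size s) -> F,
    x = \sum_i c i *: s`_i.

Definition two_sided_ideal (I : set A) : Prop :=
  [/\ I 0, forall x y, I x -> I y -> I (x + y) &
      forall a x b, I x -> I (a * x * b)].

Definition simple_algebra : Prop :=
  forall I : set A, two_sided_ideal I -> I = [set 0] \/ I = setT.

Definition central_algebra : Prop :=
  forall z : A, (forall x, z * x = x * z) -> exists c : F, z = c%:A.

Definition central_simple : Prop :=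
  [/\ finite_dimensional, simple_algebra & central_algebra].

End CentralSimple.

Section DirectLimit.
Variables (G : finZmodType) (F : fieldType).

Definition is_cocone (S : nat -> gralg G F)
    (phi : forall i, {lrmorphism S i -> S i.+1}) (A : gralg G F)
    (psi : forall i, {lrmorphism S i -> A}) : Prop :=
  (forall i, is_ghom (psi i)) /\ forall i x, psi i.+1 (phi i x) = psi i x.

Definition is_direct_limit (S : nat -> gralg G F)
    (phi : forall i, {lrmorphism S i -> S i.+1}) (A : gralg G F)
    (psi : forall i, {lrmorphism S i -> A}) : Prop :=
  is_cocone phi psi /\
  forall (B : gralg G F) (theta : forall i, {lrmorphism S i -> B}),
    is_cocone phi theta ->
    exists2 u : {lrmorphism A -> B},
      is_ghom u /\ (forall i x, u (psi i x) = theta i x) &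
      forall v : {lrmorphism A -> B},
        is_ghom v -> (forall i x, v (psi i x) = theta i x) -> v =1 u.

Definition elementary_matrix_algebra (A : gralg G F) : Prop :=
  exists2 x : {ffun G -> nat}, x != [ffun=> 0%N] & giso A (Mx x (gtriv G F)).

Definition limit_of_elementary (A : gralg G F) : Prop :=
  exists (S : nat -> gralg G F) (phi : forall i, {lrmorphism S i -> S i.+1})
         (psi : forall i, {lrmorphism S i -> A}),
    [/\ forall i, elementary_matrix_algebra (S i),
        forall i, is_ghom (phi i) /\ injective (phi i) &
        is_direct_limit phi psi].

End DirectLimit.

(* Components are automatically F-subspaces, as 1 has degree 0 in [A]. *)
Record grmod (G : finZmodType) (F : fieldType) (A : gralg G F) := GrMod {
  gm_sort :> lmodType A;
  mcomp : G -> set gm_sort;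
  mcomp_dsum : is_direct_sum mcomp;
  mcompZ : forall g h (a : A) (v : gm_sort),
    gcomp g a -> mcomp h v -> mcomp (g + h) (a *: v)
}.
Arguments mcomp {G F A P} g v : rename.

Section GradedModules.
Variables (G : finZmodType) (F : fieldType) (A : gralg G F).
Implicit Types P Q : grmod A.

Definition gmod_iso P Q : Prop :=
  exists (f : {linear P -> Q}) (h : {linear Q -> P}),
    [/\ forall g v, mcomp g v -> mcomp g (f v),
        forall g v, mcomp g v -> mcomp g (h v), cancel f h & cancel h f].

Definition finitely_generated (P : lmodType A) : Prop :=
  exists s : seq P, forall v, exists c : 'I_(size s) -> A,
    v = \sum_i c i *: s`_i.

Definition projective (P : lmodType A) : Prop :=
  forall (M N : lmodType A) (f : {linear M -> N}) (h : {linear P -> N}),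
    (forall w, exists v, f v = w) ->
    exists k : {linear P -> M}, forall v, f (k v) = h v.

Lemma zero_dsum : is_direct_sum (fun _ : G => [set: 'rV[A]_0]).
Proof.
split=> // [x|f _ _ g]; last by apply/rowP; case.
by exists (fun=> 0) => //; apply/rowP; case.
Qed.

Definition gm_zero : grmod A :=
  @GrMod G F A 'rV[A]_0 (fun=> setT) zero_dsum (fun _ _ _ _ _ _ => I).

Definition gm_add_comp P Q (g : G) : set (P * Q)%type :=
  [set v | mcomp g v.1 /\ mcomp g v.2].

Lemma gm_add_dsum P Q : is_direct_sum (@gm_add_comp P Q).
Proof.
have [dP dQ] := (mcomp_dsum P, mcomp_dsum Q).
have sum1 (f : G -> P * Q) : (\sum_g f g).1 = \sum_g (f g).1.
  exact: (big_morph fst).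
have sum2 (f : G -> P * Q) : (\sum_g f g).2 = \sum_g (f g).2.
  exact: (big_morph snd).
split=> [g|g x y [x1 x2] [y1 y2]|x|f Cf f0 g].
- by split; [apply: (dsum0 dP) | apply: (dsum0 dQ)].
- by split; [apply: (dsumB dP) | apply: (dsumB dQ)].
- exists (fun g => (dproj dP g x.1, dproj dQ g x.2)).
    by move=> g; split; apply: dproj_in.
  by apply/pair_eqP; rewrite /pair_eq sum1 sum2 -!dproj_sum !eqxx.
rewrite [f g]surjective_pairing; congr pair.
- by apply: (dsum_uniq dP (f := fun g => (f g).1)) => [h|]; [case: (Cf h)|rewrite -sum1 f0].
- by apply: (dsum_uniq dQ (f := fun g => (f g).2)) => [h|]; [case: (Cf h)|rewrite -sum2 f0].
Qed.

Lemma gm_add_compZ P Q g h (a : A) (v : P * Q) :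
  gcomp g a -> gm_add_comp h v -> gm_add_comp (g + h) (a *: v).
Proof. by move=> ag [v1 v2]; split; apply: mcompZ. Qed.

Definition gm_add P Q : grmod A := GrMod (@gm_add_dsum P Q) (@gm_add_compZ P Q).

(* P^[g]_h = P_{h g^{-1}} *)
Definition gm_shift_comp (g : G) P (h : G) : set P := mcomp (h - g).

Lemma gm_shift_dsum g P : is_direct_sum (@gm_shift_comp g P).
Proof.
have [P0 PB Pex Puniq] := mcomp_dsum P.
split=> [h|h x y|x|f Cf f0 h]; [exact: P0|exact: PB| |].
- have [f Cf ->] := Pex x; exists (fun h => f (h - g)) => [h|]; first exact: Cf.
  exact: (reindex_inj (addIr (- g))).
- rewrite -[h](addrK g) -[h + g - g]addrAC.
  apply: (Puniq (fun h => f (h + g))) => [k|].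
    by have := Cf (k + g); rewrite /gm_shift_comp addrK.
  by rewrite -[RHS]f0 [RHS](reindex_inj (addIr g)).
Qed.

Lemma gm_shift_compZ g P h k (a : A) (v : P) :
  gcomp h a -> gm_shift_comp g k v -> gm_shift_comp g (h + k) (a *: v).
Proof. by rewrite /gm_shift_comp -addrA; apply: mcompZ. Qed.

Definition gm_shift (g : G) P : grmod A :=
  GrMod (@gm_shift_dsum g P) (@gm_shift_compZ g P).

(** An isomorphism class is the collection of all modules isomorphic to a given
    one (the library's [set] lives in too small a universe here).  The monoid
    operations on isomorphism classes are induced by direct sums, the zero
    module and shifts. *)

Definition modclass := grmod A -> Prop.

Definition iso_class P : modclass := fun Q => gmod_iso P Q.

Definition K0pos : modclass -> Prop := fun c =>
  exists P, [/\ finitely_generated P, projective P & c = iso_class P].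

Definition k0_zero : modclass := iso_class gm_zero.

Definition k0_add (c d : modclass) : modclass := fun R =>
  exists P Q, [/\ c P, d Q & gmod_iso (gm_add P Q) R].

Definition k0_shift (g : G) (c : modclass) : modclass := fun R =>
  exists2 P, c P & gmod_iso (gm_shift g P) R.

Lemma gmod_iso_refl P : gmod_iso P P.
Proof. by exists idfun, idfun. Qed.

Lemma gmod_iso_trans P Q R : gmod_iso P Q -> gmod_iso Q R -> gmod_iso P R.
Proof.
move=> [f [h [fg hg fh hf]]] [f' [h' [fg' hg' fh' hf']]].
exists (f' \o f), (h \o h'); split=> [g v /fg /fg'|g v /hg' /hg|x|x] //=.
- by rewrite fh' fh.
- by rewrite hf hf'.
Qed.

Lemma k0_addE P Q :
  k0_add (iso_class P) (iso_class Q) = iso_class (gm_add P Q).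
Proof.
apply/funext => R; apply/propext; split=> [[P' [Q' [PP QQ]]]|PQR]; last first.
  by exists P, Q; split=> //; apply: gmod_iso_refl.
apply: gmod_iso_trans.
have [f [h [fg hg fh hf]]] := PP; have [f' [h' [fg' hg' fh' hf']]] := QQ.
pose k (v : P * Q) : P' * Q' := (f v.1, f' v.2).
pose l (v : P' * Q') : P * Q := (h v.1, h' v.2).
have klin : linear k by move=> a x y; rewrite /k /= !linearP.
have llin : linear l by move=> a x y; rewrite /l /= !linearP.
pose kM := GRing.isLinear.Build A (gm_add P Q) (gm_add P' Q') *:%R k klin.
pose lM := GRing.isLinear.Build A (gm_add P' Q') (gm_add P Q) *:%R l llin.
pose kL : {linear gm_add P Q -> gm_add P' Q'} := HB.pack k kM.
pose lL : {linear gm_add P' Q' -> gm_add P Q} := HB.pack l lM.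
exists kL, lL; split=> [g v [v1 v2]|g v [v1 v2]|[x y]|[x y]] /=.
- by split; [apply: fg | apply: fg'].
- by split; [apply: hg | apply: hg'].
- by rewrite /k /l /= fh fh'.
- by rewrite /k /l /= hf hf'.
Qed.

Lemma k0_shiftE g P : k0_shift g (iso_class P) = iso_class (gm_shift g P).
Proof.
apply/funext => R; apply/propext; split=> [[P' PP]|PR]; last first.
  by exists P => //; apply: gmod_iso_refl.
apply: gmod_iso_trans; have [f [h [fg hg fh hf]]] := PP.
by exists f, h; split=> // k v; [apply: fg | apply: hg].
Qed.

(* The action of x in Z_{>=0}G: c |-> \sum_g x_g (g c). *)
Definition k0_act (x : {ffun G -> nat}) (c : modclass) : modclass :=
  \big[k0_add/k0_zero]_g iter (x g) (k0_add (k0_shift g c)) k0_zero.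

Definition K0pos_act (x : {ffun G -> nat}) : modclass -> Prop := fun c =>
  exists2 d, K0pos d & c = k0_act x d.

End GradedModules.

Arguments K0pos {G F} A c.
Arguments K0pos_act {G F} A x c.

(* Main.v *)
Require Import Defs.
From HB Require Import structures.
From mathcomp Require Import all_boot all_order all_algebra.
From mathcomp Require Import boolp classical_sets.

(** Let H be the support of E and T' that of D', and write M_x for the matrix algebra
    over F graded by the element x.

    A finite-dimensional graded-division algebra K over an algebraically closed
    field has one-dimensional components ([gbasis_exists]): it is spanned by units
    X t, with inverses Y t.  Everything about K is deduced from the invariance of
    the Casimir element, the sum of the X t tensor Y t ([casimir_mid],
    [casimir_out]).

    On the other side, a limit of elementary matrix algebras is locally a matrix
    algebra on a graded space V, and its grading is inner: degrees are detected by
    the projections onto the components of V.  If K acts on V, the projection p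
    onto the components with degree in a transversal of the support of K selects
    free generators of V over K ([transversal_idempotent]).  Hence two graded
    embeddings of K in such an algebra are conjugate by a unit of degree 0
    ([hom_conj]), so that a central K can be cancelled from a tensor product that is
    locally elementary ([giso_cancel]); and the centraliser of K contains a copy of
    the opposite of K ([opposite_action]).  Moreover, for central K, the tensor
    product of K and its opposite is M_x for x the sum of the support
    ([giso_bireg]), and the flip of K tensor K is conjugation by the Casimir element,
    which is a unit of degree 0 ([flip_inner]).

    Condition (i) says that every finite subset of A commutes with a copy of the
    matrix algebra of x_H in A ([absorbs_K0], [K0_absorbs]).  Such a copy cuts a
    projective module, given by an idempotent matrix with which it commutes, into
    shifts of one piece; conversely, a decomposition of A e, for a minimal
    idempotent e of a matrix subalgebra, provides matrix units in e A e, that is, in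
    the centraliser of that subalgebra.  Equivalently, every finite subset of A
    commutes with a copy of E ([absorbs_mx_division], [absorbs_division_mx]).  In
    that case A is isomorphic to A tensor E ([absorb_iso]): the Casimir element of E
    conjugates 1 tensor E into A tensor 1 while fixing a given finite set, and
    infinitely many such conjugations are composed.

    To conclude, D tensor D'^op being M_y tensor E, the algebra A tensor D tensor
    D'^op is M_y tensor A tensor E, while A' tensor D' tensor D'^op is M_x tensor A'
    with x = x_T', a locally elementary algebra.  If A tensor D and A' tensor D' are
    isomorphic, these two algebras are; then the opposite of E is found in the
    centraliser of E and of a finite subset of A, that is, inside A ([absorbs_op]),
    whence (i), absorption of E and (ii).  Conversely, (i) gives absorption of E,
    so (ii) makes the two algebras isomorphic, and D'^op can be cancelled. *)

Set Implicit Arguments.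
Unset Strict Implicit.
Unset Printing Implicit Defensive.

Import GRing.Theory.
Local Open Scope ring_scope.

(** * Homomorphisms out of graded tensor products *)

Arguments gtens : simpl never.
Arguments gmat : simpl never.
Arguments Mx : simpl never.
Arguments gop : simpl never.

Section Lrmorphisms.
Variable F : fieldType.

Section Build.
Variables (A B : algType F) (f : A -> B).
Hypotheses (flin : linear f) (f1 : f 1 = 1) (fM : {morph f : x y / x * y}).

Lemma lrmk_subproof : {g : {lrmorphism A -> B} | forall x, g x = f x}.
Proof.
pose fL := GRing.isLinear.Build F A B *:%R f flin.
pose fR := GRing.isMonoidMorphism.Build A B f (f1, fM).
pose g : {lrmorphism A -> B} := HB.pack f fL fR.
by exists g.
Qed.

Definition lrmk : {lrmorphism A -> B} := sval lrmk_subproof.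

Lemma lrmkE x : lrmk x = f x.
Proof. exact: (svalP lrmk_subproof). Qed.

End Build.

End Lrmorphisms.

Section Tens.
Variables (F : fieldType) (U V : lmodType F).
Let pb := @pure_bilinear F U V.

Lemma pureDl (u u' : U) (v : V) : pure (u + u') v = pure u v + pure u' v.
Proof. exact: bilDl pb _ _ _. Qed.
Lemma pureDr (u : U) (v v' : V) : pure u (v + v') = pure u v + pure u v'.
Proof. exact: bilDr pb _ _ _. Qed.
Lemma pureZl c (u : U) (v : V) : pure (c *: u) v = c *: pure u v.
Proof. exact: bilZl pb _ _ _. Qed.
Lemma pureZr c (u : U) (v : V) : pure u (c *: v) = c *: pure u v.
Proof. exact: bilZr pb _ _ _. Qed.
Lemma pure0l (v : V) : pure (0 : U) v = 0.
Proof. by rewrite -(scale0r 0) pureZl scale0r. Qed.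
Lemma pure0r (u : U) : pure u (0 : V) = 0.
Proof. by rewrite -(scale0r 0) pureZr scale0r. Qed.
Lemma pure_suml (I : Type) (r : seq I) (P : pred I) (f : I -> U) (v : V) :
  pure (\sum_(i <- r | P i) f i) v = \sum_(i <- r | P i) pure (f i) v.
Proof. by apply: (big_morph (fun u => pure u v)) => [x y|]; rewrite ?pureDl ?pure0l. Qed.
Lemma pure_sumr (I : Type) (r : seq I) (P : pred I) (f : I -> V) (u : U) :
  pure u (\sum_(i <- r | P i) f i) = \sum_(i <- r | P i) pure u (f i).
Proof. by apply: (big_morph (pure u)) => [x y|]; rewrite ?pureDr ?pure0r. Qed.

Lemma lin_tens_eq (W : lmodType F) (f g : tens U V -> W) :
  linear f -> linear g -> (forall u v, f (pure u v) = g (pure u v)) -> f =1 g.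
Proof.
move=> fl gl fg.
have f0 : f 0 = 0 by have := fl (-1) 0 0; rewrite scaler0 addr0 scaleN1r addNr.
have g0 : g 0 = 0 by have := gl (-1) 0 0; rewrite scaler0 addr0 scaleN1r addNr.
elim/tens_ind => [|u v x IH]; first by rewrite f0 g0.
by have := fl 1 (pure u v) x; have := gl 1 (pure u v) x; rewrite !scale1r => -> ->;
  rewrite fg IH.
Qed.

End Tens.

Section GradedIso.
Variables (G : finZmodType) (F : fieldType).
Implicit Types A B C D : gralg G F.

Lemma gcomp0 A g : gcomp g (0 : A).
Proof. exact: dsum0 (gcomp_dsum A) g. Qed.
Lemma gcomp_sum A g (I : Type) (r : seq I) (P : pred I) (f : I -> A) :
  (forall i, P i -> gcomp g (f i)) -> gcomp g (\sum_(i <- r | P i) f i).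
Proof. exact: dsum_sum (gcomp_dsum A) _ _ _ _ _. Qed.
Lemma gproj_in A g (x : A) : gcomp g (gproj g x).
Proof. exact: dproj_in. Qed.
Lemma gproj_sum A (x : A) : x = \sum_g gproj g x.
Proof. exact: dproj_sum. Qed.
Lemma gproj_id A g h (x : A) : gcomp g x -> gproj h x = if h == g then x else 0.
Proof. exact: dproj_id. Qed.

Lemma gproj0 A g : gproj g (0 : A) = 0.
Proof. by rewrite (gproj_id g (gcomp0 A g)) eqxx. Qed.

Lemma gproj_bigsum A g (I : Type) (r : seq I) (P : pred I) (f : I -> A) :
  gproj g (\sum_(i <- r | P i) f i) = \sum_(i <- r | P i) gproj g (f i).
Proof. exact: (big_morph (fun x : A => gproj g x) (@gprojD _ _ _ _) (gproj0 A g)). Qed.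

(** The component of 1 in degree 0 is already a left unit: comparing degrees in
    1 * x = x, it fixes every homogeneous x. *)
Lemma gcomp1 A : gcomp 0 (1 : A).
Proof.
have E g (x : A) : gcomp g x -> gproj 0 1 * x = x.
  move=> xg.
  have C h : gcomp (h + g) (gproj h 1 * x) by apply: gcompM => //; apply: gproj_in.
  have H : gproj g (\sum_h gproj h 1 * x) = x.
    by rewrite -mulr_suml -gproj_sum mul1r (gproj_id _ xg) eqxx.
  rewrite -[RHS]H gproj_bigsum (bigD1 0) //= big1 ?addr0 => [|h h0].
    by rewrite (gproj_id _ (C 0)) add0r eqxx.
  by rewrite (gproj_id _ (C h)) -{1}[g]add0r (inj_eq (addIr _)) eq_sym (negPf h0).
have <- : gproj 0 1 = 1 :> A.
  transitivity (gproj 0 1 * \sum_g gproj g 1 : A); first by rewrite -gproj_sum mulr1.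
  rewrite mulr_sumr [RHS]gproj_sum.
  by apply: eq_bigr => g _; rewrite (E g) //; apply: gproj_in.
exact: gproj_in.
Qed.

Lemma ghom_proj A B (f : {lrmorphism A -> B}) g (x : A) :
  is_ghom f -> f (gproj g x) = gproj g (f x).
Proof.
move=> fg; symmetry.
apply: (dproj_uniq (gcomp_dsum B) (f := fun g => f (gproj g x))) => [h|].
  by apply: fg; apply: gproj_in.
by rewrite -rmorph_sum -gproj_sum.
Qed.

Lemma giso_refl A : giso A A.
Proof. by exists idfun, idfun; split=> // g x. Qed.

Lemma giso_sym A B : giso A B -> giso B A.
Proof. by move=> [f [h [? ? ? ?]]]; exists h, f. Qed.

Lemma giso_trans A B C : giso A B -> giso B C -> giso A C.
Proof.
move=> [f [h [fg hg fK hK]]] [f' [h' [fg' hg' fK' hK']]].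
exists (f' \o f), (h \o h'); split=> [g x /fg /fg'|g x /hg' /hg|x|x] //=.
- by rewrite fK' fK.
- by rewrite hK hK'.
Qed.

(** A bijective graded homomorphism has a graded inverse, because the
    components of an element are determined by those of its image. *)
Lemma giso_bij A B (f : {lrmorphism A -> B}) :
  is_ghom f -> injective f -> (forall b, exists a, f a = b) -> giso A B.
Proof.
move=> fg finj fsurj.
have [h hK] := choice fsurj; have fK : cancel f h by move=> x; apply: finj; rewrite hK.
have hl : linear h by move=> c x y; apply: finj; rewrite linearP /= !hK.
have h1 : h 1 = 1 by apply: finj; rewrite hK rmorph1.
have hM : {morph h : x y / x * y} by move=> x y; apply: finj; rewrite rmorphM /= !hK.
exists f, (lrmk hl h1 hM); split=> [//|g x xg|x|x]; rewrite lrmkE //.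
suff -> : h x = gproj g (h x) by apply: gproj_in.
by apply: finj; rewrite ghom_proj // hK (gproj_id _ xg) eqxx.
Qed.

End GradedIso.

Section TensorHoms.
Variables (G : finZmodType) (F : fieldType) (A B : gralg G F).
Local Notation T := (gtens A B).

Lemma gpureM (a a' : A) (b b' : B) :
  (pure a b : T) * pure a' b' = pure (a * a') (b * b').
Proof. exact: pureM. Qed.

Lemma inl_linear : linear (fun a : A => pure a (1 : B) : T).
Proof. by move=> c x y; rewrite pureDl pureZl. Qed.
Lemma inl_mul : {morph (fun a : A => pure a (1 : B) : T) : x y / x * y}.
Proof. by move=> x y; rewrite gpureM mulr1. Qed.
Definition tinl : {lrmorphism A -> T} := lrmk inl_linear erefl inl_mul.
Lemma tinlE a : tinl a = pure a 1.
Proof. exact: lrmkE. Qed.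

Lemma inr_linear : linear (fun b : B => pure (1 : A) b : T).
Proof. by move=> c x y; rewrite pureDr pureZr. Qed.
Lemma inr_mul : {morph (fun b : B => pure (1 : A) b : T) : x y / x * y}.
Proof. by move=> x y; rewrite gpureM mulr1. Qed.
Definition tinr : {lrmorphism B -> T} := lrmk inr_linear erefl inr_mul.
Lemma tinrE b : tinr b = pure 1 b.
Proof. exact: lrmkE. Qed.

Lemma pureE (a : A) (b : B) : pure a b = tinl a * tinr b.
Proof. by rewrite tinlE tinrE gpureM mulr1 mul1r. Qed.

Variables (C : gralg G F) (f : {lrmorphism A -> C}) (g : {lrmorphism B -> C}).
Hypothesis fg : forall a b, f a * g b = g b * f a.

Lemma tpair_bil : bilinear_for *:%R *:%R (fun a b => f a * g b).
Proof.
split=> [b|a] c x y /=; first by rewrite linearP mulrDl scalerAl.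
by rewrite linearP mulrDr scalerAr.
Qed.

Definition tpair_fun : T -> C := tlift (fun a b => f a * g b).

Lemma tpair_linear : linear tpair_fun.
Proof. exact: tlift_is_linear tpair_bil. Qed.

Lemma tpair_funE a b : tpair_fun (pure a b) = f a * g b.
Proof. exact: tlift_pure tpair_bil. Qed.

Lemma tpair_one : tpair_fun 1 = 1.
Proof. by rewrite [1]/(pure _ _) tpair_funE !rmorph1 mulr1. Qed.

Lemma tpair_mul : {morph tpair_fun : x y / x * y}.
Proof.
have TD x y : tpair_fun (x + y) = tpair_fun x + tpair_fun y.
  exact: tliftD tpair_bil _ _.
have T0 : tpair_fun 0 = 0 by exact: tlift0 tpair_bil.
move=> x y; elim/tens_ind: y => [|a b y IH]; first by rewrite mulr0 T0 mulr0.
rewrite mulrDr !TD mulrDr IH; congr (_ + _).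
elim/tens_ind: x {IH} => [|a' b' x IH]; first by rewrite mul0r T0 mul0r.
rewrite mulrDl !TD mulrDl IH; congr (_ + _).
rewrite gpureM !tpair_funE !rmorphM !mulrA; congr (_ * _).
by rewrite -!mulrA fg.
Qed.

Definition tpair : {lrmorphism T -> C} :=
  lrmk tpair_linear tpair_one tpair_mul.

Lemma tpairE a b : tpair (pure a b) = f a * g b.
Proof. by rewrite lrmkE tpair_funE. Qed.

Lemma tpair_inl a : tpair (tinl a) = f a.
Proof. by rewrite tinlE tpairE rmorph1 mulr1. Qed.
Lemma tpair_inr b : tpair (tinr b) = g b.
Proof. by rewrite tinrE tpairE rmorph1 mul1r. Qed.

Lemma tpair_comm z : (forall a, f a * z = z * f a) -> (forall b, g b * z = z * g b) ->
  forall x, tpair x * z = z * tpair x.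
Proof.
move=> fz gz; apply: (@lin_tens_eq _ _ _ _ (fun x => tpair x * z) (fun x => z * tpair x)).
- by move=> c x y; rewrite linearP mulrDl scalerAl.
- by move=> c x y; rewrite linearP mulrDr scalerAr.
by move=> a b; rewrite tpairE -mulrA gz !mulrA fz.
Qed.

End TensorHoms.
Arguments tinl {G F} A B : simpl never.
Arguments tinr {G F} A B : simpl never.
Arguments tpair {G F A B C f g} fg : simpl never.

Section GradedTensorHoms.
Variables (G : finZmodType) (F : fieldType).
Implicit Types A B C : gralg G F.

Lemma tinl_ghom A B : @is_ghom G F A (gtens A B) (tinl A B).
Proof.
by move=> g x xg; have := tens_comp_pure xg (gcomp1 B); rewrite addr0 tinlE.
Qed.

Lemma tinr_ghom A B : @is_ghom G F B (gtens A B) (tinr A B).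
Proof.
by move=> g x xg; have := tens_comp_pure (gcomp1 A) xg; rewrite add0r tinrE.
Qed.

Lemma tinlr_comm A B (a : A) (b : B) : tinl A B a * tinr A B b = tinr A B b * tinl A B a.
Proof. by rewrite tinlE tinrE !gpureM !mulr1 !mul1r. Qed.

Lemma tpair_ghom A B C (f : {lrmorphism A -> C}) (g : {lrmorphism B -> C}) (fg : forall
  a b, f a * g b = g b * f a) :
  is_ghom f -> is_ghom g -> @is_ghom G F (gtens A B) C (tpair fg).
Proof.
move=> hf hg k x [s sP ->]; rewrite linear_sum big_seq_cond; apply: gcomp_sum => p.
rewrite andbT => /sP[h [l [<- ph pl]]]; rewrite /= tpairE.
by apply: gcompM; [apply: hf | apply: hg].
Qed.

Lemma lrm_tens_eq A B C (f g : {lrmorphism gtens A B -> C}) :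
  (forall a, f (tinl A B a) = g (tinl A B a)) ->
  (forall b, f (tinr A B b) = g (tinr A B b)) -> f =1 g.
Proof.
move=> fl fr; apply: lin_tens_eq => [||a b]; try exact: linearP.
by rewrite pureE !rmorphM /= fl fr.
Qed.

Lemma giso_pair A B (f : {lrmorphism A -> B}) (h : {lrmorphism B -> A}) :
  is_ghom f -> is_ghom h -> cancel f h -> cancel h f -> giso A B.
Proof. by exists f, h. Qed.

Lemma giso_tens A A' B B' :
  giso A A' -> giso B B' -> giso (gtens A B) (gtens A' B').
Proof.
move=> [f [h [fg hg fK hK]]] [f' [h' [fg' hg' fK' hK']]].
have tmap (C C' D D' : gralg G F) (u : {lrmorphism C -> C'}) (v : {lrmorphism D -> D'}) :
    is_ghom u -> is_ghom v -> exists2 w : {lrmorphism gtens C D -> gtens C' D'},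
    is_ghom w & forall c d, w (pure c d) = pure (u c) (v d).
  move=> ug vg.
  have uv c d : (tinl C' D' \o u) c * (tinr C' D' \o v) d =
    (tinr C' D' \o v) d * (tinl C' D' \o u) c by exact: tinlr_comm.
  exists (tpair uv); last by move=> c d; rewrite tpairE -pureE.
  apply: tpair_ghom => g x xg /=.
    by apply: tinl_ghom; apply: ug.
  by apply: tinr_ghom; apply: vg.
have [w wg wE] := tmap _ _ _ _ _ _ fg fg'.
have [w' wg' wE'] := tmap _ _ _ _ _ _ hg hg'.
apply: (giso_pair wg wg').
- apply: (@lin_tens_eq _ _ _ _ (w' \o w) id) => // [|a b]; first exact: linearP.
  by rewrite /= wE wE' fK fK'.
- apply: (@lin_tens_eq _ _ _ _ (w \o w') id) => // [|a b]; first exact: linearP.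
  by rewrite /= wE' wE hK hK'.
Qed.

Lemma giso_tensC A B : giso (gtens A B) (gtens B A).
Proof.
have tsw (C D : gralg G F) : exists2 w : {lrmorphism gtens C D -> gtens D C},
    is_ghom w & forall c d, w (pure c d) = pure d c.
  have uv c d : tinr D C c * tinl D C d = tinl D C d * tinr D C c.
    by rewrite tinlr_comm.
  exists (tpair uv); last by move=> c d; rewrite tpairE uv -pureE.
  by apply: tpair_ghom; [apply: tinr_ghom | apply: tinl_ghom].
have [w wg wE] := tsw A B; have [w' wg' wE'] := tsw B A.
apply: (giso_pair wg wg').
- apply: (@lin_tens_eq _ _ _ _ (w' \o w) id) => // [|a b]; first exact: linearP.
  by rewrite /= wE wE'.
- apply: (@lin_tens_eq _ _ _ _ (w \o w') id) => // [|a b]; first exact: linearP.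
  by rewrite /= wE' wE.
Qed.

Lemma giso_tensA A B C : giso (gtens (gtens A B) C) (gtens A (gtens B C)).
Proof.
have abc a b : tinl A (gtens B C) a * (tinr A (gtens B C) \o tinl B C) b =
  (tinr A (gtens B C) \o tinl B C) b * tinl A (gtens B C) a by exact: tinlr_comm.
have ABc x c : tpair abc x * (tinr A (gtens B C) \o tinr B C) c =
    (tinr A (gtens B C) \o tinr B C) c * tpair abc x.
  apply: tpair_comm => [a|b]; first exact: tinlr_comm.
  by rewrite -!(rmorphM (tinr A (gtens B C))) tinlr_comm.
have bcA b c : (tinl (gtens A B) C \o tinr A B) b * tinr (gtens A B) C c =
  tinr (gtens A B) C c * (tinl (gtens A B) C \o tinr A B) b by exact: tinlr_comm.
have aBC a x : (tinl (gtens A B) C \o tinl A B) a * tpair bcA x =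
    tpair bcA x * (tinl (gtens A B) C \o tinl A B) a.
  symmetry; apply: tpair_comm => [b|c]; last by rewrite tinlr_comm.
  by rewrite -!(rmorphM (tinl (gtens A B) C)) tinlr_comm.
pose w : {lrmorphism gtens (gtens A B) C -> gtens A (gtens B C)} := tpair ABc.
pose w' : {lrmorphism gtens A (gtens B C) -> gtens (gtens A B) C} := tpair aBC.
apply: (giso_pair (f:=w) (h:=w')).
- apply: tpair_ghom; first apply: tpair_ghom.
  + exact: tinl_ghom.
  + by move=> g x xg; apply/tinr_ghom/tinl_ghom.
  + by move=> g x xg; apply/tinr_ghom/tinr_ghom.
- apply: tpair_ghom; last apply: tpair_ghom.
  + by move=> g x xg; apply/tinl_ghom/tinl_ghom.
  + by move=> g x xg; apply/tinl_ghom/tinr_ghom.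
  + exact: tinr_ghom.
- apply: (@lrm_tens_eq _ _ _ (w' \o w) idfun) => [x|c] /=.
    apply: (@lrm_tens_eq _ _ _ (w' \o w \o tinl _ C) (tinl _ C)) => [a|b] /=.
      by rewrite /w /w'; do 4?rewrite !(tpair_inl, tpair_inr) /=.
    by rewrite /w /w'; do 4?rewrite !(tpair_inl, tpair_inr) /=.
  by rewrite /w /w'; do 4?rewrite !(tpair_inl, tpair_inr) /=.
- apply: (@lrm_tens_eq _ _ _ (w \o w') idfun) => [a|x] /=.
    by rewrite /w /w'; do 4?rewrite !(tpair_inl, tpair_inr) /=.
  apply: (@lrm_tens_eq _ _ _ (w \o w' \o tinr _ _) (tinr _ _)) => [b|c] /=.
    by rewrite /w /w'; do 4?rewrite !(tpair_inl, tpair_inr) /=.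
  by rewrite /w /w'; do 4?rewrite !(tpair_inl, tpair_inr) /=.
Qed.

End GradedTensorHoms.

(** * Graded-division algebras as twisted group algebras *)

Section GradedBasis.
Variables (G : finZmodType) (F : fieldType).

Lemma scal_inj (A : algType F) (c d : F) : c%:A = d%:A :> A -> c = d.
Proof.
move=> /eqP; rewrite -subr_eq0 -scalerBl scaler_eq0 oner_eq0 orbF subr_eq0.
by move/eqP.
Qed.

(** A graded algebra whose nonzero components are lines spanned by units, that
    is, a twisted group algebra of the subgroup H.  The families are indexed by
    all of G, with [X] and [Y] zero off H, so that sums can be reindexed by
    translations of G. *)
Record gbasis (E : gralg G F) (H : {set G}) (X Y : G -> E) (c : G -> E -> F) :
  Prop := GBasis {
  gbX : forall t, gcomp t (X t);
  gbY : forall t, gcomp (- t) (Y t);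
  gbXY : forall t, t \in H -> X t * Y t = 1;
  gbYX : forall t, t \in H -> Y t * X t = 1;
  gbX0 : forall t, t \notin H -> X t = 0;
  gbY0 : forall t, t \notin H -> Y t = 0;
  gbX1 : X 0 = 1;
  gb_sum : forall a, a = \sum_t c t a *: X t;
  gbcP : forall t k a b, c t (k *: a + b) = k * c t a + c t b;
  gbcX : forall s t, c s (X t) = ((s == t) && (t \in H))%:R;
  gbH0 : 0 \in H;
  gbHD : forall s t, s \in H -> t \in H -> s + t \in H;
  gbHN : forall t, t \in H -> - t \in H
}.

Section Theory.
Variables (E : gralg G F) (H : {set G}) (X Y : G -> E) (c : G -> E -> F).
Hypothesis B : gbasis H X Y c.

Lemma gbc0 t : c t 0 = 0.
Proof.
by have := gbcP B t (-1) 0 0; rewrite scaler0 addr0 mulN1r addNr.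
Qed.
Lemma gbcD t a b : c t (a + b) = c t a + c t b.
Proof. by have := gbcP B t 1 a b; rewrite scale1r mul1r. Qed.
Lemma gbcZ t k a : c t (k *: a) = k * c t a.
Proof. by have := gbcP B t k a 0; rewrite !addr0 gbc0 addr0. Qed.
Lemma gbc_sum t (I : Type) (r : seq I) (P : pred I) (f : I -> E) :
  c t (\sum_(i <- r | P i) f i) = \sum_(i <- r | P i) c t (f i).
Proof. by apply: (big_morph (c t)) => [x y|]; rewrite ?gbcD ?gbc0. Qed.

Lemma gb_proj t a : gproj t a = c t a *: X t.
Proof.
apply: (dproj_uniq (gcomp_dsum E) (f := fun t => c t a *: X t)) => [g|].
  by apply: gcompZ; apply: (gbX B).
exact: (gb_sum B).
Qed.

Lemma gb_homog t a : gcomp t a -> a = c t a *: X t.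
Proof. by move=> ta; rewrite -gb_proj (gproj_id _ ta) eqxx. Qed.

Lemma gbc_homog s t a : gcomp t a -> s != t -> c s a = 0.
Proof.
move=> ta st; rewrite (gb_homog ta) gbcZ (gbcX B).
by rewrite (negPf st) mulr0.
Qed.

Lemma gb_ind (P : E -> Prop) :
  P 0 -> (forall k a b, P a -> P b -> P (k *: a + b)) ->
  (forall t, t \in H -> P (X t)) -> forall a, P a.
Proof.
move=> P0 PP PX a; rewrite (gb_sum B a).
have PD x y : P x -> P y -> P (x + y) by move=> Px Py; have := PP 1 _ _ Px Py;
  rewrite scale1r.
apply: big_ind => // t _.
case: (boolP (t \in H)) => tH; first by have := PP (c t a) _ _ (PX t tH) P0; rewrite addr0.
by rewrite (gbX0 B tH) scaler0.
Qed.

Lemma gb_mulX s t : X s * X t = c (s + t) (X s * X t) *: X (s + t).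
Proof. by apply: gb_homog; apply: gcompM; apply: (gbX B). Qed.

Lemma gbHDl s t : s \in H -> (s + t \in H) = (t \in H).
Proof.
move=> sH; apply/idP/idP => [stH|]; last exact: (gbHD B).
by rewrite -[t](addKr s); apply: (gbHD B) => //; apply: (gbHN B).
Qed.

(** The structure constant of X t * X s reappears when X s acts on the dual
    family Y; together with the translation t to t + s this is what makes the
    Casimir sums below invariant. *)
Lemma gbXY_shift s t : s \in H ->
  X s * Y (t + s) = c (t + s) (X t * X s) *: Y t.
Proof.
move=> sH; case: (boolP (t \in H)) => tH; last first.
  by rewrite !(gbY0 B) ?mulr0 ?scaler0 // addrC gbHDl.
have tsH : t + s \in H by apply: (gbHD B).
have XE := gb_mulX t s; move: (c (t + s) (X t * X s)) XE => k XE.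
rewrite -[X s * _]mul1r -(gbYX B tH) -mulrA (mulrA (X t)) XE.
by rewrite -scalerAl (gbXY B) // -scalerAr mulr1.
Qed.

Lemma gbYX_shift s t : s \in H ->
  Y (s + t) * X s = c (s + t) (X s * X t) *: Y t.
Proof.
move=> sH; case: (boolP (t \in H)) => tH; last first.
  by rewrite !(gbY0 B) ?mul0r ?scaler0 // gbHDl.
have stH : s + t \in H by apply: (gbHD B).
have XE := gb_mulX s t; move: (c (s + t) (X s * X t)) XE => k XE.
rewrite -[_ * X s]mulr1 -(gbXY B tH) mulrA -(mulrA _ (X s)) XE.
by rewrite -scalerAr (gbYX B) // -scalerAl mul1r.
Qed.

Section Casimir.
Variables (W : lmodType F) (phi : E -> E -> W).
Hypothesis bf : bilinear_for *:%R *:%R phi.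

Let phi0l b : phi 0 b = 0.
Proof. by rewrite -(scale0r 0) (bilZl bf) scale0r. Qed.
Let phi0r b : phi b 0 = 0.
Proof. by rewrite -(scale0r 0) (bilZr bf) scale0r. Qed.

(** The sum over t of X t tensor Y t is the Casimir element of the symmetric
    algebra E.  Its two invariance properties are stated through an arbitrary
    bilinear map, since they are applied in several algebras at once. *)
Lemma casimir_mid a : \sum_t phi (X t * a) (Y t) = \sum_t phi (X t) (a * Y t).
Proof.
elim/gb_ind: a => [|k a b IHa IHb|s sH].
- by under eq_bigr do rewrite mulr0 phi0l; under [RHS]eq_bigr do rewrite mul0r phi0r.
- under eq_bigr do rewrite mulrDr -scalerAr (bilDl bf) (bilZl bf).
  under [RHS]eq_bigr do rewrite mulrDl -scalerAl (bilDr bf) (bilZr bf).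
  by rewrite !big_split /= -!scaler_sumr IHa IHb.
rewrite [RHS](reindex_inj (addIr s)) /=; apply: eq_bigr => t _.
by rewrite gbXY_shift // {1}gb_mulX (bilZl bf) (bilZr bf).
Qed.

Lemma casimir_out a : \sum_t phi (a * X t) (Y t) = \sum_t phi (X t) (Y t * a).
Proof.
elim/gb_ind: a => [|k a b IHa IHb|s sH].
- by under eq_bigr do rewrite mul0r phi0l; under [RHS]eq_bigr do rewrite mulr0 phi0r.
- under eq_bigr do rewrite mulrDl -scalerAl (bilDl bf) (bilZl bf).
  under [RHS]eq_bigr do rewrite mulrDr -scalerAr (bilDr bf) (bilZr bf).
  by rewrite !big_split /= -!scaler_sumr IHa IHb.
rewrite [RHS](reindex_inj (addrI s)) /=; apply: eq_bigr => t _.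
by rewrite gbYX_shift // {1}gb_mulX (bilZl bf) (bilZr bf).
Qed.

End Casimir.

Lemma gbY1 : Y 0 = 1.
Proof. by rewrite -[LHS]mul1r -{1}(gbX1 B) (gbXY B) // (gbH0 B). Qed.

Lemma gbc_X0 t : c 0 (X t) = (t == 0)%:R.
Proof.
rewrite (gbcX B) eq_sym; case: eqP => // ->; by rewrite (gbH0 B).
Qed.

(** [c 0] is a symmetrising form for which the [Y t] are dual to the [X t]. *)
Lemma gb_dual b : b = \sum_t c 0 (X t * b) *: Y t.
Proof.
pose phi (x y : E) : E := c 0 x *: y.
have bf : bilinear_for *:%R *:%R phi.
  split=> [y|x] k u v; rewrite /phi /=.
    by rewrite (gbcP B) scalerDl scalerA.
  by rewrite scalerDr !scalerA mulrC.
rewrite (casimir_mid bf) /phi (bigD1 0) //= big1 ?addr0 => [|t t0].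
  by rewrite gbc_X0 eqxx scale1r gbY1 mulr1.
by rewrite gbc_X0 (negPf t0) scale0r.
Qed.

Lemma gbc_YX s t : t \in H -> c 0 (Y s * X t) = (s == t)%:R.
Proof.
move=> tH; case: (eqVneq s t) => [->|st].
  by rewrite (gbYX B) // -(gbX1 B) gbc_X0 eqxx.
have YX : gcomp (- s + t) (Y s * X t) by apply: gcompM; [apply: (gbY B)|apply: (gbX B)].
by rewrite (gbc_homog YX) // eq_sym addrC subr_eq0 eq_sym.
Qed.

(** The commutation bicharacter of the twisted group algebra. *)
Definition gb_char (s t : G) : F := c t (X s * X t * Y s).

Lemma gb_conj s t : X s * X t * Y s = gb_char s t *: X t.
Proof.
apply: gb_homog.
have C : gcomp (s + t - s) (X s * X t * Y s).
  by apply: gcompM; [apply: gcompM; apply: (gbX B) | apply: (gbY B)].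
by move: C; rewrite addrAC subrr add0r.
Qed.

Lemma gb_char0 s : s \in H -> gb_char s 0 = 1.
Proof.
by move=> sH; rewrite /gb_char (gbX1 B) mulr1 (gbXY B) // -(gbX1 B) gbc_X0 eqxx.
Qed.

(** Nondegeneracy of the commutation bicharacter, the form in which centrality
    is used. *)
Definition gbcentral := forall t, t \in H -> t != 0 ->
  exists2 s, s \in H & gb_char s t != 1.

Lemma gb_central : central_algebra E -> gbcentral.
Proof.
move=> cE t tH t0; apply: contrapT => noS.
have com s : s \in H -> X s * X t = X t * X s.
  move=> sH; have [k1|k1] := eqVneq (gb_char s t) 1; last by case: noS; exists s.
  by rewrite -[LHS]mulr1 -(gbYX B sH) mulrA gb_conj k1 scale1r.
have [k kE] : exists k : F, X t = k%:A.
  apply: cE => x; elim/gb_ind: x => [|k a b IHa IHb|s sH].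
  - by rewrite mulr0 mul0r.
  - by rewrite mulrDr mulrDl -scalerAr -scalerAl IHa IHb.
  - by rewrite com.
have := gbcX B t t; rewrite eqxx tH kE -(gbX1 B) gbcZ (gbcX B) (negPf t0) mulr0.
by move/eqP; rewrite eq_sym oner_eq0.
Qed.

End Theory.

End GradedBasis.

(** Only one component of y contributes to the component of degree 0 of
    x * y = 1, so that component is an inverse of x too. *)
Lemma ginv_homog (G : finZmodType) (F : fieldType) (A : gralg G F) g (x y z : A) :
  gcomp g x -> x * y = 1 -> z * x = 1 -> gcomp (- g) y.
Proof.
move=> xg xy zx; suff : x * gproj (- g) y = 1.
  move/(congr1 (fun w => z * w)); rewrite mulrA zx mul1r mulr1 => zE.
  suff -> : y = gproj (- g) y by apply: gproj_in.
  by rewrite zE -[y]mul1r -zx -mulrA xy mulr1.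
have H : gproj 0 (\sum_h x * gproj h y) = 1.
  by rewrite -mulr_sumr -gproj_sum xy (gproj_id _ (gcomp1 A)) eqxx.
have C h : gcomp (g + h) (x * gproj h y) by apply: gcompM => //; apply: gproj_in.
rewrite -[RHS]H gproj_bigsum (bigD1 (- g)) //= big1 ?addr0 => [|h h0].
  by rewrite (gproj_id _ (C _)) subrr eqxx.
by rewrite (gproj_id _ (C h)) eq_sym addrC addr_eq0 (negPf h0).
Qed.

Section BasisExistence.
Variables (G : finZmodType) (F : closedFieldType).

(** The powers of x below one more than the dimension are linearly dependent. *)
Lemma algebraic_of_fd (A : algType F) (x : A) : finite_dimensional A ->
  exists2 p : {poly F}, p != 0 & horner_alg x p = 0.
Proof.
move=> [s sP]; set n := size s in sP.
have [c cP] := choice (fun i : 'I_n.+1 => sP (x ^+ i)).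
pose M := \matrix_(i < n.+1, j < n) c i j.
have /rowV0Pn[v /sub_kermxP vM v0] : kermx M != 0.
  rewrite -mxrank_eq0 mxrank_ker subn_eq0 -ltnNge.
  by rewrite ltnS; apply: rank_leq_col.
exists (\poly_(i < n.+1) v ord0 (inord i)).
  apply: contra v0 => /eqP p0; apply/eqP/rowP => i; rewrite mxE.
  have := congr1 (fun p : {poly F} => p`_i) p0.
  by rewrite coef_poly ltn_ord inord_val coef0.
rewrite poly_def linear_sum /=.
under eq_bigr => i _ do rewrite linearZ /= rmorphXn /= horner_algX inord_val cP.
under eq_bigr do rewrite mulr_algl scaler_sumr.
rewrite exchange_big big1 //= => j _.
transitivity ((\sum_(i < n.+1) v ord0 i * c i j) *: s`_j).
  by rewrite scaler_suml; apply: eq_bigr => i _; rewrite scalerA.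
have := congr1 (fun u : 'rV_n => u ord0 j) vM.
by rewrite !mxE; under eq_bigr do rewrite mxE; move=> ->; rewrite scale0r.
Qed.

Variable E : gralg G F.
Hypotheses (divE : graded_division E) (fdE : finite_dimensional E).

(** A polynomial killing x splits, and each of its factors x - z, being of
    degree 0, is zero or invertible. *)
Lemma gdiv_comp0 (x : E) : gcomp 0 x -> exists k : F, x = k%:A.
Proof.
move=> x0; have [p p0 px] := algebraic_of_fd x fdE.
have [r pE] := closed_field_poly_normal p.
have {px} : \prod_(z <- r) (x - z%:A) = 0.
  move: px; rewrite pE linearZ /= mulr_algl rmorph_prod /= => /eqP.
  rewrite scaler_eq0 lead_coef_eq0 (negPf p0) /= => /eqP <-.
  by apply: eq_bigr => z _; rewrite rmorphB /= horner_algX horner_algC.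
elim: r {pE} => [|z r IH]; first by rewrite big_nil => /eqP; rewrite oner_eq0.
rewrite big_cons; have [/eqP|xz] := eqVneq (x - z%:A) 0.
  by rewrite subr_eq0 => /eqP -> _; exists z.
have zz : gcomp 0 (x - z%:A).
  by apply: (dsumB (gcomp_dsum E)) => //; apply: gcompZ; apply: gcomp1.
have [u [_ ux]] := divE zz xz.
by move=> /(congr1 (fun w => u * w)); rewrite mulrA ux mul1r mulr0; apply: IH.
Qed.

Lemma gdiv_inv g (x y : E) : gcomp g x -> x * y = 1 -> gcomp (- g) y.
Proof.
move=> xg xy; have [/eqP x0|x0] := boolP (x == 0).
  by move/eqP: xy; rewrite x0 mul0r eq_sym oner_eq0.
by have [z [_ zx]] := divE xg x0; apply: ginv_homog xg xy zx.
Qed.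

Lemma suppP g : reflect (exists2 x : E, gcomp g x & x != 0) (g \in supp E).
Proof. by rewrite inE; apply: asboolP. Qed.

Lemma gbasis_exists : exists (X Y : G -> E) (c : G -> E -> F),
  gbasis (supp E) X Y c.
Proof.
have /choice[ev evP] : forall x : E, exists k : F, gcomp 0 x -> x = k%:A.
  move=> x; have [x0|nx0] := pselect (gcomp 0 x); last by exists 0.
  by have [k kE] := gdiv_comp0 x0; exists k.
have /choice[X0 X0P] : forall g, exists x : E,
    g \in supp E -> [/\ gcomp g x, x != 0 & g = 0 -> x = 1].
  move=> g; have [->|g0] := eqVneq g 0.
    by exists 1 => _; split=> //; [apply: gcomp1 | apply: oner_neq0].
  have [/suppP[x xg x0]|gS] := boolP (g \in supp E); last by exists 0.
  by exists x => _; split=> // gE; rewrite gE eqxx in g0.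
have /choice[Y0 Y0P] : forall g, exists y : E,
    g \in supp E -> X0 g * y = 1 /\ y * X0 g = 1.
  move=> g; have [gS|gS] := boolP (g \in supp E); last by exists 0.
  by have [xg x0 _] := X0P g gS; have [y yP] := divE xg x0; exists y.
pose X g := if g \in supp E then X0 g else 0.
pose Y g := if g \in supp E then Y0 g else 0.
pose c g a := if g \in supp E then ev (gproj g a * Y0 g) else 0.
have XYg g (a : E) : g \in supp E -> gcomp g a -> a = ev (a * Y0 g) *: X0 g.
  move=> gS ag; have [xg x0 _] := X0P g gS; have [xy yx] := Y0P g gS.
  have yg := gdiv_inv xg xy.
  have /evP e : gcomp 0 (a * Y0 g) by rewrite -(subrr g); apply: gcompM.
  by rewrite -{1}[a]mulr1 -yx mulrA {1}e -scalerAl mul1r.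
have S0 : 0 \in supp E by apply/suppP; exists 1; [apply: gcomp1 | apply: oner_neq0].
have nz x y : x * y = 1 :> E -> x != 0 /\ y != 0.
  by move=> xy; split; apply/eqP => z; move/eqP: xy;
    rewrite z ?(mul0r, mulr0) eq_sym oner_eq0.
have cX s t : c s (X t) = ((s == t) && (t \in supp E))%:R.
  rewrite /c /X; case: (boolP (s \in supp E)) => sS; last first.
    by case: eqP => // <-; rewrite (negPf sS).
  case: (boolP (t \in supp E)) => tS; last first.
    rewrite andbF gproj0 mul0r; apply: (@scal_inj _ E).
    by rewrite -evP ?scale0r //; apply: gcomp0.
  have [xt x0 _] := X0P t tS; rewrite (gproj_id _ xt); have [st|st] := eqVneq s t.
    have [xy _] := Y0P t tS.
    rewrite st xy; apply: (@scal_inj _ E); rewrite -evP ?scale1r //; exact: gcomp1.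
  by rewrite mul0r; apply: (@scal_inj _ E); rewrite -evP ?scale0r //; apply: gcomp0.
have cX' g a : gproj g a = c g a *: X g.
  rewrite /c /X; case: ifP => gS; first by apply: XYg => //; apply: gproj_in.
  rewrite scale0r; apply/eqP; apply/negPn/negP => a0.
  by case/negP: (negbT gS); apply/suppP; exists (gproj g a) => //; apply: gproj_in.
exists X, Y, c; split.
- by move=> t; rewrite /X; case: ifP => [/X0P[]|] // _; apply: gcomp0.
- move=> t; rewrite /Y; case: ifP => [tS|_]; last exact: gcomp0.
  by have [xg _ _] := X0P t tS; have [xy _] := Y0P t tS; apply: gdiv_inv xg xy.
- by move=> t tS; rewrite /X /Y tS; case: (Y0P t tS).
- by move=> t tS; rewrite /X /Y tS; case: (Y0P t tS).
- by move=> t /negPf tS; rewrite /X tS.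
- by move=> t /negPf tS; rewrite /Y tS.
- by rewrite /X S0; have [_ _] := X0P 0 S0; apply.
- by move=> a; rewrite [LHS]gproj_sum; apply: eq_bigr => g _; apply: cX'.
- move=> t k a b; case: (boolP (t \in supp E)) => tS; last first.
    by rewrite /c (negPf tS) mulr0 addr0.
  apply/eqP; rewrite -subr_eq0; apply/eqP; apply: (@scal_inj _ E); rewrite scale0r.
  have [xy _] := Y0P t tS.
  rewrite -xy scalerAl.
  have -> : (c t (k *: a + b) - (k * c t a + c t b)) *: X0 t = 0; last by rewrite mul0r.
  have XE : X0 t = X t by rewrite /X tS.
  rewrite XE scalerBl -cX' scalerDl -scalerA -!cX' gprojD gprojZ; exact: subrr.
- exact: cX.
- exact: S0.
- move=> s t /suppP[x xs x0] /suppP[y yt y0]; apply/suppP.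
  exists (x * y); first exact: gcompM.
  have [u [_ ux]] := divE xs x0; apply/eqP => /(congr1 (fun w => u * w)).
  by rewrite mulrA ux mul1r mulr0 => /eqP; rewrite (negPf y0).
- move=> t /suppP[x xt x0]; have [y [xy yx]] := divE xt x0.
  by apply/suppP; exists y; [apply: gdiv_inv xt xy | case: (nz _ _ xy)].
Qed.

End BasisExistence.

(** * Locally elementary algebras and their inner gradings *)

Section MatrixUnits.
Variables (G : finZmodType) (F : fieldType).
Implicit Types C : gralg G F.

(** Matrix units with an elementary grading, inside an algebra that may be
    larger than their span. *)
Record mxunits C (I : finType) (d : I -> G) (e : I -> I -> C) : Prop := MxUnits {
  mu_deg : forall i j, gcomp (d i - d j) (e i j);
  mu_mul : forall i j k l, e i j * e k l = if j == k then e i l else 0;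
  mu_one : \sum_i e i i = 1
}.

Definition mspan C (I : finType) (e : I -> I -> C) (x : C) : Prop :=
  exists c : I -> I -> F, x = \sum_i \sum_j c i j *: e i j.

(** What remains of being a direct limit of elementary matrix algebras once the
    countability of the limit is forgotten.  This property, unlike that of being
    a limit, can be checked on finite sets. *)
Definition locally_elementary C : Prop := forall s : seq C,
  exists (I : finType) (d : I -> G) (e : I -> I -> C),
    mxunits d e /\ forall x, x \in s -> mspan e x.

Lemma mu_inh C I d e : @mxunits C I d e -> inhabited I.
Proof.
move=> U; have := mu_one U; have [i _|noI] := pickP (fun i : I => true); first by [].
by rewrite big_pred0 // => /eqP; rewrite eq_sym oner_eq0.
Qed.

Section Spread.
Variables (C : gralg G F) (I : finType) (d : I -> G) (e : I -> I -> C) (o : I).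
Hypothesis U : mxunits d e.

(** Identifies the corner cut out by [e o o] with the centraliser of the matrix
    units. *)
Definition spread (u : C) : C := \sum_k e k o * u * e o k.

Lemma spread_comm u i j : e o o * u = u * e o o ->
  spread u * e i j = e i j * spread u.
Proof.
move=> eu; rewrite /spread mulr_suml mulr_sumr (bigD1 i) //= big1 => [|k ki]; last first.
  by rewrite -mulrA (mu_mul U) (negPf ki) mulr0.
rewrite [RHS](bigD1 j) //= [X in _ = _ + X]big1 => [|k kj]; last first.
  by rewrite !mulrA (mu_mul U) eq_sym (negPf kj) !mul0r.
by rewrite !addr0 -!mulrA (mu_mul U) !eqxx !mulrA (mu_mul U) eqxx.
Qed.

Lemma spreadM u v : e o o * u = u * e o o ->
  spread u * spread v = spread (u * v).
Proof.
move=> eu; rewrite {1 3}/spread mulr_suml; apply: eq_bigr => k _.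
rewrite /spread mulr_sumr (bigD1 k) //= big1 ?addr0 => [|l lk].
  rewrite !mulrA -(mulrA _ (e o k)) (mu_mul U) eqxx -(mulrA _ u) -eu.
  by rewrite !mulrA (mu_mul U) eqxx.
by rewrite !mulrA -(mulrA _ (e o k)) (mu_mul U) eq_sym (negPf lk) mulr0 !mul0r.
Qed.

Lemma spreadP k u v : spread (k *: u + v) = k *: spread u + spread v.
Proof.
rewrite scaler_sumr -big_split; apply: eq_bigr => i _ /=.
by rewrite mulrDr mulrDl -scalerAr -scalerAl.
Qed.

Lemma spread1 : spread 1 = 1.
Proof.
rewrite -[RHS](mu_one U); apply: eq_bigr => i _.
by rewrite mulr1 (mu_mul U) eqxx.
Qed.

Lemma spread_deg g u : gcomp g u -> gcomp g (spread u).
Proof.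
move=> ug; apply: gcomp_sum => k _.
have -> : g = (d k - d o) + g + (d o - d k) by rewrite addrAC addrA subrK subrr add0r.
by apply: gcompM; [apply: gcompM => //|]; apply: (mu_deg U).
Qed.

End Spread.

Lemma mspan_homog C (I : finType) (d : I -> G) (e : I -> I -> C) h x :
  mxunits d e -> mspan e x -> gcomp h x ->
  exists c : I -> I -> F, x = \sum_i \sum_(j | d i == h + d j) c i j *: e i j.
Proof.
move=> U [c xE] xh; exists c.
have /esym := gproj_id h xh; rewrite eqxx => ->.
rewrite {1}xE gproj_bigsum; apply: eq_bigr => i _; rewrite gproj_bigsum.
rewrite [RHS]big_mkcond; apply: eq_bigr => j _; rewrite gprojZ.
rewrite (gproj_id _ (mu_deg U i j)) eq_sym subr_eq; case: ifP => // _.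
by rewrite scaler0.
Qed.

(** The grading of a matrix algebra is inner: p g is the projection onto the
    component of degree g of the underlying graded space, and an element of
    degree h moves that component to the one of degree h + g. *)
Lemma inner_projections C : locally_elementary C -> forall s : seq C,
  exists p : G -> C, [/\ forall g, gcomp 0 (p g),
    forall g h, p g * p h = if g == h then p g else 0, \sum_g p g = 1 &
    forall x h g, x \in s -> gcomp h x -> x * p g = p (h + g) * x].
Proof.
move=> LE s; have [I [d [e [U sU]]]] := LE s.
exists (fun g => \sum_(i | d i == g) e i i); split.
- by move=> g; apply: gcomp_sum => i _; rewrite -(subrr (d i)); apply: (mu_deg U).
- move=> g h; rewrite mulr_suml; case: eqP => [<-|gh]; last first.
    rewrite big1 // => i /eqP ig; rewrite mulr_sumr big1 // => j /eqP jh.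
    by rewrite (mu_mul U); case: eqP => // ij; case: gh; rewrite -ig -jh ij.
  apply: eq_bigr => i ig; rewrite mulr_sumr (bigD1 i) //= big1 => [|j /andP[_ ji]].
    by rewrite (mu_mul U) eqxx addr0.
  by rewrite (mu_mul U) eq_sym (negPf ji).
- rewrite -[RHS](mu_one U) [RHS](partition_big d xpredT) //=.
move=> x h g xs xh; have [c ->] := mspan_homog U (sU x xs) xh.
rewrite mulr_suml mulr_sumr.
transitivity (\sum_i \sum_(j | (d i == h + d j) && (d j == g)) c i j *: e i j).
  apply: eq_bigr => i _; rewrite mulr_suml [RHS]big_mkcondr; apply: eq_bigr => j _.
  rewrite -scalerAl mulr_sumr; case: ifP => dj.
    rewrite (bigD1 j) //= big1 ?addr0 ?(mu_mul U) ?eqxx // => k /andP[_ kj].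
    by rewrite (mu_mul U) eq_sym (negPf kj).
  rewrite big1 ?scaler0 // => k /eqP dk; rewrite (mu_mul U); case: eqP => // jk.
  by rewrite jk dk eqxx in dj.
apply: eq_bigr => i _; rewrite mulr_sumr [LHS]big_mkcondr; apply: eq_bigr => j /eqP dij.
rewrite -scalerAr mulr_suml; case: ifP => dj.
  rewrite (bigD1 i) //=; last by rewrite dij (eqP dj).
  rewrite big1 ?addr0 ?(mu_mul U) ?eqxx // => k /andP[_ ki].
  by rewrite (mu_mul U) (negPf ki).
rewrite big1 ?scaler0 // => k /eqP dk; rewrite (mu_mul U); case: eqP => // ki.
by move: dj; rewrite -(inj_eq (addrI h)) -dij -dk ki eqxx.
Qed.

Lemma coset_transversal (H : {set G}) : 0 \in H ->
  (forall s t, s \in H -> t \in H -> s + t \in H) ->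
  (forall t, t \in H -> - t \in H) ->
  exists Z : {set G}, (forall g, exists2 t, t \in H &
    forall t', t' \in H -> (g - t' \in Z) = (t' == t)).
Proof.
move=> H0 HD HN.
pose r (g : G) := odflt g [pick x | x - g \in H].
have rH g : r g - g \in H by rewrite /r; case: pickP => [//|_] /=; rewrite subrr.
have rE g h : g - h \in H -> r g = r h.
  move=> gh; rewrite /r (@eq_pick _ (fun x => x - g \in H) (fun x => x - h \in H)).
    by case: pickP => [//|/(_ h)]; rewrite subrr H0.
  move=> x; apply/idP/idP => xH.
    by rewrite -[x](subrK g) -addrA; apply: HD.
  by rewrite -[x](subrK h) -addrA; apply: HD => //; rewrite -opprB; apply: HN.
exists [set x | r x == x] => g; exists (g - r g); first by rewrite -opprB; apply: HN.
move=> t' t'H; rewrite inE (rE _ g); last by rewrite addrAC subrr add0r; apply: HN.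
by rewrite eq_sym subr_eq addrC -subr_eq eq_sym.
Qed.

(** Let p project onto the components with degree in a transversal of G / H.
    On the underlying graded space V the units th (X t), for t in H, permute the
    components, so V is the direct sum of the spaces th (X t) (p V): a graded
    E-module is free, and p selects a space of generators. *)
Lemma transversal_idempotent C (E : gralg G F) (H : {set G}) (X Y : G -> E) c :
  locally_elementary C -> gbasis H X Y c -> forall s : seq C,
  exists p : C, [/\ gcomp 0 p,
    forall x, x \in s -> gcomp 0 x -> x * p = p * x &
    forall th : {lrmorphism E -> C}, is_ghom th -> (forall t, th (X t) \in s) ->
      \sum_t th (X t) * p * th (Y t) = 1 /\
      forall a, p * th a * p = c 0 a *: p].
Proof.
move=> LE B s; have [q [q0 qM q1 qS]] := inner_projections LE s.
have [Z ZP] := coset_transversal (gbH0 B) (gbHD B) (gbHN B).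
exists (\sum_(z in Z) q z); split.
- by apply: gcomp_sum.
- move=> x xs x0; rewrite mulr_sumr mulr_suml; apply: eq_bigr => z _.
  by rewrite (qS _ _ _ xs x0) add0r.
move=> th gth thS.
have Xq t : th (X t) * \sum_(z in Z) q z = (\sum_(g | g - t \in Z) q g) * th (X t).
  rewrite mulr_sumr mulr_suml (reindex_inj (addrI (- t))) /=.
  apply: eq_big => [g|g _]; first by rewrite addrC.
  by rewrite (qS _ _ _ (thS t) (gth _ _ (gbX B t))) addrA subrr add0r.
split.
  transitivity (\sum_(t in H) \sum_(g | g - t \in Z) q g).
    rewrite [RHS]big_mkcond; apply: eq_bigr => t _; rewrite Xq -mulrA -rmorphM.
    case: (boolP (t \in H)) => tH; first by rewrite (gbXY B) // rmorph1 mulr1.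
    by rewrite (gbX0 B) // mul0r rmorph0 mulr0.
  rewrite -[RHS]q1 (exchange_big_dep xpredT) //=; apply: eq_bigr => g _.
  have [t tH tP] := ZP g; rewrite (bigD1 t) /=; last by rewrite tH tP ?eqxx.
  by rewrite big1 ?addr0 // => t' /andP[/andP[t'H]]; rewrite tP // => ->.
set p := \sum_(z in Z) q z.
have ppX t : p * th (X t) * p = (t == 0)%:R *: p.
  case: (boolP (t \in H)) => tH; last first.
    rewrite (gbX0 B) // rmorph0 mulr0 mul0r; case: eqP tH => [->|_ _];
      last by rewrite scale0r.
    by rewrite (gbH0 B).
  rewrite -mulrA Xq mulrA /p mulr_suml.
  have [->|t0] := eqVneq t 0.
    rewrite (gbX1 B) rmorph1 mulr1 scale1r; apply: eq_bigr => z zZ.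
    rewrite mulr_sumr (bigD1 z) ?subr0 //= big1 ?addr0 ?qM ?eqxx // => g /andP[_ gz].
    by rewrite qM eq_sym (negPf gz).
  rewrite big1 ?mul0r ?scale0r // => z zZ; rewrite mulr_sumr big1 // => g gZ.
  rewrite qM; case: eqP => // zg; move: gZ; rewrite -zg => gZ.
  have [t1 t1H t1P] := ZP z; move: (t1P 0 (gbH0 B)) (t1P t tH).
  by rewrite subr0 zZ gZ => /esym/eqP <- /esym t00; rewrite t00 in t0.
elim/(gb_ind B) => [|k a b IHa IHb|t tH].
- by rewrite rmorph0 mulr0 mul0r (gbc0 B) scale0r.
- rewrite linearP mulrDr mulrDl -scalerAr -scalerAl IHa IHb.
  by rewrite (gbcP B) scalerDl scalerA.
by rewrite ppX (gbc_X0 B).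
Qed.

End MatrixUnits.

(** * Conjugacy of embeddings and the opposite algebra in the centraliser *)

Section InnerConjugation.
Variables (G : finZmodType) (F : fieldType).
Implicit Types C : gralg G F.

Variables (E : gralg G F) (H : {set G}) (X Y : G -> E) (c : G -> E -> F).
Hypothesis B : gbasis H X Y c.

Lemma mem_values C (f : G -> C) t : f t \in [seq f u | u <- enum G].
Proof. by apply: (map_f f); rewrite mem_enum. Qed.

Lemma homs_bilinear C (al be : {lrmorphism E -> C}) (p : C) :
  bilinear_for *:%R *:%R (fun x y => al x * p * be y).
Proof.
split=> [y|x] k u v /=.
- by rewrite linearP !mulrDl -!scalerAl.
- by rewrite linearP !mulrDr -!scalerAr.
Qed.

(** Both homomorphisms make V a graded E-module, and p V is a space of free
    generators for either structure; u is the isomorphism of E-modules that is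
    the identity on p V. *)
Lemma hom_conj C (al be : {lrmorphism E -> C}) : locally_elementary C ->
  is_ghom al -> is_ghom be ->
  exists u v : C, [/\ gcomp 0 u, gcomp 0 v, u * v = 1, v * u = 1 &
    forall a, u * be a = al a * u].
Proof.
move=> LE gal gbe.
have [p [p0 _ pP]] := transversal_idempotent LE B
  ([seq al (X t) | t <- enum G] ++ [seq be (X t) | t <- enum G]).
have [al1 alc] : \sum_t al (X t) * p * al (Y t) = 1 /\
    forall a, p * al a * p = c 0 a *: p.
  by apply: pP => // t; rewrite mem_cat (mem_values (fun t => al (X t))).
have [be1 bec] : \sum_t be (X t) * p * be (Y t) = 1 /\
    forall a, p * be a * p = c 0 a *: p.
  by apply: pP => // t; rewrite mem_cat orbC (mem_values (fun t => be (X t))).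
have key (f g : {lrmorphism E -> C}) : (forall a, p * g a * p = c 0 a *: p) ->
    (\sum_t f (X t) * p * g (Y t)) * (\sum_t g (X t) * p * f (Y t)) =
    \sum_t f (X t) * p * f (Y t).
  move=> gc; rewrite mulr_suml; apply: eq_bigr => s _.
  transitivity (\sum_t c 0 (Y s * X t) *: (f (X s) * p * f (Y t))).
    rewrite mulr_sumr; apply: eq_bigr => t _.
    have -> : f (X s) * p * g (Y s) * (g (X t) * p * f (Y t)) =
        f (X s) * (p * g (Y s * X t) * p) * f (Y t) by rewrite rmorphM !mulrA.
    by rewrite gc -scalerAr -scalerAl.
  rewrite (bigD1 s) //= big1 ?addr0 => [|t ts].
    case: (boolP (s \in H)) => sH; first by rewrite (gbc_YX B) // eqxx scale1r.
    by rewrite (gbY0 B sH) mul0r (gbc0 B) rmorph0 mulr0 scale0r.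
  case: (boolP (t \in H)) => tH.
    by rewrite (gbc_YX B) // eq_sym (negPf ts) scale0r.
  by rewrite (gbX0 B tH) mulr0 (gbc0 B) scale0r.
have deg (f g : {lrmorphism E -> C}) : is_ghom f -> is_ghom g ->
    gcomp 0 (\sum_t f (X t) * p * g (Y t)).
  move=> gf gg; apply: gcomp_sum => t _; rewrite -(subrr t) -[X in X - _]addr0.
  by apply: gcompM; [apply: gcompM => //; apply/gf/(gbX B) | apply/gg/(gbY B)].
exists (\sum_t al (X t) * p * be (Y t)), (\sum_t be (X t) * p * al (Y t)).
split; try exact: deg.
- by rewrite key.
- by rewrite key.
move=> a; rewrite mulr_suml mulr_sumr.
under eq_bigr do rewrite -mulrA -rmorphM.
under [RHS]eq_bigr do rewrite !mulrA -rmorphM.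
by rewrite -(casimir_out B (homs_bilinear al be p)).
Qed.

(** On V, the direct sum of the th (X t) (p V), right multiplication in E makes
    sense: R a sends th b v to th (b * a) v for v in p V.  To commute with the
    matrix units e as well, this is done in the corner of [e o o] and spread. *)
Lemma opposite_action C (th : {lrmorphism E -> C}) (I : finType) (d : I -> G)
    (e : I -> I -> C) : locally_elementary C -> is_ghom th -> mxunits d e ->
  (forall a i j, th a * e i j = e i j * th a) ->
  exists R : {lrmorphism gop E -> C}, [/\ is_ghom R,
    forall a i j, R a * e i j = e i j * R a &
    forall a b, R a * th b = th b * R a].
Proof.
move=> LE gth U the; have [o] := mu_inh U.
have [p [p0 pe pP]] := transversal_idempotent LE B
  (e o o :: [seq th (X t) | t <- enum G]).
have [th1 thc] : \sum_t th (X t) * p * th (Y t) = 1 /\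
    forall a, p * th a * p = c 0 a *: p.
  by apply: pP => // t; rewrite inE orbC (mem_values (fun t => th (X t))).
have {pe}pe : e o o * p = p * e o o.
  by apply: pe; rewrite ?inE ?eqxx // -(subrr (d o)); apply: (mu_deg U).
(* Averaging with the Casimir element maps C to the centraliser of th; the
   right multiplication by a is the average of th a * p. *)
pose cas (u : C) := \sum_t th (X t) * u * th (Y t).
have casP k u v : cas (k *: u + v) = k *: cas u + cas v.
  rewrite scaler_sumr -big_split; apply: eq_bigr => t _ /=.
  by rewrite mulrDr mulrDl -scalerAr -scalerAl.
have cas_comm u b : cas u * th b = th b * cas u.
  rewrite mulr_suml mulr_sumr.
  under eq_bigr do rewrite -mulrA -rmorphM.
  under [RHS]eq_bigr do rewrite !mulrA -rmorphM.
  by rewrite -(casimir_out B (homs_bilinear th th u)).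
have cas_mid u b : cas (th b * u) = cas (u * th b).
  rewrite /cas; under eq_bigr do rewrite !mulrA -rmorphM.
  under [RHS]eq_bigr do rewrite !mulrA -mulrA -rmorphM.
  exact: (casimir_mid B (homs_bilinear th th u) b).
have cas_mul u v : (forall b, v * th b = th b * v) -> cas u * v = cas (u * v).
  move=> vC; rewrite mulr_suml; apply: eq_bigr => t _.
  by rewrite -!mulrA vC.
pose r (a : E) := cas (th a * p).
(* p annihilates all the translates of p V except p V itself. *)
have pr b : p * r b = p * th b.
  rewrite mulr_sumr [in RHS](gb_dual B b) linear_sum mulr_sumr; apply: eq_bigr => t _.
  by rewrite !mulrA -(mulrA p) -rmorphM thc linearZ -scalerAl scalerAr.
have rM a b : r a * r b = r (b * a).
  rewrite /r (cas_mul (th a * p)); last by move=> x; rewrite cas_comm.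
  rewrite -mulrA -/(r b) pr mulrA -cas_mid mulrA -rmorphM; congr (cas (_ * _)).
have r_o a : e o o * r a = r a * e o o.
  rewrite mulr_sumr mulr_suml; apply: eq_bigr => t _.
  rewrite !mulrA -the -(mulrA (th (X t))) -the mulrA -(mulrA _ (e o o) p) pe.
  by rewrite -!mulrA -the.
pose R (a : gop E) := spread e o (r a).
have Rl : linear R by move=> k a b; rewrite /R /r linearP mulrDl -scalerAl casP spreadP.
have R1 : R 1 = 1.
  by rewrite /R /r [1 : gop E]/(1 : E) rmorph1 mul1r /cas th1 (spread1 o U).
have RM : {morph R : a b / a * b} by move=> a b; rewrite /R (spreadM U) // rM.
exists (lrmk Rl R1 RM); split=> [g a ag|a i j|a b]; rewrite lrmkE.
- apply: (spread_deg o U); apply: gcomp_sum => t _.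
  have -> : g = t + (g + 0) - t by rewrite addr0 addrC addKr.
  apply: gcompM; last exact/gth/(gbY B); apply: gcompM; first exact/gth/(gbX B).
  by apply: gcompM => //; apply: gth.
- exact: (spread_comm U).
- rewrite mulr_suml mulr_sumr; apply: eq_bigr => k _.
  by rewrite -mulrA -the !mulrA the -(mulrA _ (r a)) cas_comm !mulrA.
Qed.

End InnerConjugation.

Section LocallyElementary.
Variables (G : finZmodType) (F : fieldType).
Implicit Types A B C : gralg G F.

Lemma mxunits_map A C (f : {lrmorphism A -> C}) (I : finType) (d : I -> G)
    (e : I -> I -> A) : is_ghom f -> mxunits d e -> mxunits d (fun i j => f (e i j)).
Proof.
move=> gf U; split=> [i j|i j k l|]; first exact/gf/(mu_deg U).
  by rewrite -rmorphM (mu_mul U); case: eqP => // _; rewrite rmorph0.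
by rewrite -linear_sum (mu_one U) rmorph1.
Qed.

Lemma mspan_map A C (f : {lrmorphism A -> C}) (I : finType) (e : I -> I -> A) x :
  mspan e x -> mspan (fun i j => f (e i j)) (f x).
Proof.
move=> [c ->]; exists c; rewrite linear_sum; apply: eq_bigr => i _.
by rewrite linear_sum; apply: eq_bigr => j _; rewrite linearZ.
Qed.

Lemma locally_elementary_iso A C : giso A C -> locally_elementary A -> locally_elementary C.
Proof.
move=> [f [h [gf gh fK hK]]] LE s; have [I [d [e [U sU]]]] := LE [seq h x | x <- s].
exists I, d, (fun i j => f (e i j)); split; first exact: mxunits_map.
by move=> x xs; rewrite -(hK x); apply/mspan_map/sU/map_f.
Qed.

Lemma mspanP C (I : finType) (e : I -> I -> C) k x y :
  mspan e x -> mspan e y -> mspan e (k *: x + y).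
Proof.
move=> [a ->] [b ->]; exists (fun i j => k * a i j + b i j).
rewrite scaler_sumr -big_split; apply: eq_bigr => i _ /=.
rewrite scaler_sumr -big_split; apply: eq_bigr => j _ /=.
by rewrite scalerDl scalerA.
Qed.

Lemma mspan0 C (I : finType) (e : I -> I -> C) : mspan e 0.
Proof.
exists (fun _ _ => 0); rewrite big1 // => i _; rewrite big1 // => j _.
by rewrite scale0r.
Qed.

Lemma mspan_sum C (I : finType) (e : I -> I -> C) (J : Type) (r : seq J) (P : pred J) f :
  (forall j, P j -> mspan e (f j)) -> mspan e (\sum_(j <- r | P j) f j).
Proof.
move=> H; apply: big_ind => //; first exact: mspan0.
by move=> x y xe ye; rewrite -[x]scale1r; apply: mspanP.
Qed.

Lemma mspan_unit C (I : finType) (e : I -> I -> C) i j : mspan e (e i j).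
Proof.
exists (fun k l => ((k == i) && (l == j))%:R).
rewrite (bigD1 i) //= (bigD1 j) //= !eqxx scale1r big1 => [|l /negPf ->];
  last by rewrite scale0r.
rewrite big1 ?addr0 // => k /negPf ki; rewrite big1 // => l _; by rewrite ki scale0r.
Qed.

Lemma mxunits_tens A C (I J : finType) (d : I -> G) (d' : J -> G)
    (e : I -> I -> A) (f : J -> J -> C) : mxunits d e -> mxunits d' f ->
  mxunits (fun p : I * J => d p.1 + d' p.2)
    (fun p q => pure (e p.1 q.1) (f p.2 q.2) : gtens A C).
Proof.
move=> U V; split=> [[i j] [k l]|[i j] [k l] [m n] [o p]|] /=.
- rewrite opprD addrACA; exact: tens_comp_pure (mu_deg U _ _) (mu_deg V _ _).
- rewrite gpureM (mu_mul U) (mu_mul V) xpair_eqE.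
  by case: eqP; case: eqP => //= _ _; rewrite ?pure0l ?pure0r.
rewrite -(pair_bigA _ (fun i j => pure (e i i) (f j j))) /=.
transitivity (pure 1 1 : gtens A C); last by [].
rewrite -(mu_one U) pure_suml; apply: eq_bigr => i _.
by rewrite -pure_sumr (mu_one V).
Qed.

Lemma tens_common A C (s : seq (gtens A C)) : exists (sA : seq A) (sC : seq C),
  forall x, x \in s -> exists2 t : seq (A * C),
    (forall p, p \in t -> p.1 \in sA /\ p.2 \in sC) & x = \sum_(p <- t) pure p.1 p.2.
Proof.
elim: s => [|x s [sA [sC IH]]]; first by exists [::], [::].
have [t xE] := tens_sum x.
exists ([seq p.1 | p <- t] ++ sA), ([seq p.2 | p <- t] ++ sC) => y; rewrite inE.
case: eqP => [-> _|_ /= /IH[u uP yE]].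
  by exists t => // p pt; rewrite !mem_cat !map_f.
by exists u => // p /uP[pA pC]; rewrite !mem_cat pA pC !orbT.
Qed.

Lemma locally_elementary_tens A C : locally_elementary A -> locally_elementary C ->
  locally_elementary (gtens A C).
Proof.
move=> LA LC s; have [sA [sC sP]] := tens_common s.
have [I [d [e [U sU]]]] := LA sA; have [J [d' [f [V sV]]]] := LC sC.
exists (I * J)%type, (fun p : I * J => d p.1 + d' p.2),
  (fun p q => pure (e p.1 q.1) (f p.2 q.2) : gtens A C).
split; first exact: mxunits_tens.
move=> x /sP[t tP ->]; rewrite big_seq; apply: mspan_sum => p /tP[/sU[a aE] /sV[b bE]].
rewrite aE bE pure_suml; apply: mspan_sum => i _; rewrite pure_suml.
apply: mspan_sum => k _; rewrite pure_sumr; apply: mspan_sum => j _.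
rewrite pure_sumr; apply: mspan_sum => l _; rewrite pureZl pureZr scalerA.
rewrite -[_ *: _]addr0; apply: mspanP; last exact: mspan0.
exact: (@mspan_unit (gtens A C) (I * J)%type _ (i, j) (k, l)).
Qed.

Lemma mxunits_delta n (d : 'I_n.+1 -> G) :
  mxunits d (fun i j => delta_mx i j : gmat (gtriv G F) d).
Proof.
split=> [i j k l|i j k l|].
- move=> g0; rewrite mxE; case: eqP => [ki|] //; case: eqP => [lj|] //=.
  by move: g0; rewrite ki lj addrA addNr add0r addNr eqxx.
- rewrite [LHS]mul_delta_mx_cond; case: eqP => _; by rewrite ?mulr1n ?mulr0n.
by rewrite [RHS]mx1_sum_delta.
Qed.

Lemma gmat_sum_delta n (d : 'I_n.+1 -> G) (x : gmat (gtriv G F) d) :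
  x = \sum_i \sum_j x i j *: (delta_mx i j : gmat (gtriv G F) d).
Proof.
apply/matrixP => i j.
rewrite summxE (bigD1 i) //= summxE (bigD1 j) //= !mxE !eqxx [_ *: _]mulr1.
rewrite big1 => [|l lj]; last by rewrite !mxE eq_sym (negPf lj) andbF [_ *: _]mulr0.
rewrite big1 ?addr0 // => k ki; rewrite summxE big1 // => l _.
by rewrite !mxE eq_sym (negPf ki) [_ *: _]mulr0.
Qed.

Lemma mspan_delta n (d : 'I_n.+1 -> G) (x : gmat (gtriv G F) d) :
  mspan (fun i j => delta_mx i j : gmat (gtriv G F) d) x.
Proof. by exists (fun i j => x i j); apply: gmat_sum_delta. Qed.

Lemma locally_elementary_mx n (d : 'I_n.+1 -> G) :
  locally_elementary (gmat (gtriv G F) d).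
Proof.
move=> s; exists 'I_n.+1, d, (fun i j => delta_mx i j : gmat (gtriv G F) d).
by split; [apply: mxunits_delta | move=> x _; apply: mspan_delta].
Qed.

End LocallyElementary.

(** * Direct limits of elementary matrix algebras *)

Section Subalgebra.
Variables (F : fieldType) (A : algType F) (S : subalgClosed A).

Record subalg := SubAlg { subalg_val : A; subalg_valP : subalg_val \in S }.

HB.instance Definition _ := [isSub for subalg_val].
HB.instance Definition _ := [Choice of subalg by <:].
HB.instance Definition _ := [SubChoice_isSubAlgebra of subalg by <:].

End Subalgebra.

Section GradedSubalgebra.
Variables (G : finZmodType) (F : fieldType) (A : gralg G F) (S : subalgClosed A).
Hypothesis Sg : forall g (x : A), x \in S -> gproj g x \in S.

Definition subalg_comp (g : G) (x : subalg S) : Prop := gcomp g (subalg_val x).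

Lemma subalg_dsum : is_direct_sum subalg_comp.
Proof.
pose p g (x : subalg S) : subalg S := SubAlg (Sg g (subalg_valP x)).
apply: (direct_sumP (p := p)).
- by move=> g; apply: gcomp0.
- by move=> g x y xg yg; apply: (dsumB (gcomp_dsum A)).
- by move=> g x; apply: gproj_in.
- move=> x; apply: val_inj; rewrite raddf_sum /=; exact: gproj_sum.
- by move=> g x y; apply: val_inj; apply: gprojD.
- move=> g h x xg; apply: val_inj; rewrite /= (gproj_id _ xg).
  by case: ifP.
Qed.

Lemma subalg_compZ g c x : subalg_comp g x -> subalg_comp g (c *: x).
Proof. exact: gcompZ. Qed.

Lemma subalg_compM g h x y :
  subalg_comp g x -> subalg_comp h y -> subalg_comp (g + h) (x * y).
Proof. exact: gcompM. Qed.

Definition gsubalg : gralg G F := GrAlg subalg_dsum subalg_compZ subalg_compM.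

End GradedSubalgebra.

Section Limits.
Variables (G : finZmodType) (F : fieldType).
Implicit Types A : gralg G F.

Section Union.
Variables (S : nat -> gralg G F) (phi : forall i, {lrmorphism S i -> S i.+1}).
Variables (A : gralg G F) (psi : forall i, {lrmorphism S i -> A}).
Hypothesis lim : is_direct_limit phi psi.

Lemma cocone_shift i k (x : S i) : exists y : S (k + i), psi (k + i) y = psi i x.
Proof.
elim: k => [|k [y yE]]; first by exists x.
by exists (phi (k + i) y); rewrite lim.1.2.
Qed.

Lemma cocone_common (s : seq A) : exists i, forall a, a \in s ->
  (exists j x, psi j x = a) -> exists x, psi i x = a.
Proof.
elim: s => [|b s [i iP]]; first by exists 0.
have [[j [x xE]]|nb] := pselect (exists j x, psi j x = b); last first.
  by exists i => a; rewrite inE => /orP[/eqP-> //|/iP].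
exists (j + i) => a; rewrite inE => /orP[/eqP-> _|/iP ai /ai[y <-]].
  by have [y yE] := cocone_shift i x; move: y yE; rewrite addnC => y yE; exists y;
    rewrite yE.
exact: cocone_shift.
Qed.

Definition limit_union : {pred A} := fun a => `[< exists i x, psi i x = a >].

Lemma limit_union_common (a b : A) : a \in limit_union -> b \in limit_union ->
  exists i x y, psi i x = a /\ psi i y = b.
Proof.
move=> /asboolP ua /asboolP ub; have [i iP] := cocone_common [:: a; b].
have [x xE] := iP a (mem_head _ _) ua.
have [y yE] := iP b (mem_last a [:: b]) ub.
by exists i, x, y.
Qed.

Lemma limit_union_closed : GRing.subsemialg_closed limit_union.
Proof.
split.
- by apply/asboolP; exists 0, 1; rewrite rmorph1.
- split=> [|a b]; first by apply/asboolP; exists 0, 0; rewrite rmorph0.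
  move=> ua ub; have [i [x [y [<- <-]]]] := limit_union_common ua ub.
  by apply/asboolP; exists i, (x + y); rewrite rmorphD.
- move=> c a /asboolP[i [x <-]]; apply/asboolP; exists i, (c *: x).
  by rewrite linearZ.
- move=> a b ua ub; have [i [x [y [<- <-]]]] := limit_union_common ua ub.
  by apply/asboolP; exists i, (x * y); rewrite rmorphM.
Qed.

HB.instance Definition _ :=
  GRing.isSubalgClosed.Build F A limit_union limit_union_closed.

Lemma limit_union_proj g (a : A) : a \in limit_union -> gproj g a \in limit_union.
Proof.
move=> /asboolP[i [x <-]]; apply/asboolP; exists i, (gproj g x).
by apply: ghom_proj; apply: lim.1.1.
Qed.

(** The union of the images is a graded subalgebra U to which the cocone
    corestricts.  The induced map from A to U, followed by the inclusion, agrees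
    with the identity on the cocone, hence is the identity. *)
Lemma limit_covered (a : A) : exists i x, psi i x = a.
Proof.
pose U := gsubalg limit_union_proj.
have inU i x : psi i x \in limit_union by apply/asboolP; exists i, x.
pose th_fun i (x : S i) : U := SubAlg (inU i x).
have thl i : linear (@th_fun i) by move=> c x y; apply: val_inj; rewrite /= linearP.
have th1 i : th_fun i 1 = 1 by apply: val_inj; rewrite /= rmorph1.
have thM i : {morph th_fun i : x y / x * y} by move=> x y; apply: val_inj;
  rewrite /= rmorphM.
pose th i : {lrmorphism S i -> U} := lrmk (thl i) (th1 i) (thM i).
have thE i x : subalg_val (th i x) = psi i x by rewrite lrmkE.
have [|u [gu uP] _] := lim.2 U th.
  split=> [i g x xg|i x]; first by rewrite lrmkE; apply: lim.1.1.
  by apply: val_inj; rewrite /= !thE lim.1.2.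
have vl : linear (@subalg_val F A limit_union : U -> A) by [].
pose v : {lrmorphism U -> A} := lrmk vl erefl (fun _ _ => erefl).
have [w _ wP] := lim.2 A psi lim.1.
have ugr : is_ghom (v \o u) by move=> g x xg; rewrite /= lrmkE; apply: gu.
have vuE : (v \o u) a = w a.
  by apply: wP => // i x; rewrite /= lrmkE uP thE.
have -> : a = subalg_val (u a).
  transitivity (w a); last by rewrite -vuE /= lrmkE.
  by apply: (wP idfun) => // g x.
by have /asboolP := subalg_valP (u a).
Qed.

End Union.

(** One vector at a time, so that a basis can be treated in stages by the
    intertwining argument. *)
Definition spanning A (u : nat -> A) : Prop := forall V : A -> Prop,
  V 0 -> (forall k x y, V x -> V y -> V (k *: x + y)) -> (forall n, V (u n)) ->
  forall x, V x.

Lemma limit_locally_elementary A : limit_of_elementary A -> locally_elementary A.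
Proof.
move=> [S [phi [psi [el gpsi lim]]]] s.
have [i iP] := cocone_common lim s.
have [x _ iso] := el i.
have LE : locally_elementary (S i).
  by apply: locally_elementary_iso (giso_sym iso) _; apply: locally_elementary_mx.
have /choice[y yP] : forall a, exists y, a \in s -> psi i y = a.
  move=> a; have [as_|_] := boolP (a \in s); last by exists 0.
  by have [y yE] := iP a as_ (limit_covered lim a); exists y.
have [I [d [e [U sU]]]] := LE [seq y a | a <- s].
exists I, d, (fun k l => psi i (e k l)); split; first exact: mxunits_map (lim.1.1 i) U.
by move=> a as_; rewrite -(yP a as_); apply/mspan_map/sU/map_f.
Qed.

Lemma elementary_spanned A : elementary_matrix_algebra A ->
  exists t : seq A, forall V : A -> Prop, V 0 ->
    (forall k x y, V x -> V y -> V (k *: x + y)) ->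
    (forall x, x \in t -> V x) -> forall x, V x.
Proof.
move=> [x _ [f [h [gf gh fK hK]]]].
set n := (size (degs x)).-1.
exists [seq h (delta_mx p.1 p.2) | p <- enum ({: 'I_n.+1 * 'I_n.+1})].
move=> V V0 VP Vt a; rewrite -(fK a); have [c ->] := mspan_delta (f a).
have VD b b' : V b -> V b' -> V (b + b').
  by move=> Vb Vb'; rewrite -[b]scale1r; apply: VP.
rewrite linear_sum; apply: big_ind => // i _.
rewrite linear_sum; apply: big_ind => // j _.
rewrite linearZ /= -[_ *: _]addr0; apply: VP => //; apply: Vt.
by apply/mapP; exists (i, j) => //; rewrite mem_enum.
Qed.

Lemma limit_spanned A : limit_of_elementary A -> exists u : nat -> A, spanning u.
Proof.
move=> [S [phi [psi [el _ lim]]]].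
pose P i (t : seq (S i)) := forall V : S i -> Prop, V 0 ->
    (forall k x y, V x -> V y -> V (k *: x + y)) ->
    (forall x, x \in t -> V x) -> forall x, V x.
have tP i : {t | P i t} := cid (elementary_spanned (el i)).
exists (fun n => if unpickle n is Some (i, k) then psi i (sval (tP i))`_k else 0).
move=> V V0 VP Vu a; have [i [x <-]] := limit_covered lim a.
apply: (svalP (tP i) (fun x => V (psi i x))) => [|k y z Vy Vz|y yt].
- by rewrite rmorph0.
- by rewrite linearP; apply: VP.
have := Vu (pickle (i, index y (sval (tP i)))).
by rewrite pickleK nth_index.
Qed.

Lemma spanning_tens A (B : gralg G F) (X : G -> B) (c : G -> B -> F) (u : nat -> A) :
  (forall b, b = \sum_t c t b *: X t) -> spanning u ->
  exists w : nat -> gtens A B, spanning w.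
Proof.
move=> bE Su.
exists (fun n => if unpickle n is Some (m, t) then pure (u m) (X t) else 0).
move=> V V0 VP Vw x.
have VD b b' : V b -> V b' -> V (b + b').
  by move=> Vb Vb'; rewrite -[b]scale1r; apply: VP.
have VX t a : V (pure a (X t)).
  apply: (Su (fun a => V (pure a (X t)))) => [|k y z Vy Vz|n].
  - by rewrite pure0l.
  - by rewrite pureDl pureZl; apply: VP.
  by have := Vw (pickle (n, t)); rewrite pickleK.
elim/tens_ind: x => // a b x Vx; apply: (VD) => //.
rewrite (bE b) pure_sumr; apply: big_ind => [//|x1 y1|t _]; first exact: VD.
by rewrite pureZr -[_ *: _]addr0; apply: VP.
Qed.

End Limits.

(** * Centralisers, cancellation and the inner flip *)

(** The operators psi act diagonally on the x t with eigenvalue 1 on x o, so the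
    normalised operators psi - chi t kill x t and fix x o; applied one after the
    other they leave x o alone. *)
Lemma isolate (F : fieldType) (W : lmodType F) (T : finType) (o : T) (x : T -> W)
    (I : W -> Prop) :
  (forall k a b, I a -> I b -> I (k *: a + b)) ->
  (forall t, t != o -> x t = 0 \/ exists (psi : W -> W) (chi : T -> F),
    [/\ linear psi, forall y, I y -> I (psi y), forall r, psi (x r) = chi r *: x r,
        chi o = 1 & chi t != 1]) ->
  I (\sum_t x t) -> I (x o).
Proof.
move=> IP sep Ix.
have I0 : I 0 by have := IP (-1) _ _ Ix Ix; rewrite scaleN1r addNr.
have IZ k a : I a -> I (k *: a) by move=> Ia; rewrite -[_ *: _]addr0; apply: IP.
have key (r : seq T) : o \notin r -> exists c : T -> F,
    [/\ c o = 1, forall t, t \in r -> c t *: x t = 0 & I (\sum_t c t *: x t)].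
  elim: r => [|t r IH].
    by exists (fun=> 1); split=> //; under eq_bigr do rewrite scale1r.
  rewrite inE negb_or eq_sym => /andP[to /IH[c [c1 c0 Ic]]].
  have [xt|[psi [chi [psil Ipsi psix chi1 chit]]]] := sep t to.
    exists c; split=> // s; rewrite inE => /orP[/eqP ->|/c0 //].
    by rewrite xt scaler0.
  have nz : 1 - chi t != 0 by rewrite subr_eq0 eq_sym.
  exists (fun s => (1 - chi t)^-1 * (chi s - chi t) * c s); split.
  - by rewrite chi1 c1 mulVf // mulr1.
  - move=> s; rewrite inE => /orP[/eqP ->|/c0 sr];
    first by rewrite subrr mulr0 mul0r scale0r.
    by rewrite -scalerA sr scaler0.
  have -> : \sum_s ((1 - chi t)^-1 * (chi s - chi t) * c s) *: x s =
      (1 - chi t)^-1 *: ((- chi t) *: (\sum_s c s *: x s) + psi (\sum_s c s *: x s)).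
    have psi0 : psi 0 = 0 by have := psil (-1) 0 0; rewrite scaler0 addr0 scaleN1r addNr.
    have psiD a b : psi (a + b) = psi a + psi b by have := psil 1 a b; rewrite !scale1r.
    rewrite (big_morph psi psiD psi0) scaler_sumr -big_split scaler_sumr /=.
    apply: eq_bigr => s _; have := psil (c s) (x s) 0; rewrite psi0 !addr0 => ->.
    rewrite psix !scalerA -scalerDl scalerA -mulrA; congr ((_ * _) *: _).
    by rewrite mulrBl addrC mulNr [c s * _]mulrC.
  by apply: IZ; apply: IP => //; apply: Ipsi.
have [|c [c1 c0 Ic]] := key [seq t <- enum T | t != o]; first by rewrite mem_filter eqxx.
move: Ic; rewrite (bigD1 o) //= c1 scale1r big1 ?addr0 // => t to.
by apply: c0; rewrite mem_filter to mem_enum.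
Qed.

Section TensorBasis.
Variables (G : finZmodType) (F : fieldType) (A E : gralg G F).
Variables (H : {set G}) (X Y : G -> E) (c : G -> E -> F).
Hypothesis B : gbasis H X Y c.
Local Notation T := (gtens A E).

Lemma tcoef_bil t : bilinear_for *:%R *:%R (fun (a : A) (b : E) => c t b *: a).
Proof.
split=> [b|a] k x y /=; first by rewrite scalerDr !scalerA mulrC.
by rewrite (gbcP B) scalerDl scalerA.
Qed.

(** The coordinates of the free A-module [gtens A E] along the basis [X]. *)
Definition tcoef t : T -> A := tlift (fun (a : A) (b : E) => c t b *: a).

Lemma tcoefP t : linear (tcoef t).
Proof. exact: tlift_is_linear (tcoef_bil t). Qed.

Lemma tcoef_pure t a b : tcoef t (pure a b) = c t b *: a.
Proof. exact: tlift_pure (tcoef_bil t). Qed.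

Lemma tcoef_inl a : tcoef 0 (tinl A E a) = a.
Proof. by rewrite tinlE tcoef_pure -(gbX1 B) (gbc_X0 B) eqxx scale1r. Qed.

Lemma tinl_inj : injective (tinl A E).
Proof. by move=> a b ab; rewrite -(tcoef_inl a) ab tcoef_inl. Qed.

Lemma tcoef_sum (z : T) : z = \sum_t pure (tcoef t z) (X t).
Proof.
have L : linear (fun z : T => \sum_t pure (tcoef t z) (X t) : T).
  move=> k x y; rewrite scaler_sumr -big_split; apply: eq_bigr => t _ /=.
  by rewrite tcoefP pureDl pureZl.
apply: (lin_tens_eq (f := id) _ L) => // a b.
rewrite {1}(gb_sum B b) pure_sumr; apply: eq_bigr => t _.
by rewrite tcoef_pure pureZl pureZr.
Qed.

Lemma tcoef_deg t g (z : T) : gcomp g z -> gcomp (g - t) (tcoef t z).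
Proof.
have TD x y : tcoef t (x + y) = tcoef t x + tcoef t y.
  by have := tcoefP t 1 x y; rewrite !scale1r.
have T0 : tcoef t 0 = 0 by apply: (addrI (tcoef t 0)); rewrite -TD !addr0.
move=> [s sP ->]; rewrite (big_morph _ TD T0) big_seq.
apply: gcomp_sum => p /sP[h [k [<- ph pk]]]; rewrite tcoef_pure.
have [->|tk] := eqVneq t k; first by rewrite addrK; apply: gcompZ.
by rewrite (gbc_homog B pk tk) scale0r; apply: gcomp0.
Qed.

Lemma tcoef_conj s t (z : T) : s \in H ->
  tcoef t (tinr A E (X s) * z * tinr A E (Y s)) = gb_char X Y c s t *: tcoef t z.
Proof.
move=> sH; have L1 : linear (fun z : T => tcoef t (tinr A E (X s) * z * tinr A E (Y s))).
  by move=> k x y; rewrite mulrDr mulrDl -scalerAr -scalerAl tcoefP.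
have L2 : linear (fun z : T => gb_char X Y c s t *: tcoef t z).
  by move=> k x y; rewrite tcoefP scalerDr !scalerA mulrC.
apply: (lin_tens_eq L1 L2) => a b;
  rewrite !tinrE !gpureM !(mul1r, mulr1) !tcoef_pure scalerA.
congr (_ *: _); elim/(gb_ind B): b => [|k u v IHu IHv|r rH].
- by rewrite mulr0 mul0r (gbc0 B) mulr0.
- by rewrite mulrDr mulrDl -scalerAr -scalerAl !(gbcP B) IHu IHv mulrDr mulrCA.
rewrite (gb_conj B) (gbcZ B) (gbcX B); case: eqP => [<-//|_].
by rewrite !mulr0.
Qed.

Hypothesis cB : gbcentral H X Y c.

(** Conjugation by X s multiplies the coordinate along X t by the bicharacter,
    which is nondegenerate; so an element fixed by all these conjugations has
    only its coordinate along X 0 = 1. *)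
Lemma tens_centralizer (z : T) :
  (forall b, z * tinr A E b = tinr A E b * z) -> z = tinl A E (tcoef 0 z).
Proof.
move=> zC; rewrite [LHS]tcoef_sum (bigD1 0) //= big1 ?addr0 => [|t t0].
  by rewrite (gbX1 B) tinlE.
case: (boolP (t \in H)) => tH; last by rewrite (gbX0 B tH) pure0r.
have [s sH st] := cB tH t0; have := tcoef_conj t z sH.
rewrite -zC -mulrA -rmorphM (gbXY B) // rmorph1 mulr1 => /eqP.
rewrite -subr_eq0 -{1}[tcoef t z]scale1r -scalerBl scaler_eq0 subr_eq0 eq_sym.
by rewrite (negPf st) => /eqP ->; rewrite pure0l.
Qed.

(** Multiplying by Y t moves the coordinate along X t to 0, where conjugations by
    the X s isolate it. *)
Lemma tens_ideal (I : T -> Prop) :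
  (forall k x y, I x -> I y -> I (k *: x + y)) ->
  (forall b x, I x -> I (tinr A E b * x)) ->
  (forall b x, I x -> I (x * tinr A E b)) ->
  forall z t, I z -> t \in H -> I (tinl A E (tcoef t z)).
Proof.
move=> IP Il Ir z t Iz tH.
pose z' := z * tinr A E (Y t).
have -> : tcoef t z = tcoef 0 z'.
  have L : linear (fun z : T => tcoef 0 (z * tinr A E (Y t))).
    by move=> k x y; rewrite mulrDl -scalerAl tcoefP.
  apply: (lin_tens_eq (tcoefP t) L) => a b; rewrite tinrE gpureM mulr1 !tcoef_pure.
  congr (_ *: _); elim/(gb_ind B): b => [|k u v IHu IHv|r rH].
  - by rewrite mul0r !(gbc0 B).
  - by rewrite mulrDl -scalerAl !(gbcP B) IHu IHv.
  rewrite (gbcX B) rH andbT; case: eqP => [->|tr].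
    by rewrite (gbXY B) // -(gbX1 B) (gbc_X0 B) eqxx.
  rewrite (gbc_homog (t := r - t) B) //; first exact: gcompM (gbX B r) (gbY B t).
  by rewrite eq_sym subr_eq0 eq_sym; apply/eqP.
have Iz' : I z' by apply: Ir.
have := tcoef_sum z'; move: (z') Iz' => {z Iz z'} z Iz zE; rewrite zE in Iz.
rewrite tinlE -(gbX1 B).
apply: (isolate (x := fun t => pure (tcoef t z) (X t) : T) IP _ Iz) => {tH}t t0.
case: (boolP (t \in H)) => tH; last by left; rewrite (gbX0 B tH) pure0r.
have [s sH st] := cB tH t0; right.
exists (fun y => tinr A E (X s) * y * tinr A E (Y s)), (gb_char X Y c s); split=> //.
- by move=> k x y; rewrite mulrDr mulrDl -scalerAr -scalerAl.
- by move=> y Iy; apply/Ir/Il.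
- by move=> r; rewrite !tinrE !gpureM mulr1 mul1r (gb_conj B) pureZr.
- exact: gb_char0 B _ sH.
Qed.

Lemma tens_central : central_algebra A -> central_algebra T.
Proof.
move=> cA z zC; have zE := tens_centralizer (fun b => zC (tinr A E b)).
have [k kE] : exists k : F, tcoef 0 z = k%:A.
  by apply: cA => a; apply: tinl_inj; rewrite !rmorphM /= -zE zC.
by exists k; rewrite zE kE linearZ rmorph1.
Qed.

End TensorBasis.

Section Cancellation.
Variables (G : finZmodType) (F : fieldType) (A A' E : gralg G F).
Variables (H : {set G}) (X Y : G -> E) (c : G -> E -> F).
Hypotheses (B : gbasis H X Y c) (cB : gbcentral H X Y c).

(** The isomorphism yields a second copy of E in [gtens A' E], conjugate to the
    standard one; hence so are the centralisers of the two copies, which are A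
    and A'. *)
Lemma giso_cancel : locally_elementary (gtens A' E) ->
  giso (gtens A E) (gtens A' E) -> giso A A'.
Proof.
move=> LE [f [h [gf gh fK hK]]].
pose al : {lrmorphism E -> gtens A' E} := f \o tinr A E.
have gal : is_ghom al by move=> g x xg; apply/gf/tinr_ghom.
have [u [v [u0 v0 uv vu uC]]] := hom_conj B LE gal (@tinr_ghom _ _ A' E).
have vC b : v * al b = tinr A' E b * v.
  by rewrite -[LHS]mulr1 -uv mulrA -[v * al b * u]mulrA -uC !mulrA vu mul1r.
pose t0 := tcoef (A := A') c 0.
have fiE a : v * f (tinl A E a) * u = tinl A' E (t0 (v * f (tinl A E a) * u)).
  apply: (tens_centralizer B cB) => b.
  rewrite -mulrA uC [RHS]mulrA [in RHS]mulrA -vC -!mulrA; congr (_ * _); rewrite !mulrA.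
  by congr (_ * _); rewrite /al /= -!rmorphM tinlr_comm.
pose fi a := t0 (v * f (tinl A E a) * u).
have inj := tinl_inj (A := A') B.
have fil : linear fi.
  move=> k a b; rewrite /fi linearP /= linearP /= mulrDr mulrDl -scalerAr -scalerAl.
  exact: (tcoefP (A := A') B).
have fi1 : fi 1 = 1 by apply: inj; rewrite -fiE !rmorph1 mulr1 vu.
have fiM : {morph fi : a b / a * b}.
  move=> a b; apply: inj; rewrite rmorphM /= -!fiE !rmorphM /= !mulrA.
  by rewrite -[v * f (tinl A E a) * u * v]mulrA uv mulr1.
apply: (@giso_bij _ _ A A' (lrmk fil fi1 fiM)).
- move=> g a ag; rewrite lrmkE /fi -[g]subr0; apply: (tcoef_deg B).
  rewrite -[g]addr0 -[g]add0r; apply: gcompM => //; apply: gcompM => //.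
  by apply/gf/tinl_ghom.
- move=> a b; rewrite !lrmkE => /(congr1 (tinl A' E)); rewrite -!fiE => ab.
  apply: (tinl_inj B (A := A)); rewrite -(fK (tinl A E a)) -(fK (tinl A E b)); congr (h _).
  rewrite -[LHS]mul1r -[RHS]mul1r -uv -!mulrA; congr (u * _).
  by rewrite -[LHS]mulr1 -[RHS]mulr1 -uv !mulrA; congr (_ * v).
move=> a'; pose z := h (u * tinl A' E a' * v).
have zE : z = tinl A E (tcoef c 0 z).
  apply: (tens_centralizer B cB) => b; rewrite -(fK (tinr A E b)) -!rmorphM; congr (h _).
  rewrite -/(al b) -!mulrA vC !mulrA -uC -!mulrA; congr (u * _).
  by rewrite !mulrA tinlr_comm.
exists (tcoef c 0 z); apply: inj; rewrite lrmkE -fiE -zE hK.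
by rewrite !mulrA vu mul1r -mulrA vu mulr1.
Qed.

End Cancellation.

Section Flip.
Variables (G : finZmodType) (F : fieldType) (E : gralg G F).
Variables (H : {set G}) (X Y : G -> E) (c : G -> E -> F).
Hypotheses (B : gbasis H X Y c) (cB : gbcentral H X Y c).
Local Notation T := (gtens E E).

(** The Casimir element w intertwines the flip by its invariance.  Since the
    flip turns left into right multiples of w, the left ideal and the right
    ideal of w are stable under one tensor factor on both sides; the coordinate
    of w at X 0 is 1, so both ideals contain 1. *)
Lemma flip_inner : exists w w' : T, [/\ gcomp 0 w, gcomp 0 w', w * w' = 1,
  w' * w = 1 & forall a b, w * pure a b = pure b a * w].
Proof.
pose w : T := \sum_t pure (X t) (Y t).
have wP a b : w * pure a b = pure b a * w.
  rewrite mulr_suml mulr_sumr.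
  under eq_bigr do rewrite gpureM.
  under [RHS]eq_bigr do rewrite gpureM.
  pose phi1 (x y : E) : T := pure x (y * b).
  have bf1 : bilinear_for *:%R *:%R phi1.
    split=> [y|x] k u v; rewrite /phi1 /= ?pureDl ?pureZl //.
    by rewrite mulrDl -scalerAl pureDr pureZr.
  rewrite (casimir_mid B bf1 a) /phi1.
  pose phi2 (x y : E) : T := pure x (a * y).
  have bf2 : bilinear_for *:%R *:%R phi2.
    split=> [y|x] k u v; rewrite /phi2 /= ?pureDl ?pureZl //.
    by rewrite mulrDr -scalerAr pureDr pureZr.
  rewrite (casimir_out B bf2 b) /phi2.
  by apply: eq_bigr => t _; rewrite mulrA.
have w0 : gcomp 0 w.
  apply: gcomp_sum => t _; rewrite -(subrr t).
  exact: tens_comp_pure (gbX B t) (gbY B t).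
have w1 : tcoef (A := E) c 0 w = 1.
  have TD x y : tcoef (A := E) c 0 (x + y) = tcoef c 0 x + tcoef c 0 y.
    by have := tcoefP (A := E) B 0 1 x y; rewrite !scale1r.
  have T0 : tcoef (A := E) c 0 0 = 0 by apply: (addrI (tcoef c 0 0)); rewrite -TD !addr0.
  rewrite (big_morph _ TD T0) (bigD1 0) //= big1 ?addr0 => [|t t0].
    by rewrite (tcoef_pure B) (gbY1 B) (gbX1 B) -(gbX1 B) (gbc_X0 B) eqxx scale1r.
  by rewrite (tcoef_pure B) (gbc_homog B (gbY B t)) ?scale0r // eq_sym oppr_eq0.
have wl b : w * tinl E E b = tinr E E b * w by rewrite tinlE tinrE wP.
have wr b : w * tinr E E b = tinl E E b * w by rewrite tinlE tinrE wP.
have [w' ww'] : exists w', w * w' = 1.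
  have : exists z, tinl E E (tcoef c 0 w) = w * z.
    apply: (tens_ideal B cB (I := fun x => exists z, x = w * z)) (gbH0 B).
    - by move=> k x y [z ->] [z' ->]; exists (k *: z + z'); rewrite mulrDr scalerAr.
    - by move=> b x [z ->]; exists (tinl E E b * z); rewrite !mulrA wl.
    - by move=> b x [z ->]; exists (z * tinr E E b); rewrite mulrA.
    - by exists 1; rewrite mulr1.
  by case=> z zE; exists z; rewrite -zE w1 rmorph1.
have [w'' w''w] : exists w', w' * w = 1.
  have : exists z, tinl E E (tcoef c 0 w) = z * w.
    apply: (tens_ideal B cB (I := fun x => exists z, x = z * w)) (gbH0 B).
    - by move=> k x y [z ->] [z' ->]; exists (k *: z + z'); rewrite mulrDl scalerAl.
    - by move=> b x [z ->]; exists (tinr E E b * z); rewrite mulrA.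
    - by move=> b x [z ->]; exists (z * tinl E E b); rewrite -!mulrA wr.
    - by exists 1; rewrite mul1r.
  by case=> z zE; exists z; rewrite -zE w1 rmorph1.
have e : w'' = w' by rewrite -[LHS]mulr1 -ww' mulrA w''w mul1r.
exists w, w'; split=> //; last by rewrite -e.
by have := ginv_homog w0 ww' w''w; rewrite oppr0.
Qed.

End Flip.

(** * Opposite algebras and matrix algebras *)

Section Opposite.
Variables (G : finZmodType) (F : fieldType) (E : gralg G F).

Lemma gbasis_op (H : {set G}) (X Y : G -> E) (c : G -> E -> F) :
  gbasis H X Y c -> gbasis (E := gop E) H X Y c.
Proof.
by case=> *; split.
Qed.

Lemma op_central : central_algebra E -> central_algebra (gop E).
Proof. by move=> cE z zC; apply: cE => x; rewrite -[LHS]/((x : gop E) * z) -zC. Qed.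

Lemma op_fd : finite_dimensional E -> finite_dimensional (gop E).
Proof. by []. Qed.

End Opposite.

Section Finiteness.
Variables (G : finZmodType) (F : fieldType).
Implicit Types A B : gralg G F.

Lemma iso_central A B : giso A B -> central_algebra A -> central_algebra B.
Proof.
move=> [f [h [gf gh fK hK]]] cA z zC.
have [k kE] : exists k : F, h z = k%:A.
  by apply: cA => x; rewrite -(fK x) -!rmorphM zC.
by exists k; rewrite -(hK z) kE linearZ rmorph1.
Qed.

Lemma fd_surj A B (f : A -> B) : linear f -> (forall b, exists a, f a = b) ->
  finite_dimensional A -> finite_dimensional B.
Proof.
move=> fl fsurj [s sP].
have fD x y : f (x + y) = f x + f y by have := fl 1 x y; rewrite !scale1r.
have f0 : f 0 = 0 by apply: (addrI (f 0)); rewrite -fD !addr0.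
have fZ k x : f (k *: x) = k *: f x by have := fl k x 0; rewrite f0 !addr0.
exists [seq f a | a <- s] => b; have [a <-] := fsurj b; have [c ->] := sP a.
have E : size [seq f a | a <- s] = size s by rewrite size_map.
exists (fun i => c (cast_ord E i)); rewrite (big_morph f fD f0).
rewrite (reindex (cast_ord E)) /=; last first.
  by exists (cast_ord (esym E)) => i _; [apply: cast_ordK | apply: cast_ordKV].
apply: eq_bigr => i _; rewrite fZ (nth_map 0) //.
by rewrite -E.
Qed.

Lemma fd_tens A B : finite_dimensional A -> finite_dimensional B ->
  finite_dimensional (gtens A B).
Proof.
move=> [s sP] [t tP].
pose l := [seq pure a b | a <- s, b <- t] : seq (gtens A B).
have inl (i : 'I_(size s)) (j : 'I_(size t)) : pure s`_i t`_j \in l.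
  by apply/allpairsP; exists (s`_i, t`_j); rewrite !mem_nth.
pose V (x : gtens A B) := exists c : 'I_(size l) -> F, x = \sum_i c i *: l`_i.
have V0 : V 0 by exists (fun=> 0); rewrite big1 // => i _; rewrite scale0r.
have VP k x y : V x -> V y -> V (k *: x + y).
  move=> [a ->] [b ->]; exists (fun i => k * a i + b i).
  by rewrite scaler_sumr -big_split; apply: eq_bigr => i _ /=; rewrite scalerDl scalerA.
have VD x y : V x -> V y -> V (x + y).
  by move=> Vx Vy; rewrite -[x]scale1r; apply: VP.
have Vl x : x \in l -> V x.
  move=> xl; have il : (index x l < size l)%N by rewrite index_mem.
  exists (fun i => (i == Ordinal il)%:R); rewrite (bigD1 (Ordinal il)) //= eqxx scale1r.
  by rewrite nth_index // big1 ?addr0 // => i /negPf ->; rewrite scale0r.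
exists l => x; rewrite -/(V x); elim/tens_ind: x => // a b x Vx; apply: (VD) => //.
have [c ->] := sP a; have [d ->] := tP b.
rewrite pure_suml; apply: big_ind => [//|y z|i _]; first exact: VD.
rewrite pure_sumr; apply: big_ind => [//|y z|j _]; first exact: VD.
by rewrite pureZl pureZr scalerA -[_ *: _]addr0; apply: VP => //; apply: Vl.
Qed.

Section Matrices.
Variables (E : gralg G F) (n : nat) (d : 'I_n.+1 -> G).

Lemma gmat_central : central_algebra (gmat E d) -> central_algebra E.
Proof.
move=> cM z zC; have [k kE] : exists k : F, z%:M = k%:A :> gmat E d.
  apply: cM => M; apply/matrixP => i j.
  rewrite [LHS]mxE [RHS]mxE (bigD1 i) //= big1 => [|k ki]; last first.
    by rewrite mxE eq_sym (negPf ki) mul0r.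
  rewrite [RHS](bigD1 j) //= big1 => [|k kj]; last by rewrite mxE (negPf kj) mulr0.
  by rewrite !mxE !eqxx !addr0 zC.
exists k; have := congr1 (fun M : matalg E n => M ord0 ord0) kE.
by rewrite !mxE eqxx.
Qed.

Lemma gmat_fd : finite_dimensional (gmat E d) -> finite_dimensional E.
Proof.
apply: (@fd_surj (gmat E d) E (fun M => M ord0 ord0)) => [k x y|b]; first by rewrite !mxE.
by exists b%:M; rewrite mxE eqxx.
Qed.

Lemma mx_scal_linear : linear (map_mx (fun k : F^o => k%:A : E) : gmat (gtriv G F) d ->
  gmat E d).
Proof. by move=> k x y; apply/matrixP => i j; rewrite !mxE scalerDl scalerA. Qed.
Lemma mx_scal1 : map_mx (fun k : F^o => k%:A : E) (1 : gmat (gtriv G F) d) = 1 :> gmat E d.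
Proof. by apply/matrixP => i j; rewrite !mxE; case: (i == j);
  rewrite ?scale1r ?scale0r. Qed.
Lemma mx_scalM : {morph (map_mx (fun k : F^o => k%:A : E) : gmat (gtriv G F) d -> gmat
  E d) : x y / x * y}.
Proof.
move=> x y; apply/matrixP => i j; rewrite !mxE scaler_suml; apply: eq_bigr => k _.
by rewrite !mxE mulr_algl scalerA.
Qed.

Definition mx_scal : {lrmorphism gmat (gtriv G F) d -> gmat E d} :=
  lrmk mx_scal_linear mx_scal1 mx_scalM.

Lemma mx_diag_linear : linear (fun b : E => b%:M : gmat E d).
Proof.
move=> k x y; apply/matrixP => i j; rewrite !mxE; case: eqP => _; rewrite ?mulr1n //.
by rewrite !mulr0n scaler0 addr0.
Qed.
Lemma mx_diagM : {morph (fun b : E => b%:M : gmat E d) : x y / x * y}.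
Proof. by move=> x y; rewrite [RHS]mul_scalar_mx scale_scalar_mx. Qed.

Definition mx_diag : {lrmorphism E -> gmat E d} := lrmk mx_diag_linear erefl mx_diagM.

Lemma mx_scal_ghom : is_ghom mx_scal.
Proof.
move=> g x xg i j; rewrite lrmkE mxE; have := xg i j; rewrite /gcomp /= /triv_comp /=.
have [e0 _|e0 /(_ isT) ->] := eqVneq (- d i + g + d j) 0; last by rewrite scale0r;
  apply: gcomp0.
by rewrite e0; apply: (@gcompZ G F E 0 (x i j) 1 (gcomp1 E)).
Qed.

Lemma mx_diag_ghom : is_ghom mx_diag.
Proof.
move=> g x xg i j; rewrite lrmkE mxE; case: eqP => [->|_]; last exact: gcomp0.
by rewrite mulr1n addrAC addNr add0r.
Qed.

Lemma mx_scal_diag x b : mx_scal x * mx_diag b = mx_diag b * mx_scal x.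
Proof.
rewrite !lrmkE; apply/matrixP => i j.
rewrite [LHS]mxE [RHS]mxE (bigD1 j) //= big1 => [|k kj];
  last by rewrite !mxE (negPf kj) mulr0.
rewrite [RHS](bigD1 i) //= big1 => [|k ki]; last by rewrite !mxE eq_sym (negPf ki) mul0r.
by rewrite !mxE !eqxx !addr0 mulr_algl mulr_algr.
Qed.

Definition mx_tens : {lrmorphism gtens (gmat (gtriv G F) d) E -> gmat E d} :=
  tpair mx_scal_diag.

Lemma mx_tensE x b i j : mx_tens (pure x b) i j = x i j *: b.
Proof.
rewrite tpairE !lrmkE [LHS]mxE (bigD1 j) //= big1 => [|k kj];
  last by rewrite !mxE (negPf kj) mulr0.
by rewrite !mxE eqxx addr0 mulr_algl.
Qed.

Lemma mx_tens_inl m : mx_tens (tinl _ _ m) = mx_scal m.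
Proof. exact: tpair_inl. Qed.
Lemma mx_tens_inr a : mx_tens (tinr _ _ a) = mx_diag a.
Proof. exact: tpair_inr. Qed.

Lemma mx_tens_ghom : is_ghom mx_tens.
Proof. by apply: tpair_ghom; [apply: mx_scal_ghom | apply: mx_diag_ghom]. Qed.

Lemma mx_tens_inj : injective mx_tens.
Proof.
pose K (M : gmat E d) : gtens (gmat (gtriv G F) d) E :=
  \sum_i \sum_j pure (delta_mx i j : gmat (gtriv G F) d) (M i j).
apply: (can_inj (g := K)).
apply: (lin_tens_eq (f := fun z => K (mx_tens z)) (g := id)) => [k x y|//|x b].
  rewrite linearP /K scaler_sumr -big_split; apply: eq_bigr => i _ /=.
  rewrite scaler_sumr -big_split; apply: eq_bigr => j _ /=.
  by rewrite !mxE pureDr pureZr.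
rewrite /K [in RHS](gmat_sum_delta x) pure_suml; apply: eq_bigr => i _.
by rewrite pure_suml; apply: eq_bigr => j _; rewrite mx_tensE pureZl pureZr.
Qed.

Lemma mx_tens_surj M : exists z, mx_tens z = M.
Proof.
exists (\sum_i \sum_j pure (delta_mx i j : gmat (gtriv G F) d) (M i j)).
rewrite linear_sum; apply/matrixP => i j;
  rewrite summxE (bigD1 i) //= linear_sum summxE (bigD1 j) //=.
rewrite mx_tensE mxE !eqxx scale1r big1 => [|l lj]; last first.
  by rewrite mx_tensE mxE eq_sym (negPf lj) andbF scale0r.
rewrite big1 ?addr0 // => k ki; rewrite linear_sum summxE big1 // => l _.
by rewrite mx_tensE mxE eq_sym (negPf ki) scale0r.
Qed.

Lemma giso_gmat : giso (gtens (gmat (gtriv G F) d) E) (gmat E d).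
Proof. exact: giso_bij mx_tens_ghom mx_tens_inj mx_tens_surj. Qed.

Lemma mx_tinr_inj : injective (tinr (gmat (gtriv G F) d) E).
Proof.
move=> a b ab; have : mx_diag a = mx_diag b.
  by rewrite -!mx_tens_inr ab.
rewrite !lrmkE => /(congr1 (fun M : matalg E n => M ord0 ord0)).
by rewrite !mxE eqxx.
Qed.

(** Through [mx_tens], a matrix over E commuting with the matrix units is
    scalar. *)
Lemma mx_centralizer (z : gtens (gmat (gtriv G F) d) E) :
  (forall m, z * tinl _ _ m = tinl _ _ m * z) -> exists a, z = tinr _ _ a.
Proof.
move=> zC; exists (mx_tens z ord0 ord0); apply: mx_tens_inj.
rewrite mx_tens_inr; set x := mx_tens z; rewrite lrmkE; apply/matrixP => i j.
have := congr1 (fun m => mx_tens m i ord0) (zC (delta_mx j ord0)).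
rewrite !(rmorphM mx_tens) /= mx_tens_inl -/x lrmkE [LHS]mxE (bigD1 j) // big1 => [|k
  kj]; last first.
  by rewrite !mxE (negPf kj) scale0r mulr0.
rewrite [RHS]mxE (bigD1 ord0) // [X in _ = _ + X]big1 => [|k k0]; last first.
  by rewrite !mxE (negPf k0) andbF scale0r mul0r.
rewrite !mxE !eqxx scale1r mulr1 /= !addr0 andbT => ->.
by case: eqP => _; rewrite ?scale1r ?mul1r ?scale0r ?mul0r.
Qed.

End Matrices.
End Finiteness.

(** * The regular bimodule of a central graded-division algebra *)

Section RegularRepresentation.
Variables (G : finZmodType) (F : fieldType) (E : gralg G F).
Variables (H : {set G}) (X Y : G -> E) (c : G -> E -> F).
Hypothesis B : gbasis H X Y c.

Local Notation n := (size (degs (xset H))).-1.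
Let d (i : 'I_n.+1) : G := nth 0 (degs (xset H)) i.
Local Notation M := (Mx (xset H) (gtriv G F)).

Lemma mem_degs_xset t : (t \in degs (xset H)) = (t \in H).
Proof. by rewrite -has_pred1 has_count count_degs ffunE; case: (t \in H). Qed.

Lemma uniq_degs_xset : uniq (degs (xset H)).
Proof.
by apply: count_mem_uniq => t; rewrite count_degs mem_degs_xset ffunE.
Qed.

Lemma size_degs_xset : n.+1 = size (degs (xset H)).
Proof.
rewrite prednK // lt0n size_eq0; apply/eqP => e.
by have := mem_degs_xset 0; rewrite e (gbH0 B).
Qed.

Lemma ltn_degs (i : 'I_n.+1) : (i < size (degs (xset H)))%N.
Proof. exact: leq_trans (ltn_ord i) (eq_leq size_degs_xset). Qed.

Lemma degs_in i : d i \in H.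
Proof. by rewrite -mem_degs_xset mem_nth // ltn_degs. Qed.

Lemma degs_inj : injective d.
Proof.
move=> i j /eqP; rewrite nth_uniq ?uniq_degs_xset ?ltn_degs //.
by move/eqP/val_inj.
Qed.

Definition degs_idx (t : G) : 'I_n.+1 := inord (index t (degs (xset H))).

Lemma degs_idxK t : t \in H -> d (degs_idx t) = t.
Proof.
move=> tH; rewrite /d inordK ?nth_index ?mem_degs_xset //.
by apply: leq_trans (eq_leq (esym size_degs_xset)); rewrite index_mem mem_degs_xset.
Qed.

Lemma degs_sum (W : nmodType) (f : G -> W) : \sum_i f (d i) = \sum_(t in H) f t.
Proof.
rewrite (reindex_onto d degs_idx) /= => [|t tH]; last exact: degs_idxK.
apply: eq_bigl => i; rewrite degs_in /=; apply/esym/eqP.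
by apply: degs_inj; rewrite degs_idxK // degs_in.
Qed.

Lemma degs_expand a : a = \sum_i c (d i) a *: X (d i).
Proof.
rewrite (degs_sum (fun t => c t a *: X t)) {1}(gb_sum B a) [RHS]big_mkcond.
by apply: eq_bigr => t _; case: ifP => // /negbT tH; rewrite (gbX0 B) // scaler0.
Qed.

Lemma gbc_mul_expand t a (f : E -> E) : linear f ->
  c t (f a) = \sum_i c (d i) a * c t (f (X (d i))).
Proof.
move=> fl.
have fD x y : f (x + y) = f x + f y by have := fl 1 x y; rewrite !scale1r.
have f0 : f 0 = 0 by apply: (addrI (f 0)); rewrite -fD !addr0.
have fZ k x : f (k *: x) = k *: f x by have := fl k x 0; rewrite f0 !addr0.
rewrite {1}(degs_expand a) (big_morph f fD f0) (gbc_sum B).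
by apply: eq_bigr => i _; rewrite fZ (gbcZ B).
Qed.

Definition lreg_mx (a : E) : M := \matrix_(i, j) (c (d i) (a * X (d j)) : F^o).
Definition rreg_mx (a : gop E) : M := \matrix_(i, j) (c (d i) (X (d j) * (a : E)) : F^o).

Lemma lreg_linear : linear lreg_mx.
Proof. by move=> k x y; apply/matrixP => i j; rewrite !mxE mulrDl -scalerAl (gbcP B). Qed.
Lemma rreg_linear : linear rreg_mx.
Proof. by move=> k x y; apply/matrixP => i j; rewrite !mxE mulrDr -scalerAr (gbcP B). Qed.
Lemma gbcX_degs i j : c (d i) (X (d j)) = (i == j)%:R.
Proof. by rewrite (gbcX B) degs_in andbT (inj_eq degs_inj). Qed.
Lemma lreg1 : lreg_mx 1 = 1.
Proof. by apply/matrixP => i j; rewrite !mxE mul1r gbcX_degs. Qed.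
Lemma rreg1 : rreg_mx 1 = 1.
Proof. by apply/matrixP => i j; rewrite !mxE mulr1 gbcX_degs. Qed.
Lemma lregM : {morph lreg_mx : x y / x * y}.
Proof.
move=> x y; apply/matrixP => i j; rewrite !mxE -mulrA.
rewrite (gbc_mul_expand _ _ (f := fun u => x * u)) //; last by move=> k u v;
  rewrite mulrDr scalerAr.
by apply: eq_bigr => k _; rewrite !mxE mulrC.
Qed.
Lemma rregM : {morph rreg_mx : x y / x * y}.
Proof.
move=> x y; apply/matrixP => i j; rewrite !mxE gopM mulrA.
rewrite (gbc_mul_expand _ _ (f := fun u => u * (x : E))) //; last by move=> k u v;
  rewrite mulrDl scalerAl.
by apply: eq_bigr => k _; rewrite !mxE mulrC.
Qed.

Definition lreg : {lrmorphism E -> M} := lrmk lreg_linear lreg1 lregM.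
Definition rreg : {lrmorphism gop E -> M} := lrmk rreg_linear rreg1 rregM.

Lemma lreg_ghom : is_ghom lreg.
Proof.
move=> g a ag i j nz; rewrite lrmkE mxE.
apply: (gbc_homog B (gcompM ag (gbX B (d j)))).
by move: nz; rewrite -addrA addrC subr_eq0 eq_sym.
Qed.
Lemma rreg_ghom : is_ghom rreg.
Proof.
move=> g a ag i j nz; rewrite lrmkE mxE.
apply: (gbc_homog B (gcompM (gbX B (d j)) ag)).
by move: nz; rewrite -addrA addrC subr_eq0 eq_sym [d j + g]addrC.
Qed.

Lemma lreg_rreg a b : lreg a * rreg b = rreg b * lreg a.
Proof.
rewrite !lrmkE; apply/matrixP => i j; rewrite [LHS]mxE [RHS]mxE.
transitivity (c (d i) (a * X (d j) * (b : E))).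
  rewrite -mulrA (gbc_mul_expand _ _ (f := fun u => a * u)) //; last by move=> k u v;
    rewrite mulrDr scalerAr.
  by apply: eq_bigr => k _; rewrite !mxE mulrC.
rewrite (gbc_mul_expand _ _ (f := fun u => u * (b : E))) //; last by move=> k u v;
  rewrite mulrDl scalerAl.
by apply: eq_bigr => k _; rewrite !mxE mulrC.
Qed.

(** E as a bimodule over itself, in the homogeneous basis. *)
Definition bireg : {lrmorphism gtens E (gop E) -> M} := tpair lreg_rreg.

Lemma bireg_ghom : is_ghom bireg.
Proof. by apply: tpair_ghom; [apply: lreg_ghom | apply: rreg_ghom]. Qed.

(** By centrality of the opposite algebra, an ideal that contains z contains the
    coordinates of z, on which [bireg] is the faithful left regular
    representation. *)
Lemma bireg_inj : gbcentral (E := gop E) H X Y c -> injective bireg.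
Proof.
move=> cB; have B' := gbasis_op B.
have ker0 z : bireg z = 0 -> z = 0.
  move=> z0; rewrite (tcoef_sum B' z) big1 // => t _.
  case: (boolP (t \in H)) => tH; last by rewrite (gbX0 B tH) pure0r.
  suff -> : tcoef (A := E) (E := gop E) c t z = 0 by rewrite pure0l.
  have : bireg (tinl E (gop E) (tcoef (A := E) (E := gop E) c t z)) = 0.
    apply: (tens_ideal B' cB (I := fun x => bireg x = 0)) tH => //.
    - by move=> k x y x0 y0; rewrite linearP /= x0 y0 scaler0 addr0.
    - by move=> b x x0; rewrite rmorphM /= x0 mulr0.
    - by move=> b x x0; rewrite rmorphM /= x0 mul0r.
  rewrite tpair_inl; set a := tcoef _ _ _ => /= la0.
  rewrite (degs_expand a) big1 // => i _.
  have := congr1 (fun N : matalg F^o n => N i (degs_idx 0)) la0.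
  by rewrite lrmkE !mxE degs_idxK ?(gbH0 B) // (gbX1 B) mulr1 => ->; rewrite scale0r.
move=> x y xy; apply/eqP; rewrite -subr_eq0; apply/eqP; apply: ker0.
by rewrite linearB /= xy subrr.
Qed.

(** The operators X s (.) Y s are diagonal with entries given by the
    nondegenerate bicharacter, so polynomials in them isolate one diagonal matrix
    unit;
    multiplying by elements of E on both sides gives all the others. *)
Lemma bireg_surj : gbcentral H X Y c -> forall m, exists z, bireg z = m.
Proof.
move=> cB; pose I (m : M) := exists z, bireg z = m.
have IP k x y : I x -> I y -> I (k *: x + y).
  by move=> [x' <-] [y' <-]; exists (k *: x' + y'); rewrite linearP.
have IM x y : I x -> I y -> I (x * y).
  by move=> [x' <-] [y' <-]; exists (x' * y'); rewrite rmorphM.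
have IL a : I (lreg a) by exists (tinl _ _ a); rewrite tpair_inl.
have IR a : I (rreg a) by exists (tinr _ _ a); rewrite tpair_inr.
pose o := degs_idx 0; have d0 : d o = 0 by apply: degs_idxK; apply: (gbH0 B).
have Ioo : I (delta_mx o o : M).
  apply: (isolate (x := fun i => delta_mx i i : M)) => // [i io|]; last first.
    by exists 1; rewrite rmorph1; apply: esym (mu_one (mxunits_delta F d)).
  right; have i0 : d i != 0 by rewrite -d0 (inj_eq degs_inj).
  have [s sH st] := cB _ (degs_in i) i0.
  exists (fun m => rreg (Y s) * lreg (X s) * m), (fun i => gb_char X Y c s (d i));
    split=> //.
  - by move=> k x y; rewrite mulrDr scalerAr.
  - by move=> y Iy; apply: (IM) => //; apply: (IM).
  - move=> r; rewrite -lreg_rreg !lrmkE; apply/matrixP => k l.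
    rewrite [LHS]mxE (bigD1 r) //= big1 => [|q qr]; last by rewrite !mxE (negPf qr) mulr0.
    rewrite addr0 mxE; transitivity (c (d k) (X s * X (d r) * Y s) * (delta_mx r r : M)
      r l).
      congr (_ * _); rewrite -mulrA (gbc_mul_expand _ _ (f := fun u => X s * u)) //.
        by apply: eq_bigr => q _; rewrite !mxE mulrC.
      by move=> k' u v; rewrite mulrDr scalerAr.
    rewrite (gb_conj B) (gbcZ B) gbcX_degs !mxE eqxx [RHS]/(_ * _) -mulrA; congr (_ * _).
    by case: (k == r); rewrite ?mul1r ?mul0r.
  - by rewrite d0 (gb_char0 B).
have Ikl k l : I (delta_mx k l : M).
  have -> : delta_mx k l = lreg (X (d k)) * delta_mx o o * lreg (Y (d l)) :> M.
    apply/matrixP => i j; rewrite !lrmkE [RHS]mxE (bigD1 o) //= big1 => [|q qo]; last first.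
      rewrite mxE big1 ?mul0r // => r _; rewrite [delta_mx _ _ _ _]mxE (negPf qo) andbF.
      by rewrite mulr0.
    rewrite addr0 [X in _ = X * _]mxE (bigD1 o) //= big1 => [|q qo]; last first.
      by rewrite [delta_mx _ _ _ _]mxE (negPf qo) mulr0.
    rewrite addr0 !mxE !eqxx mulr1 d0 (gbX1 B) mulr1 gbcX_degs (gbc_YX B) ?degs_in //.
    by rewrite (inj_eq degs_inj) [l == j]eq_sym -natrM mulnb.
  by apply: (IM) => //; apply: (IM).
move=> m; rewrite -/(I m) (gmat_sum_delta m).
have ID x y : I x -> I y -> I (x + y) by move=> Ix Iy; rewrite -[x]scale1r; apply: (IP).
have I0 : I 0 by exists 0; rewrite rmorph0.
apply: big_ind => // i _; apply: big_ind => // j _.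
by rewrite -[_ *: _]addr0; apply: (IP).
Qed.

Lemma giso_bireg : gbcentral H X Y c -> gbcentral (E := gop E) H X Y c ->
  giso (gtens E (gop E)) M.
Proof.
move=> cB cB'; apply: (giso_bij bireg_ghom); first exact: bireg_inj.
exact: bireg_surj.
Qed.

End RegularRepresentation.

(** * Absorption of a graded-division algebra *)

Section Intertwining.
Variables (G : finZmodType) (F : fieldType) (A B : gralg G F).
Variable iota : {lrmorphism A -> B}.
Hypotheses (giota : is_ghom iota) (iota_inj : injective iota).
Variables (uA : nat -> A) (uB : nat -> B).
Hypotheses (spA : spanning uA) (spB : spanning uB).

Hypothesis push : forall (s : seq A) (b : B), exists v v' : B,
  [/\ gcomp 0 v, gcomp 0 v', v * v' = 1, v' * v = 1 &
    (forall a, a \in s -> v * iota a = iota a * v) /\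
    exists a, v * b * v' = iota a].

(** One-sided approximate intertwining.  Let v_1, v_2, ... be successive choices
    of the unit v of [push] and w_n = v_1^-1 ... v_n^-1.  The homomorphisms
    phi_n a = w_n iota(a) w_n^-1 are eventually constant on each a, because v_n
    commutes with the elements treated before; their limit is surjective, because
    v_n moves w_(n-1)^-1 b_n w_(n-1) into the image of iota, and the preimage found
    is added to the elements that later units must respect. *)
Lemma intertwining : giso A B.
Proof.
have /choice[f fP] : forall sb : seq A * B, exists r : B * B * A,
    [/\ gcomp 0 r.1.1, gcomp 0 r.1.2, r.1.1 * r.1.2 = 1, r.1.2 * r.1.1 = 1 &
      (forall a, a \in sb.1 -> r.1.1 * iota a = iota a * r.1.1) /\
      r.1.1 * sb.2 * r.1.2 = iota r.2].
  move=> [s b]; have [v [v' [v0 v'0 vv v'v [vs [a va]]]]] := push s b.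
  by exists (v, v', a).
pose step n (st : seq A * B * B) :=
  let r := f (st.1.1, st.2 * uB n * st.1.2) in
  (r.2 :: uA n :: st.1.1, st.1.2 * r.1.2, r.1.1 * st.2).
pose fix st n := if n is m.+1 then step m (st m) else ([::], 1, 1).
pose s n := (st n).1.1; pose w n := (st n).1.2; pose w' n := (st n).2.
pose r n := f (s n, w' n * uB n * w n).
have sS n : s n.+1 = (r n).2 :: uA n :: s n by [].
have wS n : w n.+1 = w n * (r n).1.2 by [].
have w'S n : w' n.+1 = (r n).1.1 * w' n by [].
have rP n := fP (s n, w' n * uB n * w n); rewrite -/(r _) /= in rP.
have inv n : [/\ gcomp 0 (w n), gcomp 0 (w' n), w n * w' n = 1 & w' n * w n = 1].
  elim: n => [|n [w0 w'0 ww w'w]]; first by rewrite !mulr1; split=> //; apply: gcomp1.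
  have [v0 v'0 vv v'v _] := rP n; rewrite wS w'S -[0]addr0; split; try exact: gcompM.
  - by rewrite mulrA -[w n * _ * _]mulrA v'v mulr1.
  - by rewrite mulrA -[_ * w' n * _]mulrA w'w mulr1.
pose phi n a := w n * iota a * w' n.
have phiS n a : a \in s n -> phi n.+1 a = phi n a.
  move=> an; have [_ _ vv v'v [vs _]] := rP n; rewrite /phi wS w'S.
  rewrite -!mulrA; congr (_ * _); rewrite !mulrA; congr (_ * _).
  by rewrite -mulrA -vs // mulrA v'v mul1r.
have phi_st m n a : a \in s n -> a \in s (m + n)%N /\ phi (m + n)%N a = phi n a.
  move=> an; elim: m => [//|m [IH1 IH2]]; rewrite addSn phiS // sS.
  by rewrite !inE IH1 !orbT.
have phi_stle m n a : a \in s n -> (n <= m)%N -> phi m a = phi n a.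
  by move=> an nm; have [_] := phi_st (m - n)%N n a an; rewrite subnK.
have phiP n k a b : phi n (k *: a + b) = k *: phi n a + phi n b.
  by rewrite /phi linearP mulrDr mulrDl -scalerAr -scalerAl.
have phiM n a b : phi n (a * b) = phi n a * phi n b.
  have [_ _ ww w'w] := inv n; rewrite /phi rmorphM !mulrA; congr (_ * _).
  by rewrite -[X in _ = X * _]mulrA w'w mulr1.
have /choice[N NP] : forall a, exists n, forall m, (n <= m)%N -> phi m a = phi n a.
  apply: spA => [|k a b [n nP] [m mP]|n].
  - by exists 0%N => m _; rewrite /phi !rmorph0 !mulr0 !mul0r.
  - exists (n + m)%N => l nml; rewrite !phiP.
    have [nl ml] : (n <= l)%N /\ (m <= l)%N.
      by split; apply: leq_trans nml; rewrite ?leq_addr ?leq_addl.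
    by rewrite nP // mP // [phi (n + m)%N a]nP ?leq_addr // [phi (n + m)%N b]mP ?leq_addl.
  - by exists n.+1 => m; apply: phi_stle; rewrite sS !inE eqxx orbT.
pose lim a := phi (N a) a.
have limE a m : (N a <= m)%N -> lim a = phi m a by move=> /NP.
have lim2 a b e : exists m, [/\ lim a = phi m a, lim b = phi m b & lim e = phi m e].
  exists (N a + N b + N e)%N; split; apply: limE.
  - by rewrite -addnA leq_addr.
  - by rewrite addnAC leq_addl.
  - exact: leq_addl.
have limP : linear lim.
  by move=> k a b; have [m [-> -> ->]] := lim2 a b (k *: a + b).
have lim1 : lim 1 = 1.
  by rewrite /lim /phi rmorph1 mulr1; case: (inv (N 1)).
have limM : {morph lim : a b / a * b}.
  by move=> a b; have [m [-> -> ->]] := lim2 a b (a * b).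
apply: (@giso_bij _ _ _ _ (lrmk limP lim1 limM)).
- move=> g a ag; rewrite lrmkE /lim /phi; have [w0 w'0 _ _] := inv (N a).
  rewrite -[g]addr0 -[g]add0r; apply: gcompM => //; apply: gcompM => //; exact: giota.
- move=> a b; rewrite !lrmkE; have [m [-> -> _]] := lim2 a b 0.
  have [_ _ ww w'w] := inv m.
  have ph x : iota x = w' m * phi m x * w m.
    by rewrite /phi !mulrA w'w mul1r -mulrA w'w mulr1.
  by move=> e; apply: iota_inj; rewrite !ph e.
suff H : forall b, exists a, lim a = b by move=> b; have [a aE] := H b; exists a;
  rewrite lrmkE.
apply: spB => [|k b b' [a <-] [a' <-]|n].
- exists 0; have := limP (-1) 0 0; by rewrite scaler0 addr0 scaleN1r addNr.
- by exists (k *: a + a'); rewrite limP.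
exists (r n).2; have aS : (r n).2 \in s n.+1 by rewrite sS mem_head.
have -> : lim (r n).2 = phi n.+1 (r n).2.
  rewrite (limE _ (N (r n).2 + n.+1)%N) ?leq_addr // (phi_stle _ n.+1) ?leq_addl //.
have [_ _ vv v'v [_ e]] := rP n; have [_ _ ww w'w] := inv n.
rewrite /phi wS w'S -e; move: vv v'v; set v := (f _).1.1; set v' := (f _).1.2 => vv v'v.
transitivity (w n * (v' * v) * w' n * uB n * w n * (v' * v) * w' n).
  by rewrite !mulrA.
by rewrite v'v !mulr1 ww mul1r -mulrA ww mulr1.
Qed.

End Intertwining.

Section Absorption.
Variables (G : finZmodType) (F : fieldType) (A E : gralg G F).

(** A condition on finite subsets that makes A isomorphic to [gtens A E] when A is
    countably spanned and E is central graded-division, see [absorb_iso]. *)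
Definition absorbs : Prop := forall s : seq A, exists th : {lrmorphism E -> A},
  is_ghom th /\ forall b a, a \in s -> th b * a = a * th b.

Variables (H : {set G}) (X Y : G -> E) (c : G -> E -> F).
Hypotheses (B : gbasis H X Y c) (cB : gbcentral H X Y c).

(** The image in [gtens A E] of the element inducing the flip of E, along a copy
    of E in A, moves 1 tensor E into A tensor 1 and commutes with what that copy
    commutes with; this is the hypothesis of the intertwining argument for the
    inclusion of A. *)
Lemma absorb_iso (u : nat -> A) : spanning u -> absorbs -> giso A (gtens A E).
Proof.
move=> spu ab; have [u' spu'] := spanning_tens (gb_sum B) spu.
apply: (intertwining (@tinl_ghom _ _ A E) (tinl_inj B (A := A)) spu spu') => s z.
have [t zE] := tens_sum z.
have [th [gth thC]] := ab (s ++ [seq p.1 | p <- t]).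
have tmC a b : (tinl A E \o th) a * tinr A E b = tinr A E b * (tinl A E \o th) a.
  exact: tinlr_comm.
pose tm : {lrmorphism gtens E E -> gtens A E} := tpair tmC.
have gtm : is_ghom tm.
  by apply: tpair_ghom; [move=> g x xg; apply/tinl_ghom/gth | apply: tinr_ghom].
have [w [w' [w0 w'0 ww w'w wP]]] := flip_inner B cB.
have tmS x a : a \in s ++ [seq p.1 | p <- t] -> tm x * tinl A E a = tinl A E a * tm x.
  move=> as_; apply: tpair_comm => [b|b]; last by rewrite tinlr_comm.
  by rewrite /= -!rmorphM thC.
exists (tm w), (tm w'); split; try exact: gtm.
- by rewrite -rmorphM ww rmorph1.
- by rewrite -rmorphM w'w rmorph1.
split=> [a as_|]; first by apply: tmS; rewrite mem_cat as_.
exists (\sum_(p <- t) p.1 * th p.2).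
rewrite zE mulr_sumr mulr_suml linear_sum big_seq [RHS]big_seq; apply: eq_bigr => p pt.
rewrite pureE mulrA tmS; last by rewrite mem_cat (map_f fst) ?orbT.
have e : tm w * tinr A E p.2 = tinl A E (th p.2) * tm w.
  have := congr1 tm (wP 1 p.2); rewrite !rmorphM /=.
  by rewrite -tinrE -tinlE tpair_inr tpair_inl.
by rewrite -!mulrA (mulrA (tm w)) e -!mulrA -rmorphM ww rmorph1 mulr1 /= -rmorphM.
Qed.

End Absorption.

(** * Graded modules and sums of shifts *)

Section MatrixHoms.
Variables (G : finZmodType) (F : fieldType) (A : gralg G F).
Variables (n : nat) (d : 'I_n.+1 -> G) (e : 'I_n.+1 -> 'I_n.+1 -> A).
Hypothesis U : mxunits d e.

Lemma gmat_hom : exists th : {lrmorphism gmat (gtriv G F) d -> A},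
  is_ghom th /\ forall m, th m = \sum_i \sum_j (m i j : F) *: e i j.
Proof.
pose f (m : gmat (gtriv G F) d) := \sum_i \sum_j (m i j : F) *: e i j.
have fl : linear f.
  move=> k x y; rewrite scaler_sumr -big_split; apply: eq_bigr => i _ /=.
  rewrite scaler_sumr -big_split; apply: eq_bigr => j _ /=.
  by rewrite !mxE scalerDl scalerA.
have f1 : f 1 = 1.
  rewrite -(mu_one U); apply: eq_bigr => i _; rewrite (bigD1 i) //= big1 => [|j ji].
    by rewrite mxE eqxx scale1r addr0.
  by rewrite mxE eq_sym (negPf ji) scale0r.
have fM : {morph f : x y / x * y}.
  move=> x y; rewrite [RHS]mulr_suml; apply: eq_bigr => i _.
  rewrite mulr_suml; under eq_bigr do rewrite mxE scaler_suml.
  rewrite exchange_big; apply: eq_bigr => k _ /=; rewrite /f mulr_sumr [RHS](bigD1 k) //=.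
  rewrite [X in _ + X]big1 => [|l lk]; last first.
    rewrite mulr_sumr big1 // => j _.
    by rewrite -scalerAl -scalerAr (mu_mul U) eq_sym (negPf lk) !scaler0.
  rewrite addr0 mulr_sumr; apply: eq_bigr => j _.
  by rewrite -scalerAl -scalerAr (mu_mul U) eqxx scalerA.
exists (lrmk fl f1 fM); split=> [g m mg|m]; rewrite lrmkE //.
apply: gcomp_sum => i _; apply: gcomp_sum => j _.
have [e0|e0] := eqVneq (- d i + g + d j) 0; last first.
  by rewrite [m i j](mg i j e0) scale0r; apply: gcomp0.
have -> : g = d i - d j.
  by rewrite -[d i]addr0 -e0 addrA addNKr addrK.
by apply: gcompZ; apply: (mu_deg U).
Qed.

End MatrixHoms.

Section GradedModuleTools.
Variables (G : finZmodType) (F : fieldType) (A : gralg G F).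
Implicit Types P Q R : grmod A.

Definition mproj P (g : G) (v : P) : P := dproj (mcomp_dsum P) g v.

Lemma mcomp0 P g : mcomp g (0 : P).
Proof. exact: dsum0 (mcomp_dsum P) g. Qed.
Lemma mcomp_sum P g (I : Type) (r : seq I) (p : pred I) (f : I -> P) :
  (forall i, p i -> mcomp g (f i)) -> mcomp g (\sum_(i <- r | p i) f i).
Proof. exact: dsum_sum (mcomp_dsum P) _ _ _ _ _. Qed.
Lemma mproj_in P g (x : P) : mcomp g (mproj g x).
Proof. exact: dproj_in. Qed.
Lemma mproj_sum P (x : P) : x = \sum_g mproj g x.
Proof. exact: dproj_sum. Qed.
Lemma mproj_id P g h (x : P) : mcomp g x -> mproj h x = if h == g then x else 0.
Proof. exact: dproj_id. Qed.
Lemma mprojD P g (x y : P) : mproj g (x + y) = mproj g x + mproj g y.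
Proof. exact: dprojD. Qed.
Lemma mproj0 P g : mproj g (0 : P) = 0.
Proof. by rewrite (mproj_id g (mcomp0 P g)) eqxx. Qed.
Lemma mproj_bigsum P g (I : Type) (r : seq I) (p : pred I) (f : I -> P) :
  mproj g (\sum_(i <- r | p i) f i) = \sum_(i <- r | p i) mproj g (f i).
Proof. exact: (big_morph (fun x : P => mproj g x) (@mprojD _ _) (mproj0 P g)). Qed.

Lemma mproj_scale P g h (a : A) (v : P) :
  mcomp h v -> mproj g (a *: v) = gproj (g - h) a *: v.
Proof.
move=> vh; rewrite {1}(gproj_sum a) scaler_suml mproj_bigsum (bigD1 (g - h)) //= big1
  => [|k kgh].
  by rewrite (mproj_id _ (mcompZ (gproj_in (g - h) a) vh)) subrK eqxx addr0.
rewrite (mproj_id _ (mcompZ (gproj_in k a) vh)); case: eqP => // ge.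
by move: kgh; rewrite ge addrK eqxx.
Qed.

Lemma gproj_mull g h (a b : A) : gcomp h a -> gproj (h + g) (a * b) = a * gproj g b.
Proof.
move=> ah; rewrite {1}(gproj_sum b) mulr_sumr gproj_bigsum (bigD1 g) //= big1 => [|k kg].
  by rewrite (gproj_id _ (gcompM ah (gproj_in g b))) eqxx addr0.
by rewrite (gproj_id _ (gcompM ah (gproj_in k b))) (inj_eq (addrI h)) eq_sym (negPf kg).
Qed.

Lemma mklin_subproof (V W : lmodType A) (f : V -> W) : linear f ->
  {g : {linear V -> W} | forall v, g v = f v}.
Proof.
move=> fl; pose fL := GRing.isLinear.Build A V W *:%R f fl.
pose g : {linear V -> W} := HB.pack f fL.
by exists g.
Qed.

Definition mklin (V W : lmodType A) (f : V -> W) (fl : linear f) : {linear V -> W} :=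
  sval (mklin_subproof fl).

Lemma mklinE (V W : lmodType A) (f : V -> W) (fl : linear f) v : mklin fl v = f v.
Proof. exact: (svalP (mklin_subproof fl)). Qed.

Lemma gmod_iso_sym P Q : gmod_iso P Q -> gmod_iso Q P.
Proof. by move=> [f [h [fg hg fh hf]]]; exists h, f. Qed.

Lemma iso_class_eq P Q : gmod_iso P Q -> iso_class P = iso_class Q.
Proof.
move=> PQ; apply/funext => R; apply/propext; split; apply: gmod_iso_trans => //.
exact: gmod_iso_sym.
Qed.

Lemma fg_retract (V W : lmodType A) (i : {linear W -> V}) (r : {linear V -> W}) :
  cancel i r -> finitely_generated V -> finitely_generated W.
Proof.
move=> ir [s sP]; have E : size [seq r v | v <- s] = size s by rewrite size_map.
exists [seq r v | v <- s] => w; have [c cE] := sP (i w).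
exists (fun k => c (cast_ord E k)); rewrite -[LHS]ir cE linear_sum.
rewrite (reindex (cast_ord E)) /=; last first.
  by exists (cast_ord (esym E)) => k _; [apply: cast_ordK | apply: cast_ordKV].
by apply: eq_bigr => k _; rewrite linearZ (nth_map 0) // -E.
Qed.

Lemma projective_retract (V W : lmodType A) (i : {linear W -> V}) (r : {linear V -> W}) :
  cancel i r -> projective V -> projective W.
Proof.
move=> ir pV M N f h fs; have [k kE] := pV M N f (h \o r) fs.
by exists (k \o i) => v; rewrite /= kE /= ir.
Qed.

(** R is the direct sum of the shifts of Q by the t in p, presented by
    inclusions and projections of degrees t and - t. *)
Definition shift_sum Q (p : pred G) R : Prop :=
  exists (io : G -> {linear Q -> R}) (pr : G -> {linear R -> Q}),
  [/\ forall t h v, p t -> mcomp h v -> mcomp (h + t) (io t v),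
      forall t h v, p t -> mcomp h v -> mcomp (h - t) (pr t v),
      forall s t v, p s -> p t -> pr s (io t v) = if s == t then v else 0 &
      forall v, \sum_(t | p t) io t (pr t v) = v].

Lemma shift_sum_iso Q p R R' : gmod_iso R R' -> shift_sum Q p R -> shift_sum Q p R'.
Proof.
move=> [f [h [fg hg fK hK]]] [io [pr [ig pg prio ioprE]]].
exists (fun t => f \o io t), (fun t => pr t \o h);
  split=> [t k v pt vk|t k v pt vk|s t v ps pt|v] /=.
- exact/fg/ig.
- exact/pg/hg.
- by rewrite fK prio.
- by rewrite -linear_sum ioprE hK.
Qed.

Lemma shift_sum_uniq Q p R R' : shift_sum Q p R -> shift_sum Q p R' -> gmod_iso R R'.
Proof.
move=> [io [pr [ig pg prio ioprE]]] [io' [pr' [ig' pg' prio' ioprE']]].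
have fl (V W : grmod A) (i : G -> {linear Q -> W}) (q : G -> {linear V -> Q}) :
    linear (fun v => \sum_(t | p t) i t (q t v)).
  move=> k x y; rewrite scaler_sumr -big_split; apply: eq_bigr => t _ /=.
  by rewrite !linearP.
have key (V W : grmod A) (i : G -> {linear Q -> W}) (q : G -> {linear V -> Q})
    (i' : G -> {linear Q -> V}) (q' : G -> {linear W -> Q}) :
    (forall s t v, p s -> p t -> q' s (i t v) = if s == t then v else 0) ->
    (forall v, \sum_(t | p t) i' t (q t v) = v) ->
    cancel (mklin (fl V W i q)) (mklin (fl W V i' q')).
  move=> qi iq v; rewrite !mklinE -[RHS]iq; apply: eq_bigr => s ps; congr (i' s _).
  rewrite linear_sum (bigD1 s) //= qi // eqxx big1 ?addr0 // => t /andP[pt ts].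
  by rewrite qi // eq_sym (negPf ts).
exists (mklin (fl R R' io' pr)), (mklin (fl R' R io pr')); split; last 2 first.
- exact: key.
- exact: key.
- move=> g v vg; rewrite mklinE; apply: mcomp_sum => t pt.
  by rewrite -[g](subrK t); apply: ig' => //; apply: pg.
- move=> g v vg; rewrite mklinE; apply: mcomp_sum => t pt.
  by rewrite -[g](subrK t); apply: ig => //; apply: pg'.
Qed.

Lemma shift_sum_fg Q p R : shift_sum Q p R -> finitely_generated Q -> finitely_generated R.
Proof.
move=> [io [pr [ig pg prio ioprE]]] [s sP].
pose l := [seq io t q | t <- enum G, q <- s].
pose V (x : R) := exists c : 'I_(size l) -> A, x = \sum_i c i *: l`_i.
have V0 : V 0 by exists (fun=> 0); rewrite big1 // => i _; rewrite scale0r.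
have VP k x y : V x -> V y -> V (k *: x + y).
  move=> [a ->] [b ->]; exists (fun i => k * a i + b i).
  by rewrite scaler_sumr -big_split; apply: eq_bigr => i _ /=; rewrite scalerDl scalerA.
have VD x y : V x -> V y -> V (x + y).
  by move=> Vx Vy; rewrite -[x]scale1r; apply: VP.
have Vl x : x \in l -> V x.
  move=> xl; have il : (index x l < size l)%N by rewrite index_mem.
  exists (fun i => (i == Ordinal il)%:R); rewrite (bigD1 (Ordinal il)) //= eqxx scale1r.
  by rewrite nth_index // big1 ?addr0 // => i /negPf ->; rewrite scale0r.
exists l => v; rewrite -/(V v) -(ioprE v); apply: big_ind => // t _.
have [c ->] := sP (pr t v); rewrite linear_sum; apply: big_ind => // i _.
rewrite linearZ /= -[_ *: _]addr0; apply: VP => //; apply: Vl.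
by apply/allpairsP; exists (t, s`_i); rewrite mem_enum mem_nth.
Qed.

Lemma shift_sum_projective Q p R : shift_sum Q p R -> projective Q -> projective R.
Proof.
move=> [io [pr [ig pg prio ioprE]]] pQ M N f h fs.
have /choice[k kE] := fun t => pQ M N f (h \o io t) fs.
have fl : linear (fun v => \sum_(t | p t) k t (pr t v)).
  move=> c x y; rewrite scaler_sumr -big_split; apply: eq_bigr => t _ /=.
  by rewrite !linearP.
exists (mklin fl) => v; rewrite mklinE linear_sum -{2}(ioprE v) linear_sum.
by apply: eq_bigr => t _; rewrite kE.
Qed.

Lemma shift_sum0 Q : shift_sum Q pred0 (gm_zero A).
Proof.
have l0 (V W : lmodType A) : linear (fun _ : V => 0 : W).
  by move=> k x y; rewrite scaler0 addr0.
exists (fun=> mklin (l0 Q (gm_zero A))), (fun=> mklin (l0 (gm_zero A) Q)); split=> // v.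
by rewrite big_pred0 //; apply/rowP; case.
Qed.

Lemma shift_sum1 Q g : shift_sum Q (pred1 g) (gm_shift g Q).
Proof.
exists (fun=> idfun : {linear Q -> gm_shift g Q}), (fun=> idfun : {linear gm_shift g Q
  -> Q}).
split=> [t h v /eqP -> vh|t h v /eqP -> vh|s t v /eqP -> /eqP ->|v] //=.
- by rewrite /mcomp /= /gm_shift_comp addrK.
- by rewrite eqxx.
- by rewrite big_pred1_eq.
Qed.

Lemma shift_sumD Q p p' R R' : shift_sum Q p R -> shift_sum Q p' R' ->
  (forall t, ~~ (p t && p' t)) -> shift_sum Q (fun t => p t || p' t) (gm_add R R').
Proof.
move=> [io [pr [ig pg prio ioprE]]] [io' [pr' [ig' pg' prio' ioprE']]] disj.
have il t : linear (fun v : Q => if p t then (io t v, 0) else (0, io' t v) : R * R').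
  move=> k x y; case: (p t); rewrite linearP; congr (_, _);
  by rewrite addr0; apply: esym (scaler0 _ k).
have pl t : linear (fun v : R * R' => if p t then pr t v.1 else pr' t v.2).
  by move=> k x y; case: (p t); rewrite linearP.
exists (fun t => mklin (il t : linear (_ : Q -> gm_add R R'))),
  (fun t => mklin (pl t : linear (_ : gm_add R R' -> Q))).
have p'F t : p' t -> p t = false by move=> p't; have := disj t; rewrite p't andbT => /negPf.
split=> [t h v ppt vh|t h v ppt vh|s t v ps pt|v].
- rewrite mklinE; case: ifP ppt => pt /= ppt; split=> /=;
    [exact: ig | exact: mcomp0 | exact: mcomp0 | exact: ig'].
- case: vh => v1 v2; rewrite mklinE; case: ifP ppt => pt /= ppt; [exact: pg | exact: pg'].
- rewrite !mklinE; case: ifP ps => [ps _|ps /= p's]; case: ifP pt => [pt _|pt /= p't] /=.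
  + exact: prio.
  + by rewrite linear0; case: eqP => // st; rewrite -st ps in pt.
  + by rewrite linear0; case: eqP => // st; rewrite st pt in ps.
  + exact: prio'.
have fstS (f : G -> R * R') : (\sum_(t | p t || p' t) f t).1 = \sum_(t | p t || p' t)
  (f t).1.
  exact: (big_morph fst).
have sndS (f : G -> R * R') : (\sum_(t | p t || p' t) f t).2 = \sum_(t | p t || p' t)
  (f t).2.
  exact: (big_morph snd).
rewrite [RHS]surjective_pairing [LHS]surjective_pairing fstS sndS; congr (_, _).
- rewrite -[RHS]ioprE [LHS]big_mkcond [RHS]big_mkcond; apply: eq_bigr => t _.
  rewrite !mklinE; case: ifP => [_|nt]; first by case: (p t).
  by case: ifP => // pt; rewrite pt in nt.
- rewrite -[RHS]ioprE' [LHS]big_mkcond [RHS]big_mkcond; apply: eq_bigr => t _.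
  rewrite !mklinE; case pt: (p t) => /=; last by case: (p' t).
  by case: ifP => // p't; have := disj t; rewrite pt p't.
Qed.

(** The iterated sum of classes is the class of an iterated direct sum, one
    summand being added for each t in turn. *)
Lemma k0_act_class (H : {set G}) Q : exists R,
  shift_sum Q (fun t => t \in H) R /\
  k0_act (xset H) (iso_class Q) = iso_class R.
Proof.
suff [R [sR kR]] : exists R, shift_sum Q (fun t => (t \in index_enum G) && (t \in H)) R /\
    k0_act (xset H) (iso_class Q) = iso_class R.
  exists R; split=> //; congr (shift_sum _ _ _): sR; apply/funext => t.
  by rewrite mem_index_enum.
rewrite /k0_act; elim: (index_enum G) (index_enum_uniq G) => [_|g r IH /= /andP[gr ur]].
  exists (gm_zero A); rewrite big_nil; split=> //.
  by have := shift_sum0 Q; congr (shift_sum _ _ _); apply/funext.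
have [R [sR kR]] := IH ur; rewrite big_cons kR ffunE.
case gH: (g \in H) => /=.
  exists (gm_add (gm_add (gm_shift g Q) (gm_zero A)) R); split; last first.
    by rewrite k0_shiftE /k0_zero !k0_addE.
  have s1 : shift_sum Q (fun t => pred1 g t || pred0 t) (gm_add (gm_shift g Q) (gm_zero A)).
    by apply: (shift_sumD (shift_sum1 Q g) (shift_sum0 Q)) => t; rewrite andbF.
  suff <- : (fun t => (pred1 g t || pred0 t) || ((t \in r) && (t \in H))) =
      (fun t => (t \in g :: r) && (t \in H)).
    apply: shift_sumD s1 sR _ => t; rewrite /= orbF; case: eqP => // ->.
    by rewrite (negPf gr).
  apply/funext => t; rewrite /= orbF inE; case: eqP => [->|] //=.
exists (gm_add (gm_zero A) R); split; last by rewrite /k0_zero k0_addE.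
suff <- : (fun t => pred0 t || ((t \in r) && (t \in H))) =
    (fun t => (t \in g :: r) && (t \in H)).
  by apply: shift_sumD (shift_sum0 Q) sR _ => t.
by apply/funext => t; rewrite /= inE; case: eqP => [->|] //=; rewrite gH andbF.
Qed.

End GradedModuleTools.

(** * Fixed submodules and graded dual bases *)

Section Submodule.
Variables (R : nzRingType) (V : lmodType R) (S : submodClosed V).

Record submod := SubMod { submod_val : V; submod_valP : submod_val \in S }.

HB.instance Definition _ := [isSub for submod_val].
HB.instance Definition _ := [Choice of submod by <:].
HB.instance Definition _ := [SubChoice_isSubLmodule of submod by <:].

End Submodule.

Section FixedPoints.
Variables (G : finZmodType) (F : fieldType) (A : gralg G F) (P : grmod A).
Variable f : {linear P -> P}.
Hypotheses (fg : forall g v, mcomp g v -> mcomp g (f v)) (ff : forall v, f (f v) = f v).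

Definition fixpts : {pred P} := fun v => f v == v.

Lemma fixpts_closed : GRing.subsemimod_closed fixpts.
Proof.
split; first split=> [|u v /eqP uE /eqP vE]; first exact/eqP/linear0.
  by apply/eqP; rewrite linearD /= uE vE.
by move=> a v /eqP vE; apply/eqP; rewrite linearZ /= vE.
Qed.

HB.instance Definition _ := GRing.isSubmodClosed.Build A P fixpts fixpts_closed.

Local Notation Q := (submod fixpts).

Lemma fixptsE (v : Q) : f (submod_val v) = submod_val v.
Proof. exact: eqP (submod_valP v). Qed.

Definition fix_comp (g : G) (v : Q) : Prop := mcomp g (submod_val v).

Lemma f_mproj g v : f (mproj g v) = mproj g (f v).
Proof.
symmetry; apply: (dproj_uniq (mcomp_dsum P) (f := fun g => f (mproj g v))) => [h|].
  by apply: fg; apply: mproj_in.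
by rewrite -linear_sum -mproj_sum.
Qed.

Lemma fix_dsum : is_direct_sum fix_comp.
Proof.
have pP g (v : Q) : mproj g (submod_val v) \in fixpts.
  by apply/eqP; rewrite f_mproj fixptsE.
apply: (direct_sumP (p := fun g v => SubMod (pP g v))).
- by move=> g; apply: mcomp0.
- by move=> g x y xg yg; apply: (dsumB (mcomp_dsum P)).
- by move=> g x; apply: mproj_in.
- move=> x; apply: val_inj; rewrite raddf_sum /=; exact: mproj_sum.
- by move=> g x y; apply: val_inj; apply: mprojD.
- move=> g h x xg; apply: val_inj; rewrite /= (mproj_id _ xg).
  by case: ifP.
Qed.

Lemma fix_compZ g h (a : A) (v : Q) :
  gcomp g a -> fix_comp h v -> fix_comp (g + h) (a *: v).
Proof. exact: mcompZ. Qed.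

(** For idempotent f this is the image of f. *)
Definition gm_fix : grmod A := GrMod fix_dsum fix_compZ.

Lemma fix_incl_linear : linear (fun v : gm_fix => submod_val v : P).
Proof. by []. Qed.
Definition fix_incl : {linear gm_fix -> P} := mklin fix_incl_linear.

Section Corestrict.
Variables (R : grmod A) (h : {linear R -> P}).
Hypothesis fh : forall v, f (h v) = h v.

Lemma corestr_in v : h v \in fixpts.
Proof. exact/eqP/fh. Qed.
Lemma corestr_linear : linear (fun v => SubMod (corestr_in v) : gm_fix).
Proof. by move=> k x y; apply: val_inj; rewrite /= linearP. Qed.
Definition corestr : {linear R -> gm_fix} := mklin corestr_linear.
Lemma corestrE v : submod_val (corestr v) = h v.
Proof. by rewrite mklinE. Qed.
End Corestrict.

Lemma fix_inclE v : fix_incl v = submod_val v.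
Proof. exact: mklinE. Qed.

Lemma fix_retract : cancel fix_incl (corestr (h := f) ff).
Proof. by move=> v; apply: val_inj; rewrite /= corestrE fix_inclE fixptsE. Qed.

Lemma gm_fix_fg : finitely_generated P -> finitely_generated gm_fix.
Proof. exact: fg_retract fix_retract. Qed.

Lemma gm_fix_projective : projective P -> projective gm_fix.
Proof. exact: projective_retract fix_retract. Qed.

End FixedPoints.

Section RegularModule.
Variables (G : finZmodType) (F : fieldType) (A : gralg G F).

Definition reg_comp (g : G) (v : A^o) : Prop := @gcomp G F A g v.

Lemma reg_dsum : is_direct_sum reg_comp.
Proof. by case: (gcomp_dsum A) => *; split. Qed.

Lemma reg_compZ g h (a : A) (v : A^o) :
  gcomp g a -> reg_comp h v -> reg_comp (g + h) (a *: v).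
Proof. exact: gcompM. Qed.

Definition gm_reg : grmod A := GrMod reg_dsum reg_compZ.

Lemma gm_reg_fg : finitely_generated gm_reg.
Proof.
exists [:: (1 : A^o)] => v; exists (fun=> v); rewrite big_ord1 /=.
exact: esym (mulr1 (v : A)).
Qed.

Lemma gm_reg_projective : projective gm_reg.
Proof.
move=> M N f h fs; have [m mE] := fs (h (1 : A^o)).
have kl : linear (fun a : gm_reg => (a : A) *: m).
  by move=> k x y; rewrite scalerDl scalerA.
exists (mklin kl) => v; rewrite mklinE linearZ /= mE -linearZ /=.
by congr (h _); apply: mulr1.
Qed.

End RegularModule.

Section DualBasis.
Variables (G : finZmodType) (F : fieldType) (A : gralg G F) (P : grmod A).

(** The components of a finite set of generators map a free module onto P, and P
    is a summand of it.  The coordinate functionals so obtained are replaced by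
    their homogeneous components of the degrees that make them graded. *)
Lemma graded_dual_basis : finitely_generated P -> projective P ->
  exists (I : finType) (p : I -> P) (d : I -> G) (sg : I -> P -> A),
  [/\ forall i, mcomp (d i) (p i),
      forall i a u v, sg i (a *: u + v) = a * sg i u + sg i v,
      forall i h v, mcomp h v -> gcomp (h - d i) (sg i v) &
      forall v, v = \sum_i sg i v *: p i].
Proof.
move=> [s sP] prP; pose I := ('I_(size s) * G)%type.
pose p (i : I) : P := mproj i.2 s`_i.1; pose d (i : I) := i.2.
have pd i : mcomp (d i) (p i) by apply: mproj_in.
have fl : linear (fun x : {ffun I -> A^o} => \sum_i (x i : A) *: p i).
  move=> k x y; rewrite scaler_sumr -big_split; apply: eq_bigr => i _ /=.
  by rewrite !ffunE scalerDl scalerA.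
have fs v : exists x, mklin fl x = v.
  have [c ->] := sP v; exists [ffun i : I => c i.1]; rewrite mklinE.
  transitivity (\sum_(i < size s) \sum_g c i *: p (i, g)).
    by rewrite pair_bigA; apply: eq_bigr => -[i g] _; rewrite ffunE.
  by apply: eq_bigr => i _; rewrite [in RHS](mproj_sum s`_i) scaler_sumr.
have [k kE] := prP _ _ (mklin fl) idfun fs.
pose t i (v : P) : A := k v i.
have tP i a u v : t i (a *: u + v) = a * t i u + t i v by rewrite /t linearP !ffunE.
have t0 i : t i 0 = 0 by rewrite /t linear0 ffunE.
have tD i u v : t i (u + v) = t i u + t i v.
  by have := tP i 1 u v; rewrite scale1r mul1r.
have tE v : v = \sum_i t i v *: p i by rewrite -[LHS]/(idfun v) -kE mklinE.
pose sg i (v : P) : A := \sum_g gproj (g - d i) (t i (mproj g v)).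
have sgD i u v : sg i (u + v) = sg i u + sg i v.
  by rewrite -big_split; apply: eq_bigr => g _; rewrite mprojD tD gprojD.
have sgH i h v : mcomp h v -> sg i v = gproj (h - d i) (t i v).
  move=> vh; rewrite /sg (bigD1 h) //= (mproj_id _ vh) eqxx big1 ?addr0 // => g gh.
  by rewrite (mproj_id _ vh) (negPf gh) t0 gproj0.
have sg0 i : sg i 0 = 0 by rewrite (sgH i 0 0 (mcomp0 _ _)) t0 gproj0.
have sgS i (J : Type) (r : seq J) (q : pred J) (f : J -> P) :
    sg i (\sum_(j <- r | q j) f j) = \sum_(j <- r | q j) sg i (f j).
  exact: (big_morph _ (sgD i) (sg0 i)).
exists I, p, d, sg; split=> // [i a u v|i h v vh|v].
- rewrite sgD; congr (_ + _).
  rewrite (mproj_sum u) scaler_sumr !sgS mulr_sumr; apply: eq_bigr => m _.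
  rewrite (gproj_sum a) scaler_suml sgS mulr_suml; apply: eq_bigr => h _.
  rewrite (sgH _ _ _ (mcompZ (gproj_in h a) (mproj_in m u))) (sgH _ _ _ (mproj_in m u)).
  by rewrite -[gproj h a *: _]addr0 tP t0 addr0 -addrA (gproj_mull _ _ (gproj_in h a)).
- by rewrite (sgH _ _ _ vh); apply: gproj_in.
under eq_bigr do rewrite {1}(mproj_sum v) sgS scaler_suml.
rewrite exchange_big [LHS]mproj_sum; apply: eq_bigr => m _ /=.
have vm := mproj_in m v; have := mproj_id m vm; rewrite eqxx => {1}<-.
rewrite {1}(tE (mproj m v)) mproj_bigsum; apply: eq_bigr => i _.
by rewrite (mproj_scale _ _ (pd i)) (sgH _ _ _ vm).
Qed.

End DualBasis.

(** * Divisibility of isomorphism classes and matrix units *)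

Section ClassesAndMatrixUnits.
Variables (G : finZmodType) (F : fieldType) (A E : gralg G F).
Variables (H : {set G}) (X Y : G -> E) (c : G -> E -> F).
Hypothesis B : gbasis H X Y c.

Local Notation n := (size (degs (xset H))).-1.
Let d (i : 'I_n.+1) : G := nth 0 (degs (xset H)) i.
Local Notation M := (Mx (xset H) (gtriv G F)).
Local Notation idx := (degs_idx H).
Local Notation delta i j := (delta_mx i j : M).

Lemma Mx_units : mxunits (C := M) d (fun i j => delta i j).
Proof. exact: (mxunits_delta F d). Qed.

(** A dual basis presents P by an idempotent matrix over A.  A copy of the matrix
    algebra commuting with its entries acts on P by A-linear maps, and cuts P into
    the images of the diagonal matrix units, which are shifts of one another. *)
Lemma absorbed_split (P : grmod A) : absorbs A M ->
  finitely_generated P -> projective P ->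
  exists Q : grmod A, [/\ finitely_generated Q, projective Q &
    shift_sum Q (fun t => t \in H) P].
Proof.
move=> ab fgP prP; have [I [p [e [sg [pe sgP sge dual]]]]] := graded_dual_basis fgP prP.
have sg0 i : sg i 0 = 0 by have := sgP i (-1) 0 0; rewrite scaler0 addr0 mulN1r addNr.
have sgD i u v : sg i (u + v) = sg i u + sg i v.
  by have := sgP i 1 u v; rewrite scale1r mul1r.
have sgZ i a u : sg i (a *: u) = a * sg i u.
  by have := sgP i a u 0; rewrite !addr0 sg0 addr0.
have sgS i (J : Type) (r : seq J) (q : pred J) (f : J -> P) :
    sg i (\sum_(j <- r | q j) f j) = \sum_(j <- r | q j) sg i (f j).
  exact: (big_morph _ (sgD i) (sg0 i)).
have [th [gth thC]] := ab [seq sg ij.1 (p ij.2) | ij <- enum ({: I * I})].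
have {}thC m i j : th m * sg i (p j) = sg i (p j) * th m.
  by apply: thC; apply/mapP; exists (i, j) => //; rewrite mem_enum.
pose r_fun (m : M) (v : P) : P := \sum_i (sg i v * th m) *: p i.
have r_lin m : linear (r_fun m).
  move=> a u v; rewrite scaler_sumr -big_split; apply: eq_bigr => i _ /=.
  by rewrite sgP mulrDl scalerDl !scalerA !mulrA.
(* r is an anti-homomorphism, as it acts by multiplication on the right. *)
pose r m : {linear P -> P} := mklin (r_lin m).
have rE m v : r m v = r_fun m v by exact: mklinE.
have rM m m' v : r m (r m' v) = r (m' * m) v.
  rewrite !rE; apply: eq_bigr => i _; congr (_ *: _); rewrite rmorphM /= mulrA.
  congr (_ * _); rewrite /r_fun sgS [in RHS](dual v) sgS mulr_suml; apply: eq_bigr => j _.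
  by rewrite !sgZ -!mulrA thC.
have r1 v : r 1 v = v.
  by rewrite rE [RHS]dual; apply: eq_bigr => i _; rewrite rmorph1 mulr1.
have rD (J : finType) (q : pred J) (f : J -> M) v :
    r (\sum_(j | q j) f j) v = \sum_(j | q j) r (f j) v.
  under [RHS]eq_bigr do rewrite rE; rewrite rE [RHS]exchange_big; apply: eq_bigr => i _ /=.
  by rewrite rmorph_sum mulr_sumr scaler_suml.
have r0 v : r 0 v = 0.
  by rewrite rE /r_fun big1 // => i _; rewrite rmorph0 mulr0 scale0r.
have rdeg g m h v : gcomp g m -> mcomp h v -> mcomp (h + g) (r m v).
  move=> mg vh; rewrite rE; apply: mcomp_sum => i _.
  have -> : h + g = (h - e i + g) + e i by rewrite addrAC subrK.
  by apply: mcompZ => //; apply: gcompM; [apply: sge | apply: gth].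
have MM := mu_mul Mx_units; have Md := mu_deg Mx_units.
pose o := idx 0; have d0 : d o = 0 by apply: (degs_idxK B); apply: (gbH0 B).
pose f := r (delta o o).
have fg g v : mcomp g v -> mcomp g (f v).
  by move=> vg; have := rdeg _ _ _ _ (Md o o) vg; rewrite subrr addr0.
have ff v : f (f v) = f v by rewrite /f rM MM eqxx.
(* The unit (o, i) has degree - d i, whence the sign. *)
pose a t : M := delta o (idx (- t)); pose b t : M := delta (idx (- t)) o.
have fb t v : f (r (b t) v) = r (b t) v by rewrite /f rM MM eqxx.
have idxN t : t \in H -> d (idx (- t)) = - t.
  by move=> tH; apply: (degs_idxK B); apply: (gbHN B).
exists (gm_fix fg); split; [exact: gm_fix_fg ff fgP | exact: gm_fix_projective ff prP |].
exists (fun t => r (a t) \o fix_incl fg), (fun t => corestr fg (fb t)).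
split=> [t h v tH vh|t h v tH vh|s t v sH tH|v] /=.
- rewrite fix_inclE; have := rdeg _ _ _ _ (Md o (idx (- t))) vh.
  by rewrite d0 sub0r idxN // opprK.
- rewrite /mcomp /= /fix_comp corestrE; have := rdeg _ _ _ _ (Md (idx (- t)) o) vh.
  by rewrite d0 subr0 idxN.
- apply: val_inj; rewrite /= corestrE fix_inclE rM MM.
  have -> : (idx (- t) == idx (- s)) = (s == t).
    apply/eqP/eqP => [|->] // e'; apply: oppr_inj.
    by rewrite -(idxN s) // -(idxN t) // e'.
  by case: eqP => _; [rewrite -/f fixptsE | rewrite r0].
transitivity (r (\sum_(t in H) delta (idx (- t)) (idx (- t))) v).
  by rewrite rD; apply: eq_bigr => t _; rewrite fix_inclE corestrE rM MM eqxx.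
rewrite -[RHS]r1; congr (r _ _); rewrite -[RHS](mu_one Mx_units).
rewrite (reindex_inj oppr_inj) /=.
rewrite (eq_bigl (fun t => t \in H)) => [|t]; last first.
  by apply/idP/idP => /(gbHN B); rewrite ?opprK.
rewrite -(degs_sum B (fun t => delta (idx (- - t)) (idx (- - t)))).
apply: eq_bigr => i _; rewrite opprK; congr (delta_mx _ _);
  by apply: (degs_inj B); rewrite (degs_idxK B) ?(degs_in B).
Qed.

Lemma absorbs_K0 : absorbs A M -> K0pos_act A (xset H) = K0pos A.
Proof.
move=> ab; apply/funext => k; apply/propext; split.
  move=> [_ [P [fgP prP ->]] ->]; have [R [sR kR]] := k0_act_class H P.
  by exists R; split=> //;
    [apply: shift_sum_fg sR fgP | apply: shift_sum_projective sR prP].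
move=> [P [fgP prP ->]]; have [Q [fgQ prQ sP]] := absorbed_split ab fgP prP.
exists (iso_class Q); first by exists Q.
have [R [sR ->]] := k0_act_class H Q.
exact: iso_class_eq (shift_sum_uniq sP sR).
Qed.

(** Let e be a diagonal matrix unit of a matrix subalgebra whose span contains s.
    The module A e is projective, so by hypothesis it is the sum of the shifts of
    some Q over H.  The maps between the summands are matrix units in its
    endomorphism ring e A e, which is the centraliser of the subalgebra. *)
Lemma K0_absorbs : locally_elementary A -> K0pos_act A (xset H) = K0pos A ->
  absorbs A M.
Proof.
move=> LE K0 s; have [I [dI [f [U sU]]]] := LE s; have [o] := mu_inh U.
pose e : A := f o o; have ee : e * e = e by rewrite (mu_mul U) eqxx.
have e0 : gcomp 0 e by rewrite -(subrr (dI o)); apply: (mu_deg U).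
have fl : linear (fun v : gm_reg A => (v : A) * e : gm_reg A).
  by move=> k x y; rewrite mulrDl -mulrA.
pose fe := mklin fl.
have feE v : fe v = (v : A) * e by exact: mklinE.
have feg g v : mcomp g v -> mcomp g (fe v).
  by move=> vg; rewrite feE -[g]addr0; apply: (@gcompM G F A).
have fefe v : fe (fe v) = fe v by rewrite !feE -mulrA ee.
pose P := gm_fix feg.
have [Q [io [pr [iog prg prio ioprE]]]] : exists Q : grmod A, shift_sum Q (fun t => t
  \in H) P.
  have : K0pos A (iso_class P).
    exists P; split=> //; first exact: gm_fix_fg fefe (gm_reg_fg A).
    exact: gm_fix_projective fefe (@gm_reg_projective G F A).
  rewrite -K0 => -[_ [Q [_ _ ->]] kE]; exists Q.
  have [R [sR kR]] := k0_act_class H Q; apply: shift_sum_iso sR; apply: gmod_iso_sym.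
  by rewrite -/(iso_class P R) kE kR; apply: gmod_iso_refl.
have eP : e \in fixpts fe by apply/eqP; rewrite feE ee.
pose eb : P := SubMod eP.
have valE (v : P) : (submod_val v : A) * e = submod_val v by rewrite -feE fixptsE.
have Pe (v : P) : v = (submod_val v : A) *: eb by apply: val_inj; rewrite /= -[LHS]valE.
pose k t s' : A := submod_val (io t (pr s' eb)).
have kE t s' (v : P) : submod_val (io t (pr s' v)) = (submod_val v : A) * k t s'.
  by rewrite {1}(Pe v) !linearZ.
have ke t s' : k t s' * e = k t s' by apply: valE.
have ek t s' : e * k t s' = k t s' by exact: (esym (kE t s' eb)).
have kM t s1 s2 r : t \in H -> s1 \in H -> s2 \in H -> r \in H ->
    k s2 r * k t s1 = if s1 == s2 then k t r else 0.
  move=> tH s1H s2H rH; rewrite -[LHS](kE t s1 (io s2 (pr r eb))) prio //.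
  by case: eqP => // _; rewrite linear0.
have kdeg t s' : t \in H -> s' \in H -> gcomp (t - s') (k t s').
  move=> tH s'H; have ebg : mcomp 0 eb by [].
  by have := iog _ _ _ tH (prg _ _ _ s'H ebg); rewrite sub0r addrC.
have k1 : \sum_(t in H) k t t = e.
  transitivity (\val (\sum_(t in H) io t (pr t eb))); last by rewrite ioprE.
  by rewrite raddf_sum.
(* Endomorphisms of A e act from the right, so the product of the k is reversed;
   the signs restore the degrees, H being stable under opposites. *)
pose u i j := spread f o (k (- d j) (- d i)).
have dH i : - d i \in H by apply: (gbHN B); apply: (degs_in B).
have V : mxunits d u.
  split=> [i j|i j i' j'|].
  - apply: (spread_deg o U); have -> : d i - d j = - d j - - d i by rewrite opprK addrC.
    exact: kdeg.
  - rewrite /u (spreadM U) ?ek ?ke // kM // (inj_eq oppr_inj).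
    rewrite [d i' == _](inj_eq (degs_inj B)) eq_sym; case: eqP => // _.
    by rewrite /spread big1 // => q _; rewrite mulr0 mul0r.
  have spS (J : finType) (g : J -> A) : spread f o (\sum_j g j) = \sum_j spread f o (g j).
    rewrite /spread exchange_big; apply: eq_bigr => q _ /=.
    by rewrite mulr_sumr mulr_suml.
  rewrite -spS (degs_sum B (fun t => k (- t) (- t))) (reindex_inj oppr_inj) /=.
  rewrite (eq_bigl (fun t => t \in H)) => [|t]; last first.
    by apply/idP/idP => /(gbHN B); rewrite ?opprK.
  under eq_bigr do rewrite opprK.
  rewrite k1 -(mu_one U); apply: eq_bigr => i _.
  by rewrite !(mu_mul U) eqxx (mu_mul U) eqxx.
have [th [gth thE]] := gmat_hom V.
exists th; split=> // m a /sU[q ->]; set x := \sum_i \sum_j _.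
have ux i j : u i j * x = x * u i j.
  rewrite [LHS]mulr_sumr [RHS]mulr_suml; apply: eq_bigr => i' _.
  rewrite [LHS]mulr_sumr [RHS]mulr_suml; apply: eq_bigr => j' _.
  by rewrite -scalerAr -scalerAl (spread_comm U) // ek ke.
rewrite thE [LHS]mulr_suml [RHS]mulr_sumr; apply: eq_bigr => i _.
rewrite [LHS]mulr_suml [RHS]mulr_sumr; apply: eq_bigr => j _.
by rewrite -scalerAl -scalerAr ux.
Qed.

End ClassesAndMatrixUnits.

(** * Absorption, descent and the classification *)

Section Factoring.
Variables (G : finZmodType) (F : fieldType) (A B C : gralg G F).

(** An injective graded homomorphism reflects degrees. *)
Lemma factor_through (f : {lrmorphism B -> C}) (j : {lrmorphism A -> C}) :
  is_ghom f -> is_ghom j -> injective j -> (forall b, exists a, f b = j a) ->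
  exists r : {lrmorphism B -> A}, is_ghom r /\ forall b, j (r b) = f b.
Proof.
move=> gf gj jinj /choice[r rP].
have rl : linear r by move=> k x y; apply: jinj; rewrite linearP /= -!rP linearP.
have r1 : r 1 = 1 by apply: jinj; rewrite -rP !rmorph1.
have rM : {morph r : x y / x * y} by move=> x y; apply: jinj;
  rewrite rmorphM /= -!rP rmorphM.
exists (lrmk rl r1 rM); split=> [g b bg|b]; rewrite lrmkE //.
suff -> : r b = gproj g (r b) by apply: gproj_in.
by apply: jinj; rewrite ghom_proj // -rP (gproj_id _ (gf _ _ bg)) eqxx.
Qed.

End Factoring.

Section Absorbing.
Variables (G : finZmodType) (F : fieldType) (A E : gralg G F).
Variables (H : {set G}) (X Y : G -> E) (c : G -> E -> F).
Hypothesis B : gbasis H X Y c.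
Local Notation M := (Mx (xset H) (gtriv G F)).

Lemma absorbs_hom (K L : gralg G F) (f : {lrmorphism K -> L}) :
  is_ghom f -> absorbs A L -> absorbs A K.
Proof.
move=> gf ab s; have [th [gth thC]] := ab s.
exists (th \o f); split=> [g x xg|b a as_] /=; first exact/gth/gf.
exact: thC.
Qed.

(** Through the left regular representation. *)
Lemma absorbs_mx_division : absorbs A M -> absorbs A E.
Proof. exact: absorbs_hom (lreg_ghom B). Qed.

(** A copy of E commuting with a matrix subalgebra of A is accompanied by a copy
    of the opposite algebra commuting with both, and the two generate the matrix
    algebra by [giso_bireg]. *)
Lemma absorbs_division_mx : gbcentral H X Y c -> gbcentral (E := gop E) H X Y c ->
  locally_elementary A -> absorbs A E -> absorbs A M.
Proof.
move=> cB cB' LE ab s; have [I [d [e [U sU]]]] := LE s.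
have [th [gth thC]] := ab [seq e p.1 p.2 | p <- enum ({: I * I})].
have {}thC b i j : th b * e i j = e i j * th b.
  by apply: thC; apply/mapP; exists (i, j) => //; rewrite mem_enum.
have [R [gR RC Rth]] := opposite_action B LE gth U thC.
have thR a b : th a * R b = R b * th a by rewrite Rth.
have gt : is_ghom (tpair thR) by apply: tpair_ghom.
have [_ [h [_ gh _ _]]] := giso_bireg B cB cB'.
exists (tpair thR \o h); split=> [g x xg|m a /sU[q ->]]; first exact/gt/gh.
rewrite mulr_sumr mulr_suml; apply: eq_bigr => i _.
rewrite mulr_sumr mulr_suml; apply: eq_bigr => j _.
by rewrite -scalerAr -scalerAl; congr (_ *: _); apply: tpair_comm => b.
Qed.

End Absorbing.

Section Descent.
Variables (G : finZmodType) (F : fieldType) (A E C : gralg G F).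
Variables (H : {set G}) (X Y : G -> E) (c : G -> E -> F).
Hypotheses (B : gbasis H X Y c) (cB : gbcentral H X Y c).

(** The opposite of 1 tensor E found in the elementary algebra commutes with
    1 tensor E, hence lies in N tensor 1. *)
Lemma opposite_in_factor (N : gralg G F) (I : finType) (d : I -> G) (e : I -> I -> N) :
  locally_elementary C -> giso (gtens N E) C -> mxunits d e ->
  exists r : {lrmorphism gop E -> N}, is_ghom r /\
    forall b i j, r b * e i j = e i j * r b.
Proof.
move=> LC [f [h [gf gh fK hK]]] U.
pose th : {lrmorphism E -> C} := f \o tinr N E.
pose j : {lrmorphism N -> C} := f \o tinl N E.
have gth : is_ghom th by move=> g x xg; apply/gf/tinr_ghom.
have gj : is_ghom j by move=> g x xg; apply/gf/tinl_ghom.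
have thj a x : th a * j x = j x * th a by rewrite /= -!rmorphM tinlr_comm.
have [R [gR RV Rth]] :=
  opposite_action B LC gth (mxunits_map gj U) (fun a k l => thj a (e k l)).
have inj := tinl_inj (A := N) B.
have [r [gr rE]] : exists r : {lrmorphism gop E -> N},
    is_ghom r /\ forall b, tinl N E (r b) = (h \o R) b.
  apply: factor_through => //; [by move=> g x xg; apply/gh/gR | exact: tinl_ghom |].
  move=> b; eexists; apply: (tens_centralizer B cB) => a.
  by rewrite /= -(fK (tinr _ _ a)) -!rmorphM; congr (h _); apply: Rth.
exists r; split=> // b k l; apply: inj.
rewrite !rmorphM /= rE /= -(fK (tinl _ _ (e k l))) -!rmorphM.
by congr (h _); apply: RV.
Qed.

Variables (n : nat) (d : 'I_n.+1 -> G).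
Local Notation M := (gmat (gtriv G F) d).

(** The copy of the opposite algebra commutes with the matrix factor M, hence
    lies in A, and there it commutes with a given finite set. *)
Lemma absorbs_op : locally_elementary A -> locally_elementary C ->
  giso (gtens (gtens M A) E) C -> absorbs A (gop E).
Proof.
move=> LA LC iso s; have [I [dI [e [U sU]]]] := LA s.
have [r [gr rV]] :=
  opposite_in_factor LC iso (mxunits_tens (mxunits_delta F d) U).
have rl b k l : r b * tinl M A (delta_mx k l) = tinl M A (delta_mx k l) * r b.
  rewrite tinlE -(mu_one U) pure_sumr mulr_sumr mulr_suml.
  by apply: eq_bigr => i _; apply: (rV b (k, i) (l, i)).
have rr b k l : r b * tinr M A (e k l) = tinr M A (e k l) * r b.
  rewrite tinrE -(mu_one (mxunits_delta F d)) pure_suml mulr_sumr mulr_suml.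
  by apply: eq_bigr => i _; apply: (rV b (i, k) (i, l)).
have inj := mx_tinr_inj (E := A) (d := d).
have [t [gt tE]] : exists t : {lrmorphism gop E -> A},
    is_ghom t /\ forall b, tinr M A (t b) = r b.
  apply: factor_through => //; first exact: tinr_ghom.
  move=> b; apply: mx_centralizer => m; rewrite (gmat_sum_delta m).
  rewrite !linear_sum mulr_sumr mulr_suml; apply: eq_bigr => k _.
  rewrite !linear_sum mulr_sumr mulr_suml; apply: eq_bigr => l _.
  by rewrite !linearZ /= -scalerAr -scalerAl rl.
exists t; split=> // b a /sU[q ->].
rewrite mulr_sumr mulr_suml; apply: eq_bigr => k _.
rewrite mulr_sumr mulr_suml; apply: eq_bigr => l _.
rewrite -scalerAr -scalerAl; congr (_ *: _); apply: inj.
by rewrite !rmorphM /= tE rr.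
Qed.

End Descent.

Theorem theorem22 (F : closedFieldType) (G : finZmodType)
    (A A' D D' E : gralg G F) (y : {ffun G -> nat})
    (limA : limit_of_elementary A) (limA' : limit_of_elementary A')
    (divD : graded_division D) (csD : central_simple D)
    (divD' : graded_division D') (csD' : central_simple D')
    (y_neq0 : y != [ffun=> 0%N]) (divE : graded_division E)
    (isoE : giso (gtens D (gop D')) (Mx y E)) :
  giso (gtens A D) (gtens A' D') <->
  K0pos_act A (xset (supp E)) = K0pos A /\
  giso (gtens (Mx y (gtriv G F)) A)
       (gtens (Mx (xset (supp D')) (gtriv G F)) A').
Proof.
have [fdD _ cD] := csD; have [fdD' _ cD'] := csD'.
have [X' [Y' [c' B']]] := gbasis_exists divD' fdD'.
have cB' := gb_central B' cD'.
have Bo' := gbasis_op B'; have cBo' := gb_central Bo' (op_central cD').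
have cE : central_algebra E.
  exact: gmat_central (iso_central isoE (tens_central Bo' cBo' cD)).
have fdE : finite_dimensional E.
  have [f [h [gf gh fK hK]]] := isoE.
  apply: (@gmat_fd _ _ _ _ _); apply: (fd_surj (f := f)) (fd_tens fdD (op_fd fdD')).
    exact: linearP.
  by move=> b; exists (h b).
have [X [Y [c B]]] := gbasis_exists divE fdE.
have cB := gb_central B cE.
have Bo := gbasis_op B; have cBo := gb_central Bo (op_central cE).
have Boo := gbasis_op Bo.
have cBoo := gb_central Boo (op_central (op_central cE)).
have LA := limit_locally_elementary limA; have LA' := limit_locally_elementary limA'.
have [u spu] := limit_spanned limA.
set My := Mx y (gtriv G F); set MT := Mx _ (gtriv G F).
have isoL : giso (gtens (gtens A D) (gop D')) (gtens (gtens My A) E).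
  apply: giso_trans (giso_tensA _ _ _) _.
  apply: giso_trans (giso_tens (giso_refl _) isoE) _.
  apply: giso_trans (giso_tens (giso_refl _) (giso_sym (giso_gmat _ _))) _.
  apply: giso_trans (giso_sym (giso_tensA _ _ _)) _.
  exact: giso_tens (giso_tensC _ _) (giso_refl _).
have isoR : giso (gtens (gtens A' D') (gop D')) (gtens MT A').
  apply: giso_trans (giso_tensA _ _ _) _.
  apply: giso_trans (giso_tens (giso_refl _) (giso_bireg B' cB' cBo')) _.
  exact: giso_tensC.
have LR : locally_elementary (gtens MT A').
  by apply: locally_elementary_tens LA'; apply: locally_elementary_mx.
have isoA : absorbs A (Mx (xset (supp E)) (gtriv G F)) -> giso A (gtens A E).
  by move=> /(absorbs_mx_division B); apply: absorb_iso B cB _ spu.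
have isoM : giso A (gtens A E) -> giso (gtens My A) (gtens (gtens My A) E).
  move=> AE; apply: giso_trans (giso_tens (giso_refl My) AE) _.
  exact: giso_sym (giso_tensA _ _ _).
split=> [iso|[K0 iso]].
  have isoC : giso (gtens (gtens My A) E) (gtens MT A').
    apply: giso_trans (giso_sym isoL) _; apply: giso_trans isoR.
    exact: giso_tens iso (giso_refl _).
  have ab : absorbs A (Mx (xset (supp E)) (gtriv G F)).
    apply: (absorbs_division_mx Bo cBo cBoo LA).
    exact: (absorbs_op B cB LA LR isoC).
  split; first exact: absorbs_K0 B ab.
  exact: giso_trans (isoM (isoA ab)) isoC.
have AE := isoA (K0_absorbs B LA K0).
apply: (giso_cancel Bo' cBo'); first exact: locally_elementary_iso (giso_sym isoR) LR.
apply: giso_trans isoL _; apply: giso_trans (giso_sym (isoM AE)) _.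
exact: giso_trans iso (giso_sym isoR).
Qed.
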